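(* Let $X$ be a Polish space equipped with a Borel probability measure $\mu$, and let $G$ be a locally finite one-ended Borel graph on $X$. Then: (i) There is a $G$-invariant comeagre Borel set $X'\subseteq X$ such that $G|_{X'}$ admits a Borel one-ended spanning tree. (ii) If $G$ is induced by a free Borel action of an amenable group, then there is a $G$-invariant $\mu$-conull Borel set $X'\subseteq X$ such that $G|_{X'}$ admits a Borel one-ended spanning tree. (iii) If $G$ is induced by a free Borel action of a group of polynomial growth, then $G$ admits a Borel one-ended spanning tree (on all of $X$).
   Context: A Borel graph $G$ on a Polish space $X$ is a (simple, undirected) graph with vertex set $V(G)=X$ whose edge set $E(G)$ is a Borel subset of $X^2$. A connected graph is one-ended if for every finite set $F$ of vertices the induced subgraph on the complement of $F$ has exactly one infinite connected component; a non-connected graph is one-ended if each of its connected components is. A set $X'\subseteq X$ is $G$-invariant if it is a union of connected components of $G$; $G|_{X'}$ is the induced subgraph. A Borel one-ended spanning tree of $G$ is an acyclic Borel subgraph $T$ of $G$ with the same vertex set, whose restriction to each connected component of $G$ is a spanning tree of that component (connected), and which is one-ended (each of these trees is one-ended). ''$G$ is induced by a free Borel action of $\Gamma$'' means that $\Gamma$ is a finitely generated (discrete) group with finite generating set $S$, acting freely and in a Borel way on $X$, and $G$ is the Schreier graph of the action: $x\ne y$ are adjacent iff $y=s\cdot x$ or $x=s\cdot y$ for some $s\in S$. *)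

(* Defs.v *)
From HB Require Import structures.
From mathcomp Require Import all_boot all_order all_algebra.
From mathcomp Require Import all_classical all_reals all_analysis.

Set Implicit Arguments.
Unset Strict Implicit.
Unset Printing Implicit Defensive.

Import Order.TTheory GRing.Theory Num.Theory.
Import numFieldNormedType.Exports.

Local Open Scope classical_set_scope.
Local Open Scope ring_scope.

(** * Topology *)

Definition completely_metrizable (R : realType) (X : topologicalType) :=
  exists d : X -> X -> R,
    [/\ (forall x y, d x y = 0 <-> x = y),
        (forall x y, d x y = d y x),
        (forall x y z, d x z <= d x y + d y z),
        (forall (x : X) (A : set X),
           nbhs x A <-> exists2 e : R, 0 < e & [set y | d x y < e] `<=` A) &
        (forall u : nat -> X,
           (forall e : R, 0 < e -> exists N : nat, forall m n : nat,
              (N <= m)%N -> (N <= n)%N -> d (u m) (u n) < e) ->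
           exists x : X, u @ \oo --> x)].

Definition separable_space (X : topologicalType) :=
  exists2 D : set X, countable D & dense D.

Definition polish (R : realType) (X : topologicalType) :=
  separable_space X /\ completely_metrizable R X.

Definition borel (X : topologicalType) : set (set X) := <<s @open X >>.

Definition nowhere_dense (X : topologicalType) (A : set X) :=
  (closure A)° = set0.

Definition meagre (X : topologicalType) (A : set X) :=
  exists2 F : nat -> set X,
    forall n, nowhere_dense (F n) & A `<=` \bigcup_n F n.

Definition comeagre (X : topologicalType) (A : set X) := meagre (~` A).

(** * Graphs whose vertices form a subset of [X] *)

Record sgraph (X : choiceType) := SGraph {
  vset : set X;
  adj : rel X;
  adj_vset : forall x y, adj x y -> vset x /\ vset y;
  adj_sym : symmetric adj;
  adj_irr : irreflexive adj
}.

Section Graphs.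
Variable X : choiceType.
Implicit Types (G T : sgraph X) (A C F : set X).

Definition induced_adj G A : rel X :=
  fun x y => [&& adj G x y, x \in A & y \in A].

Lemma induced_adj_vset G A x y :
  induced_adj G A x y -> (vset G `&` A) x /\ (vset G `&` A) y.
Proof. by move=> /and3P[/adj_vset[Gx Gy] /set_mem Ax /set_mem Ay]. Qed.

Lemma induced_adj_sym G A : symmetric (induced_adj G A).
Proof. by move=> x y; rewrite /induced_adj adj_sym (andbC (x \in A)). Qed.

Lemma induced_adj_irr G A : irreflexive (induced_adj G A).
Proof. by move=> x; rewrite /induced_adj adj_irr. Qed.

Definition induced_sgraph G A : sgraph X :=
  SGraph (@induced_adj_vset G A) (@induced_adj_sym G A) (@induced_adj_irr G A).

Definition reachable G (x y : X) :=
  exists2 p : seq X, path (adj G) x p & last x p = y.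

Definition connected_graph G :=
  forall x y, vset G x -> vset G y -> reachable G x y.

Definition graph_component G C :=
  exists2 x, vset G x & C = [set y | reachable G x y].

Definition graph_invariant G A :=
  exists2 P : set (set X), P `<=` graph_component G & A = \bigcup_(C in P) C.

Definition locally_finite_graph G :=
  forall x, vset G x -> finite_set [set y | adj G x y].

(* The bound on the size discards the degenerate closed walks x-y-x. *)
Definition acyclic_graph G :=
  forall p : seq X, (2 < size p)%N -> ~ ucycle (adj G) p.

(* Meaningful for connected graphs only; see one_ended_graph for the general case. *)
Definition connected_one_ended G :=
  forall F, F `<=` vset G -> finite_set F ->
    exists! C, graph_component (induced_sgraph G (~` F)) C /\ infinite_set C.

Definition one_ended_graph G :=
  forall C, graph_component G C -> connected_one_ended (induced_sgraph G C).

End Graphs.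

Definition borel_edges (X : topologicalType) (G : sgraph X) :=
  borel [set p : X * X | adj G p.1 p.2].

Definition borel_graph (X : topologicalType) (G : sgraph X) :=
  vset G = setT /\ borel_edges G.

Definition borel_one_ended_spanning_tree (X : topologicalType)
    (G T : sgraph X) :=
  [/\ vset T = vset G /\ (forall x y, adj T x y -> adj G x y),
      borel_edges T,
      acyclic_graph T,
      (forall C, graph_component G C -> connected_graph (induced_sgraph T C)) &
      one_ended_graph T].

Definition admits_borel_one_ended_spanning_tree (X : topologicalType)
    (G : sgraph X) :=
  exists T : sgraph X, borel_one_ended_spanning_tree G T.

(** * Groups and actions *)

Section Groups.
Variable Gam : groupType.
Implicit Types (S : seq Gam) (g h : Gam).

(* The ball of radius n around 1 in the word metric of S. *)
Definition word_ball S (n : nat) : set Gam :=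
  [set g | exists s : seq Gam,
     [/\ (size s <= n)%N, {in s, forall a, (a \in S) || (a^-1%g \in S)} &
         g = (\prod_(a <- s) a)%g]].

Definition generates S := forall g, exists n, word_ball S n g.

Definition polynomial_growth :=
  exists S, generates S /\
    exists c d : nat, forall n : nat, (0 < n)%N ->
      (word_ball S n #<= `I_(c * n ^ d))%card.

(* Existence of a left-invariant finitely additive probability on Gam. *)
Definition amenable (R : realType) :=
  exists m : set Gam -> R,
    [/\ m setT = 1,
        (forall A, 0 <= m A),
        (forall A B, A `&` B = set0 -> m (A `|` B) = m A + m B) &
        (forall g A, m [set (g * h)%g | h in A] = m A)].

Definition free_borel_action (X : topologicalType) (a : Gam -> X -> X) :=
  [/\ (forall x, a 1%g x = x),
      (forall g h x, a (g * h)%g x = a g (a h x)),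
      (forall g B, borel B -> borel (a g @^-1` B)) &
      (forall g x, a g x = x -> g = 1%g)].

Definition schreier_graph_of (X : topologicalType) (a : Gam -> X -> X) S
    (G : sgraph X) :=
  forall x y, adj G x y <->
    x <> y /\ exists2 s, s \in S & y = a s x \/ x = a s y.

Definition induced_by_free_borel_action (X : topologicalType) (G : sgraph X) :=
  exists (S : seq Gam) (a : Gam -> X -> X),
    [/\ generates S, free_borel_action a & schreier_graph_of a S G].

End Groups.

(* Main.v *)
(** The tree is the graph of a Borel map [f] with [f x] adjacent to [x], such that
    backward orbits are finite and any two forward orbits in a component meet; such a
    tree is one-ended. The map comes from a decreasing sequence of Borel sets [H n],
    [H 0] being the whole space, whose complements consist of finite pockets around
    which there are detours of bounded length inside [H n]: on each (finite) component
    of [H n \ H n.+1], [f] flows to a root adjacent to [H n.+1]. Forward orbits meet in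
    a component as soon as, for infinitely many [n], [H n.+1] avoids a ball around a
    fixed vertex whose radius is large compared to the length of the detours in [H n].

    To pass from [H n] to [H n.+1], one hollows out families of disjoint finite pieces,
    keeping only a connected ring that separates the inside of the piece from the rest
    of the graph. One-endedness provides pieces whose inside contains a given ball, and
    a Baire category argument along a branch of choices gives (i). For an amenable group,
    the pieces are connected Folner sets with rings of small density; hollowing them out
    greedily clears a fixed fraction of the measure, hence after iteration all but an
    arbitrarily small part of it, and (ii) follows as in the Borel-Cantelli lemma. For a
    group of polynomial growth, at a scale where the growth is doubling, a counting
    argument gives boundedly many rings in a large ball, each vertex of the core being
    far from one of them. The resulting layers clear the whole space, and their number
    does not depend on the radius to clear, so that finitely many sequences [H n] run in
    parallel take care of all the vertices, which gives (iii).

    Both (ii) and (iii) use that a one-ended group has at least quadratic growth: by the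
    Morse-Hedlund argument applied to the ShortLex words, otherwise its spheres have
    bounded size infinitely often, and then a level set of a Busemann function is a
    finite set separating two infinite parts. *)

Require Import Defs.
From HB Require Import structures.
From mathcomp Require Import all_boot all_order all_algebra.
From mathcomp Require Import all_classical all_reals all_analysis.
From mathcomp Require Import zify ring lra.

Set Implicit Arguments.
Unset Strict Implicit.
Unset Printing Implicit Defensive.

Import Order.TTheory GRing.Theory Num.Theory.
Import numFieldNormedType.Exports.

Local Open Scope classical_set_scope.

(** * Detours and hollowed pieces *)

(** Hollowing is not decreasing: a ring put back by [layer_op] may lie outside the set being
    hollowed. It is monotone, however, so a new stage is applied to the whole space before the older
    ones: [H n.+1] is the image under the old stages of a smaller set than for [H n]. The price is
    that old stages may displace the new hollow by their total diameter; the radius to clear at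
    stage [n] thus depends on the earlier stages, and every construction must produce its stages one
    after the other.

    Rings are connected so that a path through a piece can follow the ring instead. As the pieces of
    a layer are disjoint, a layer only adds its diameter to the length of detours.

    Superlinear growth enters as [r / |B(r)| -> 0]. Linking the points of an [r]-net of a set by
    paths of length of order [r] uses a proportion of order [r / |B(r)|] of its points; at a
    doubling scale, a geodesic of length of order [r] with endpoints averaged over [r]-balls passes
    near a given point with a probability of that order.

    The probability need not be invariant under the action: in (ii) masses are averaged over the
    translates of a partition by the elements of a piece. *)

Section Connectivity.
Variables (X : Type) (adj : X -> X -> Prop).
Implicit Types (A Y : set X) (x y z u v w : X).

Inductive conn A : X -> X -> Prop :=
| conn_refl x : A x -> conn A x x
| conn_step x y z : A x -> adj x y -> conn A y z -> conn A x z.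

Fixpoint nearby d x y : Prop :=
  if d is d'.+1 then nearby d' x y \/ exists2 z, adj x z & nearby d' z y else x = y.

Lemma conn_l A x y : conn A x y -> A x.
Proof. by case. Qed.

Lemma conn_r A x y : conn A x y -> A y.
Proof. by elim. Qed.

Lemma conn_trans A x y z : conn A x y -> conn A y z -> conn A x z.
Proof. by elim=> // {}x u v Ax xu _ IH /IH; apply: conn_step. Qed.

Lemma conn_edge A x y : A x -> A y -> adj x y -> conn A x y.
Proof. by move=> Ax Ay xy; apply: conn_step xy _ => //; apply: conn_refl. Qed.

Lemma conn_sub A A' x y : A `<=` A' -> conn A x y -> conn A' x y.
Proof.
move=> AA'; elim=> [u Au|u v w Au uv _ IH]; first exact/conn_refl/AA'.
by apply: conn_step uv IH; apply: AA'.
Qed.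

Lemma conn_closed A (D : set X) x y :
  (forall u v, D u -> A v -> adj u v -> D v) -> D x -> conn A x y -> D y.
Proof.
move=> Dcl + cxy; elim: cxy => [//|u v w Au uv vw IH Du]; apply: IH.
by apply: (Dcl _ _ Du _ uv); apply: conn_l vw.
Qed.

Lemma conn_inside A (D : set X) x y :
  (forall u v, D u -> A v -> adj u v -> D v) -> D x -> conn A x y ->
  conn (A `&` D) x y.
Proof.
move=> Dcl + cxy; elim: cxy => [u Au Du|u v w Au uv vw IH Du].
  exact: conn_refl.
apply: (conn_step _ uv (IH _)) => //; apply: (Dcl _ _ Du _ uv).
exact: conn_l vw.
Qed.

Lemma conn_first A (D : set X) x y : conn A x y -> D x \/ D y ->
  exists z, [/\ A z, D z & z = x \/ exists2 t, conn (A `\` D) x t & adj t z].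
Proof.
elim=> [u Au|u v w Au uv vw IH] Dxy.
  by exists u; split; [|case: Dxy|left].
case: (pselect (D u)) => Du; first by exists u; split=> //; left.
have Dw : D w by case: Dxy.
have {IH} [z [Az Dz [eqz|[t vt tz]]]] := IH (or_intror Dw).
- rewrite eqz in Az Dz; exists v; split=> //.
  by right; exists u => //; apply: conn_refl.
- case: (pselect (D v)) => Dv.
    exists v; split=> //; first exact: conn_l vw.
    by right; exists u => //; apply: conn_refl.
  exists z; split=> //; right; exists t => //.
  by apply: conn_step uv vt; split.
Qed.

Hypothesis adjC : forall x y, adj x y -> adj y x.

Lemma conn_sym A x y : conn A x y -> conn A y x.
Proof.
elim=> [u Au|u v w Au uv vw IH]; first exact: conn_refl.
apply: conn_trans IH _; apply: conn_edge => //; last exact: adjC.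
exact: conn_l vw.
Qed.

Lemma nearby_refl d x : nearby d x x.
Proof. by elim: d => //= d IH; left. Qed.

Lemma nearby_leq d e x y : d <= e -> nearby d x y -> nearby e x y.
Proof.
move=> /subnK <-; elim: (e - d)%N => // k IH dxy.
by rewrite addSn /=; left; apply: IH.
Qed.

Lemma nearby_trans d e x y z : nearby d x y -> nearby e y z -> nearby (d + e) x z.
Proof.
elim: d x => [x -> //|d IH x /= [dxy|[t xt dty]] yz]; first by left; apply: IH.
by right; exists t => //; apply: IH.
Qed.

Lemma nearby_edge x y : adj x y -> nearby 1 x y.
Proof. by move=> xy; right; exists y. Qed.

Lemma nearby_sym d x y : nearby d x y -> nearby d y x.
Proof.
elim: d x => [x -> //|d IH x /= [/IH|[z /adjC xz /IH yz]]]; first by left.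
have := nearby_trans yz (nearby_edge xz).
by rewrite addn1.
Qed.

Lemma nearby_conn d x y : nearby d x y -> conn setT x y.
Proof.
elim: d x => [x ->|d IH x /= [/IH //|[z xz /IH zy]]]; first exact: conn_refl.
exact: conn_step xz zy.
Qed.

Lemma conn_nearby A x y : conn A x y -> exists d, nearby d x y.
Proof.
elim=> [u _|u v w _ uv _ [d vw]]; first by exists 0%N.
by exists d.+1; right; exists v.
Qed.

Hypothesis locfin : forall x, finite_set [set y | adj x y].

Lemma nearby_finite d x : finite_set [set y | nearby d x y].
Proof.
elim: d x => [x|d IH x] /=.
  by apply: (@sub_finite_set _ _ [set x]) => // y /= ->.
apply: (@sub_finite_set _ _ ([set y | nearby d x y] `|`
   \bigcup_(z in [set z | adj x z]) [set y | nearby d z y])).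
  by move=> y [dxy|[z xz dzy]]; [left|right; exists z].
by rewrite finite_setU; split=> //; apply: bigcup_finite.
Qed.

(** The vertices at which a path from [x] can first meet [Y]; the vertices of one component of the
    complement of [Y] (a pocket) have the same exits. *)
Definition exit_of Y x u := Y u /\ (x = u \/ exists2 z, conn (~` Y) x z & adj z u).

(* Paths through the complement of [Y] can be rerouted locally along [Y]. *)
Definition bypassed D Y :=
  (forall x, exists u, exit_of Y x u) /\
  (forall x u v, exit_of Y x u -> exit_of Y x v ->
     conn (Y `&` [set w | nearby D x w]) u v).

Lemma exit_in Y x u : Y x -> exit_of Y x u -> u = x.
Proof. by move=> Yx [_ [//|[z /conn_l]]]. Qed.

Lemma exit_self Y x : Y x -> exit_of Y x x.
Proof. by move=> Yx; split=> //; left. Qed.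

Lemma exit_ex Y x y : conn setT x y -> Y y -> exists u, exit_of Y x u.
Proof.
move=> /conn_first h Yy; have [u [_ Yu xu]] := h Y (or_intror Yy).
exists u; split=> //; case: xu => [->|[t xt tu]]; first by left.
by right; exists t => //; apply: conn_sub xt => z [].
Qed.

Lemma exit_conn Y x u : exit_of Y x u -> conn setT x u.
Proof.
move=> [_ [->|[z xz zu]]]; first exact: conn_refl.
by apply: conn_trans (conn_sub _ xz) _ => //; apply: conn_edge.
Qed.

Lemma exit_shift Y x z u : conn (~` Y) x z -> exit_of Y z u -> exit_of Y x u.
Proof.
move=> xz [Yu zu]; split=> //; case: zu => [eq_zu|[t zt tu]].
  by case: (conn_r xz); rewrite eq_zu.
by right; exists t => //; apply: conn_trans xz zt.
Qed.

Lemma bypassed_setT : bypassed 0 setT.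
Proof.
split=> [x|x u v xu xv]; first by exists x; apply: exit_self.
by rewrite -(exit_in I xu) (exit_in I xv) (exit_in I xu); apply: conn_refl.
Qed.

Lemma bypassed_leq D D' Y : D <= D' -> bypassed D Y -> bypassed D' Y.
Proof.
move=> DD' [h1 h2]; split=> // x u v xu xv.
by apply: conn_sub (h2 _ _ _ xu xv) => z [Yz xz]; split=> //; apply: nearby_leq xz.
Qed.

Lemma bypassed_nearby D Y x u : bypassed D Y -> exit_of Y x u -> nearby D x u.
Proof. by move=> [_ h] xu; have /conn_l[] := h _ _ _ xu xu. Qed.

(** If an endpoint of the edge lies outside [Y], both [u] and [v] are exits of that endpoint, so a
    single detour suffices. The radius grows by one because the detour may be centred at [y]. *)
Lemma bypassed_edge D Y x y u v : bypassed D Y -> adj x y ->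
  exit_of Y x u -> exit_of Y y v ->
  conn (Y `&` [set w | nearby D.+1 x w]) u v.
Proof.
move=> hY xy xu yv.
have ball1 z w : nearby D z w -> z = x \/ z = y -> nearby D.+1 x w.
  move=> zw [<-|eqz]; first exact: nearby_leq zw.
  by rewrite -add1n; apply: nearby_trans (nearby_edge xy) _; rewrite -eqz.
case: (pselect (Y x)) => Yx; case: (pselect (Y y)) => Yy.
- rewrite (exit_in Yx xu) (exit_in Yy yv); apply: conn_edge => //; split=> //.
    exact: nearby_refl.
  by apply: nearby_leq (nearby_edge xy); lia.
- rewrite (exit_in Yx xu).
  have yx : exit_of Y y x.
    by split=> //; right; exists y; [apply: conn_refl|apply: adjC].
  apply: conn_sub (hY.2 _ _ _ yx yv) => w [Yw yw]; split=> //.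
  by apply: ball1 yw _; right.
- rewrite (exit_in Yy yv).
  have xy' : exit_of Y x y by split=> //; right; exists x => //; apply: conn_refl.
  apply: conn_sub (hY.2 _ _ _ xu xy') => w [Yw yw]; split=> //.
  by apply: ball1 yw _; left.
- have xv : exit_of Y x v by apply: exit_shift yv; apply: conn_edge.
  apply: conn_sub (hY.2 _ _ _ xu xv) => w [Yw yw]; split=> //.
  by apply: ball1 yw _; left.
Qed.

Lemma bypassed_conn D Y x y u v : bypassed D Y -> conn setT x y ->
  exit_of Y x u -> exit_of Y y v -> conn Y u v.
Proof.
move=> hY xy; elim: xy u v => [z _ u v zu zv|{}x z {}y _ xz _ IH u v xu yv].
  by apply: conn_sub (hY.2 _ _ _ zu zv) => w [].
have [t zt] := hY.1 z; apply: conn_trans (IH _ _ zt yv).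
by apply: conn_sub (bypassed_edge hY xz xu zt) => w [].
Qed.

(** The vertices of a pocket share an exit and lie within distance [D] of it. *)
Lemma bypassed_finite D Y x : bypassed D Y -> finite_set [set z | conn (~` Y) x z].
Proof.
move=> hY; have [u xu] := hY.1 x.
apply: sub_finite_set (nearby_finite D u) => z /= xz.
by apply: nearby_sym; apply: bypassed_nearby hY _; apply: exit_shift xu; apply: conn_sym.
Qed.

Hypothesis infc : forall x, infinite_set [set y | conn setT x y].

Section Operation.
Variables (d : nat) (B : set X) (P R : X -> set X).

(** The third clause is the separation property: an edge leaving the inside [P y \ R y] ends in the
    ring. *)
Definition layer_valid :=
  [/\ forall y, B y -> R y `<=` P y,
      forall y u v, B y -> R y u -> R y v -> conn (R y) u v,
      forall y z w, B y -> P y z -> ~ R y z -> adj z w -> P y w,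
      forall y y' z, B y -> B y' -> P y z -> P y' z -> y = y' &
      forall y z w, B y -> P y z -> P y w -> nearby d z w].

(* Removes the inside [P y \ R y] of each piece and adds its ring [R y] back
   as soon as the ring is touched. *)
Definition layer_op Y : set X :=
  [set z | (Y z /\ ~ exists y, [/\ B y, P y z & ~ R y z]) \/
           exists y, [/\ B y, R y z & exists2 w, R y w & Y w]].

Hypothesis valid : layer_valid.

(** Otherwise the part of [Y] inside the piece could never leave it. As [Y] is connected within a
    component and comes within [D] of each of its vertices, the whole component would be finite. *)
Lemma layer_touch D Y y w : bypassed D Y -> B y -> Y w -> P y w -> ~ R y w ->
  exists2 r, R y r & Y r.
Proof.
move=> hY By Yw Pw nRw; apply: contrapT => ntouch.
have [RP _ Pcl _ Pdiam] := valid.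
apply: (@infc w); apply: sub_finite_set (nearby_finite (d + D) w) => z /= wz.
have [u zu] := hY.1 z.
have wu : conn Y w u by apply: bypassed_conn hY wz (exit_self Yw) zu.
have [Pu _] : P y u /\ ~ R y u.
  apply: (conn_closed (D := [set z | P y z /\ ~ R y z])) wu => // a b [Pa nRa] Yb ab.
  by split; [apply: Pcl ab|move=> Rb; apply: ntouch; exists b].
apply: nearby_trans (Pdiam _ _ _ By Pw Pu) _.
exact/nearby_sym/(bypassed_nearby hY).
Qed.

Lemma layer_op_nearby Y z : layer_op Y z -> exists2 w, Y w & nearby d z w.
Proof.
have [RP _ _ _ Pdiam] := valid.
move=> [[Yz _]|[y [By Rz [w Rw Yw]]]]; first by exists z => //; apply: nearby_refl.
by exists w => //; apply: Pdiam By (RP _ By _ Rz) (RP _ By _ Rw).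
Qed.

(** A stretch of a path in [Y] through the inside of a touched piece is replaced by a path in the
    ring of that piece. The new vertices are within [d] of a vertex of the old path, and pieces are
    disjoint, so detours do not accumulate inside a layer. *)
Lemma bypassed_layer_op D Y : bypassed D Y -> bypassed (D + d) (layer_op Y).
Proof.
move=> hY; have [RP Rconn Pcl Pdisj Pdiam] := valid.
set Y' := layer_op Y.
have inY' y z : B y -> P y z -> Y' z -> R y z.
  move=> By Pz [[Yz nz]|[y' [By' Rz _]]].
    by apply: contrapT => nR; apply: nz; exists y.
  by rewrite (Pdisj _ _ _ By By' Pz (RP _ By' _ Rz)).
have YY' z : Y z -> (Y' z) \/ exists y, [/\ B y, P y z, ~ R y z & exists2 r, R y r & Y r].
  move=> Yz; case: (pselect (exists y, [/\ B y, P y z & ~ R y z])) => [[y [By Pz nRz]]|nex].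
    by right; exists y; split=> //; apply: layer_touch hY By Yz Pz nRz.
  by left; left.
have ringY' y r : B y -> (exists2 r, R y r & Y r) -> R y r -> Y' r.
  by move=> By tch Rr; right; exists y.
split=> [x|x u v xu xv].
  have [u xu] := hY.1 x.
  case: (YY' u xu.1) => [Y'u|[y [By Pu nRu [r Rr Yr]]]].
    by apply: (@exit_ex Y' x u) => //; apply: exit_conn xu.
  apply: (@exit_ex Y' x r); last first.
    exact: (ringY' _ _ By (ex_intro2 _ _ r Rr Yr) Rr).
  apply: conn_trans (exit_conn xu) _; apply: (nearby_conn (d := d)).
  by apply: Pdiam By Pu (RP _ By _ Rr).
case: (pselect (Y' x)) => [Y'x|nY'x].
  rewrite (exit_in Y'x xu) (exit_in Y'x xv); apply: conn_refl; split=> //.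
  exact: nearby_refl.
(* If the pocket of [x] reaches the inside of a touched piece, the ring of that piece is present and
   encloses the pocket: all exits lie on this one ring. *)
case: (pselect (exists z y, [/\ conn (~` Y') x z, B y, P y z, ~ R y z &
                          exists2 r, R y r & Y r])).
  move=> [z0 [y [xz0 By Pz0 nRz0 tch]]].
  have inP z : conn (~` Y') z0 z -> P y z /\ ~ R y z.
    apply: (conn_closed (D := [set z | P y z /\ ~ R y z])) => // a b [Pa nRa] nY'b ab.
    by split; [apply: Pcl ab|move=> Rb; apply: nY'b; apply: ringY' Rb].
  have ex w : exit_of Y' x w -> R y w.
    move=> [Y'w [eqw|[t xt tw]]]; first by move: nY'x; rewrite eqw.
    have [Pt nRt] : P y t /\ ~ R y t by apply/inP/(conn_trans (conn_sym xz0)).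
    by apply: inY' => //; apply: Pcl tw.
  have [Px _] : P y x /\ ~ R y x by apply/inP/conn_sym.
  apply: conn_sub (Rconn _ _ _ By (ex _ xu) (ex _ xv)) => w Rw; split.
    exact: ringY' Rw.
  by apply: nearby_leq (Pdiam _ _ _ By Px (RP _ By _ Rw)); lia.
(* Otherwise the pocket avoids [Y], hence lies in a pocket of [Y], and the detours along [Y] are
   available. *)
move=> ninact.
have nY z : conn (~` Y') x z -> ~ Y z.
  move=> xz Yz; case: (YY' z Yz) => [|[y [By Pz nRz tch]]]; first exact: (conn_r xz).
  by apply: ninact; exists z, y.
have nYconn z : conn (~` Y') x z -> conn (~` Y) x z.
  move=> xz; have : conn ((~` Y') `&` [set t | conn (~` Y') x t]) x z.
    apply: conn_inside xz => // [a b xa nb ab|]; last exact: conn_refl.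
    by apply: (conn_trans xa); apply: conn_edge => //; apply: conn_r xa.
  by apply: conn_sub => t [_ /nY].
(* each exit into [layer_op Y] is linked to an exit into [Y] through one ring *)
have toY w : exit_of Y' x w -> exists2 w', exit_of Y x w' &
    Y' w' /\ conn (Y' `&` [set t | nearby (D + d) x t]) w w'.
  move=> xw; have [Y'w [eqw|[t xt tw]]] := xw; first by move: nY'x; rewrite eqw.
  have xt' := nYconn _ xt.
  case: (pselect (Y w)) => Yw.
    have xw' : exit_of Y x w by split=> //; right; exists t.
    exists w => //; split=> //; apply: conn_refl; split=> //.
    by apply: nearby_leq (bypassed_nearby hY xw'); lia.
  case: Y'w => [[]//|[y [By Rw [r Rr Yr]]]].
  have [w' [Rw' Yw' ww']] := conn_first (Rconn _ _ _ By Rw Rr) (or_intror Yr).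
  have xw' : exit_of Y x w'.
    split=> //; case: ww' => [eqw|[s ws sw']]; first by move: Yw'; rewrite eqw.
    right; exists s => //; apply: (conn_trans xt').
    apply: conn_step tw _; first exact: conn_r xt'.
    by apply: conn_sub ws => ? [].
  have tch : exists2 r, R y r & Y r by exists r.
  exists w' => //; split; first exact: ringY' Rw'.
  apply: conn_sub (Rconn _ _ _ By Rw Rw') => s Rs; split; first exact: ringY' Rs.
  apply: nearby_trans (bypassed_nearby hY xw') _.
  by apply: Pdiam By (RP _ By _ Rw') (RP _ By _ Rs).
have [u' xu' [Y'u' uu']] := toY u xu.
have [v' xv' [Y'v' vv']] := toY v xv.
apply: conn_trans uu' _; apply: conn_trans (conn_sym vv').
set A := Y' `&` _.
have YA := hY.2 _ _ _ xu' xv'.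
(* Induction along the path in [Y]. The second clause describes a path that currently runs inside a
   touched piece: since it may enter this piece from any vertex of the ring, all of them have to
   reach [v']. *)
suff reroute a : conn (Y `&` [set w | nearby D x w]) a v' -> Y' a \/ True ->
    (Y' a -> conn A a v') /\
    (forall y, B y -> P y a -> ~ R y a -> (exists2 r, R y r & Y r) ->
       forall r, R y r -> conn A r v').
  by have [h _] := reroute _ YA (or_intror I); apply: h.
have Aself w : Y' w -> nearby D x w -> A w.
  by move=> Y'w xw; split=> //; apply: nearby_leq xw; lia.
have ringA y b r : B y -> P y b -> nearby D x b -> (exists2 r, R y r & Y r) -> R y r -> A r.
  move=> By Pa xa tch Rr; split; first exact: ringY' Rr.
  exact: nearby_trans xa (Pdiam _ _ _ By Pa (RP _ By _ Rr)).
have ringconn y b r s : B y -> P y b -> nearby D x b -> (exists2 r, R y r & Y r) ->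
    R y r -> R y s -> conn A r s.
  move=> By Pa xa tch Rr Rs; apply: conn_sub (Rconn _ _ _ By Rr Rs) => t.
  exact: ringA Pa xa tch.
move=> + _.
move=> cab; have [_ xv'nearby] := conn_r cab.
have Y'b := Y'v'.
elim: cab xv'nearby Y'b => [b [Yb xb] _ Y'b|a1 b c [Ya xa] ab bc IH xc Y'c].
  split=> [_|y By Pb nRb tch r Rr]; first by apply/conn_refl/Aself.
  by have := inY' _ _ By Pb Y'b.
have [IH1 IH2] := IH xc Y'c; have [Yb xb] := conn_l bc.
case: (YY' b Yb) => [Y'b|[y [By Pb nRb tch]]].
  split=> [Y'a|y By Pa nRa tch r Rr].
    by apply: conn_step ab (IH1 Y'b); apply: Aself.
  have Rb : R y b by apply: inY' => //; apply: Pcl ab.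
  by apply: conn_trans (IH1 Y'b); apply: ringconn By Pa xa tch Rr Rb.
have Pa : P y a1 by apply: Pcl By Pb nRb _; apply: adjC.
split=> [Y'a|y' By' Pa' nRa tch' r Rr].
  exact: IH2 By Pb nRb tch _ (inY' _ _ By Pa Y'a).
rewrite -(Pdisj _ _ _ By By' Pa Pa') in Rr.
exact: IH2 By Pb nRb tch _ Rr.
Qed.

Lemma layer_op_mono Y Y' : Y `<=` Y' -> layer_op Y `<=` layer_op Y'.
Proof.
move=> YY' z [[Yz nz]|[y [By Rz [w Rw Yw]]]]; first by left; split=> //; apply: YY'.
by right; exists y; split=> //; exists w => //; apply: YY'.
Qed.

End Operation.
End Connectivity.

(** * Borel predicates on the components *)

Section BorelPredicates.
Variable X : topologicalType.
Implicit Types (P Q : X -> Prop).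

Lemma borel_open (A : set X) : open A -> borel A.
Proof. exact: sub_sigma_algebra. Qed.

Lemma borel_not P : borel [set x | P x] -> borel [set x | ~ P x].
Proof. by move=> /sigma_algebraCD; rewrite setTD. Qed.

Lemma borel_ex_nat (F : nat -> X -> Prop) :
  (forall i, borel [set x | F i x]) -> borel [set x | exists i, F i x].
Proof.
move=> bF; rewrite [X in borel X](_ : _ = \bigcup_i [set x | F i x]).
  exact: sigma_algebra_bigcup.
by apply/seteqP; split=> x /= [i]; [exists i|exists i].
Qed.

Lemma borel_eqP P Q : (forall x, P x <-> Q x) -> borel [set x | P x] ->
  borel [set x | Q x].
Proof.
by move=> PQ; congr (borel _); apply/seteqP; split=> x /=; rewrite PQ.
Qed.

Lemma borel_or P Q : borel [set x | P x] -> borel [set x | Q x] ->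
  borel [set x | P x \/ Q x].
Proof.
move=> bP bQ; apply: (@borel_eqP (fun x => exists i, if i is 0 then P x else Q x)).
  move=> x; split=> [[[|i]]|[Px|Qx]]; [by left|by right|by exists 0|by exists 1].
by apply: borel_ex_nat => -[|i].
Qed.

Lemma borel_and P Q : borel [set x | P x] -> borel [set x | Q x] ->
  borel [set x | P x /\ Q x].
Proof.
move=> bP bQ; apply: (@borel_eqP (fun x => ~ (~ P x \/ ~ Q x))).
  move=> x; split=> [h|[Px Qx] [] //].
  by split; apply: contrapT => n; apply: h; [left|right].
by apply: borel_not; apply: borel_or; apply: borel_not.
Qed.

Lemma borel_cst (Q : Prop) : borel [set x : X | Q].
Proof.
have b0 : borel [set x : X | False] by apply: sigma_algebra0.
case: (pselect Q) => q; last by apply: borel_eqP b0 => x; split.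
by apply: borel_eqP (borel_not b0) => x; split=> // _ [].
Qed.

Lemma borel_imp P Q : borel [set x | P x] -> borel [set x | Q x] ->
  borel [set x | P x -> Q x].
Proof.
move=> bP bQ; rewrite [X in borel X](_ : _ = [set x | ~ P x \/ Q x]).
  by apply: borel_or => //; apply: borel_not.
apply/seteqP; split=> x /=; last by case.
by move=> PQ; case: (pselect (P x)); [right; apply: PQ|left].
Qed.

Lemma borel_ex (I : countType) (F : I -> X -> Prop) :
  (forall i, borel [set x | F i x]) -> borel [set x | exists i, F i x].
Proof.
move=> bF; rewrite [X in borel X](_ : _ =
    [set x | exists n, if unpickle n is Some i then F i x else False]).
  by apply: borel_ex_nat => n; case: unpickle => [i|]; [apply: bF|apply: borel_cst].
apply/seteqP; split=> x /= [i].
  by move=> Fi; exists (pickle i); rewrite pickleK.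
by case: unpickle => // j; exists j.
Qed.

Lemma borel_all (I : countType) (F : I -> X -> Prop) :
  (forall i, borel [set x | F i x]) -> borel [set x | forall i, F i x].
Proof.
move=> bF; rewrite [X in borel X](_ : _ = [set x | ~ exists i, ~ F i x]).
  by apply: borel_not; apply: borel_ex => i; apply: borel_not.
apply/seteqP; split=> x /=; first by move=> Fx [i]; apply.
by move=> nex i; apply: contrapT => nF; apply: nex; exists i.
Qed.

End BorelPredicates.

Definition borel_fun (X Y : topologicalType) (f : X -> Y) :=
  forall B, borel B -> borel (f @^-1` B).

Lemma borel_fun_open (X Y : topologicalType) (f : X -> Y) :
  (forall B, open B -> borel (f @^-1` B)) -> borel_fun f.
Proof.
move=> fo B; rewrite /borel => bB.
pose C := [set B : set Y | borel (f @^-1` B)].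
suff bC : <<s @open Y >> `<=` C by exact: bC.
apply: smallest_sub => [|A oA]; last exact: fo.
split.
- by rewrite /C /= preimage_set0; exact: (@borel_cst X False).
- by move=> A CA; rewrite /C /= setTD preimage_setC; apply: borel_not.
- by move=> A CA; rewrite /C /= preimage_bigcup; apply: sigma_algebra_bigcup.
Qed.

Lemma borel_fun_comp (X Y Z : topologicalType) (f : X -> Y) (g : Y -> Z) :
  borel_fun f -> borel_fun g -> borel_fun (g \o f).
Proof. by move=> bf bg B bB; apply: (bf (g @^-1` B)); apply: bg. Qed.

(** Makes equality a Borel condition, and breaks ties when a root is chosen. *)
Definition separating (X : topologicalType) (U : nat -> set X) :=
  (forall k, borel (U k)) /\ forall x y, x <> y -> exists2 k, U k x & ~ U k y.

Lemma borel_eq_fun (X Y : topologicalType) (U : nat -> set Y) (f g : X -> Y) :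
  separating U -> borel_fun f -> borel_fun g -> borel [set x | f x = g x].
Proof.
move=> [bU Usep] bf bg.
apply: (@borel_eqP _ (fun x => forall k, (U k (f x) -> U k (g x)) )).
  move=> x; split=> [h|-> //]; apply: contrapT => /Usep[k Uf nUg].
  exact/nUg/h.
by apply: borel_all => k; apply: borel_imp; [apply: bf|apply: bg]; apply: bU.
Qed.

Section Definable.
Variables (X : topologicalType) (adj : X -> X -> Prop) (nb : nat -> X -> X).
Variables (U : nat -> set X).
Hypothesis Usep : separating U.
Hypothesis adjC : forall x y, adj x y -> adj y x.
Hypothesis adjxx : forall x, ~ adj x x.
Hypothesis nbB : forall i, borel_fun (nb i).
Hypothesis nb_ex : forall x y, adj x y -> exists i, nb i x = y.
Hypothesis nb_or : forall i x, nb i x = x \/ adj x (nb i x).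

(** Words name the vertices of the component of [x], the head being the last step. A quantifier over
    a component thus becomes a countable one. *)
Fixpoint walk (w : seq nat) (x : X) : X :=
  if w is i :: w' then nb i (walk w' x) else x.

Lemma walk_cat v w x : walk (v ++ w) x = walk v (walk w x).
Proof. by elim: v => //= i v ->. Qed.

Lemma borel_walk w : borel_fun (walk w).
Proof. elim: w => [//|i w IH] B bB; exact: (IH (nb i @^-1` B) (nbB i bB)). Qed.

Lemma conn_walk w x : conn adj setT x (walk w x).
Proof.
elim: w => [|i w IH] /=; first exact: conn_refl.
apply: conn_trans IH _; case: (nb_or i (walk w x)) => [->|].
  exact: conn_refl.
by move=> h; apply: conn_edge.
Qed.

Lemma walk_conn x y : conn adj setT x y -> exists w, y = walk w x.
Proof.
elim=> [u _|u v w _ /nb_ex[i <-] _ [s ->]]; first by exists [::].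
by exists (s ++ [:: i]); rewrite walk_cat.
Qed.

Lemma nearby_walk w x : nearby adj (size w) x (walk w x).
Proof.
elim: w => [//|i w IH] /=; case: (nb_or i (walk w x)) => [->|h].
  by left.
by have := nearby_trans IH (nearby_edge h); rewrite addn1.
Qed.

(** Borelness of a relation along components: both arguments are named by words from one point, a
    form that is stable under quantification over vertices. *)
Definition walk_borel (Q : X -> X -> Prop) :=
  forall w v, borel [set x | Q (walk w x) (walk v x)].

Lemma borel_preimage_walk (A : set X) w : borel A -> borel [set x | A (walk w x)].
Proof. exact: borel_walk. Qed.

Lemma walk_borel_eq : walk_borel eq.
Proof. by move=> w v; apply: borel_eq_fun Usep _ _; apply: borel_walk. Qed.

Lemma walk_borel_adj : walk_borel adj.
Proof.
move=> w v.
apply: (@borel_eqP _ (fun x => walk w x <> walk v x /\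
   exists i, walk (i :: w) x = walk v x)).
  move=> x /=; split=> [[ne [i eqi]]|wv].
    by case: (nb_or i (walk w x)) => h; rewrite eqi in h => //; case: ne.
  by split; [move=> eqw; move: wv; rewrite eqw => /adjxx|apply: nb_ex].
apply: borel_and; first by apply: borel_not; apply: walk_borel_eq.
by apply: borel_ex => i; apply: walk_borel_eq.
Qed.

Lemma borel_ex_adj (Q : X -> X -> Prop) w :
  (forall v, borel [set x | Q x (walk v x)]) ->
  borel [set x | exists2 z, adj (walk w x) z & Q x z].
Proof.
move=> bQ.
apply: (@borel_eqP _ (fun x => exists i,
   adj (walk w x) (walk (i :: w) x) /\ Q x (walk (i :: w) x))).
  move=> x; split=> [[i [a q]]|[z a q]]; first by exists (walk (i :: w) x).
  by have [i eqz] := nb_ex a; exists i; rewrite /= eqz.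
by apply: borel_ex => i; apply: borel_and => //; apply: walk_borel_adj.
Qed.

Lemma walk_borel_nearby d : walk_borel (nearby adj d).
Proof.
elim: d => [|d IH] w v /=; first exact: walk_borel_eq.
apply: borel_or; first exact: IH.
by apply: borel_ex_adj => s; apply: IH.
Qed.

Fixpoint conn_steps (A : set X) n x y : Prop :=
  if n is n'.+1 then A x /\ exists2 z, adj x z & conn_steps A n' z y else A x /\ x = y.

Lemma conn_stepsP A x y : conn adj A x y <-> exists n, conn_steps A n x y.
Proof.
split=> [|[n]].
  elim=> [u Au|u v w Au uv _ [n vw]]; first by exists 0.
  by exists n.+1; split=> //; exists v.
elim: n x => [x [Ax <-]|n IH x [Ax [z xz /IH zy]]]; first exact: conn_refl.
exact: conn_step xz zy.
Qed.

Lemma walk_borel_steps A n : borel A -> walk_borel (conn_steps A n).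
Proof.
move=> bA; elim: n => [|n IH] w v /=.
  by apply: borel_and; [apply: borel_preimage_walk|apply: walk_borel_eq].
apply: borel_and; first exact: borel_preimage_walk.
by apply: borel_ex_adj => s; apply: IH.
Qed.

Lemma walk_borel_conn A : borel A -> walk_borel (conn adj A).
Proof.
move=> bA w v; apply: (@borel_eqP _ (fun x => exists n, conn_steps A n (walk w x) (walk v x))).
  by move=> x; rewrite conn_stepsP.
by apply: borel_ex => n; apply: walk_borel_steps.
Qed.

Lemma borel_ex_conn (Q : X -> X -> Prop) :
  (forall v, borel [set x | Q x (walk v x)]) ->
  borel [set x | exists2 z, conn adj setT x z & Q x z].
Proof.
move=> bQ; apply: (@borel_eqP _ (fun x => exists v, Q x (walk v x))).
  move=> x; split=> [[v q]|[z /walk_conn[v ->] q]]; last by exists v.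
  by exists (walk v x) => //; apply: conn_walk.
exact: borel_ex.
Qed.

(** A finite set of words is a shape that can be placed at any centre. There are countably many
    shapes, so the centres with a suitable shape can be sorted into countably many Borel sets. *)
Definition piece (p : seq (seq nat)) (y : X) : set X :=
  [set z | exists2 v, v \in p & z = walk v y].

Lemma piece_conn p y z : piece p y z -> conn adj setT y z.
Proof. by move=> [v _ ->]; apply: conn_walk. Qed.

Lemma walk_borel_piece p : walk_borel (piece p).
Proof.
move=> w v; rewrite /piece /=.
apply: (@borel_eqP _ (fun x => exists s, s \in p /\ walk v x = walk (s ++ w) x)).
  move=> x; split=> [[s [sp e]]|[s sp e]]; exists s => //.
    by rewrite e walk_cat.
  by rewrite walk_cat.
by apply: borel_ex => s; apply: borel_and; [apply: borel_cst|apply: walk_borel_eq].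
Qed.

Lemma borel_layer_op (B Y : set X) p r : borel B -> borel Y ->
  borel (layer_op B (piece p) (piece r) Y).
Proof.
move=> bB bY; apply: borel_or.
  apply: borel_and => //; apply: borel_not.
  apply: (@borel_eqP _ (fun z => exists2 y, conn adj setT z y &
      [/\ B y, piece p y z & ~ piece r y z])).
    move=> z; split=> [[y _ h]|[y [By py ry]]]; exists y => //.
    by apply: conn_sym => //; apply: piece_conn py.
  apply: (@borel_ex_conn (fun z y => _)) => v.
  apply: (@borel_eqP _ (fun z => B (walk v z) /\ (piece p (walk v z) (walk [::] z) /\
     ~ piece r (walk v z) (walk [::] z)))).
    by move=> z; split=> [[? [? ?]]|[]].
  apply: borel_and; first exact: borel_preimage_walk.
  by apply: borel_and; [|apply: borel_not]; apply: walk_borel_piece.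
apply: (@borel_eqP _ (fun z => exists2 y, conn adj setT z y &
    [/\ B y, piece r y z & exists2 w, piece r y w & Y w])).
  move=> z; split=> [[y _ h]|[y [By py ry]]]; exists y => //.
  by apply: conn_sym => //; apply: piece_conn py.
apply: (@borel_ex_conn (fun z y => _)) => v.
apply: (@borel_eqP _ (fun z => B (walk v z) /\ (piece r (walk v z) (walk [::] z) /\
   exists s, s \in r /\ Y (walk (s ++ v) z)))).
  move=> z; split=> [[? [? [s [sr Ys]]]]|[? ? [w [s sr ->] Yw]]].
    split=> //; exists (walk (s ++ v) z) => //.
    by exists s => //; rewrite walk_cat.
  by split=> //; split=> //; exists s; rewrite walk_cat.
apply: borel_and; first exact: borel_preimage_walk.
apply: borel_and; first exact: walk_borel_piece.
apply: borel_ex => s; apply: borel_and; [exact: borel_cst|exact: borel_preimage_walk].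
Qed.

End Definable.

Lemma finite_bound (T : eqType) (A : set T) (Q : nat -> T -> Prop) :
  finite_set A -> (forall m n x, m <= n -> Q m x -> Q n x) ->
  (forall x, A x -> exists n, Q n x) -> exists n, forall x, A x -> Q n x.
Proof.
move=> /finite_seqP[s ->] Qmono; elim: s => [|a s IH] sQ; first by exists 0.
have [|n Qn] := IH.
  by move=> x xs; apply: sQ; rewrite /= inE orbC; apply/orP; left.
have [|m Qm] := sQ a; first by rewrite /= inE eqxx.
exists (maxn m n) => x /=; rewrite inE => /predU1P[->|xs].
  by apply: Qmono Qm; apply: leq_maxl.
by apply: Qmono (Qn x xs); apply: leq_maxr.
Qed.

(** * The map of a decreasing sequence *)

Section SpanningMap.
Variables (X : topologicalType) (adj : X -> X -> Prop) (nb : nat -> X -> X).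
Variables (U : nat -> set X).
Hypothesis Usep : separating U.
Hypothesis adjC : forall x y, adj x y -> adj y x.
Hypothesis adjxx : forall x, ~ adj x x.
Hypothesis locfin : forall x, finite_set [set y | adj x y].
Hypothesis nbB : forall i, borel_fun (nb i).
Hypothesis nb_ex : forall x y, adj x y -> exists i, nb i x = y.
Hypothesis nb_or : forall i x, nb i x = x \/ adj x (nb i x).

Variables (H : nat -> set X) (D : nat -> nat).
Hypothesis H0 : H 0 = setT.
Hypothesis Hdec : forall n, H n.+1 `<=` H n.
Hypothesis Hborel : forall n, borel (H n).
Hypothesis Hbyp : forall n, bypassed adj (D n) (H n).

Local Notation conn := (conn adj).
Local Notation nearby := (nearby adj).

(* The vertices within distance [n] of a lucky vertex have their exits into [H n],
   and the links between these exits, outside [H n.+1]: their forward orbits merge. *)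
Definition lucky n : set X :=
  [set x | forall z, nearby (n + D n).+2 x z -> ~ H n.+1 z].

(** One vertex that is lucky infinitely often takes care of its whole component: the term [n] in the
    radius of [lucky n] eventually absorbs the distance to any other vertex. *)
Definition lucky_domain : set X :=
  [set x | exists2 x0, conn setT x x0 & forall m, exists2 n, m <= n & lucky n x0].

Let Delta n : set X := H n `\` H n.+1.

Lemma Hmono m n : m <= n -> H n `<=` H m.
Proof.
move=> /subnK <-; elim: (n - m) => // k IH x; rewrite addSn => /Hdec; exact: IH.
Qed.

Lemma Delta_uniq m n x : Delta m x -> Delta n x -> m = n.
Proof.
move=> [Hm nHm] [Hn nHn]; apply/eqP; rewrite eqn_leq; apply/andP; split.
  by rewrite leqNgt; apply/negP => lt; apply: nHn; apply: Hmono Hm.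
by rewrite leqNgt; apply/negP => lt; apply: nHm; apply: Hmono Hn.
Qed.

Lemma Delta_ex m x : ~ H m x -> exists2 n, n < m & Delta n x.
Proof.
elim: m => [|m IH] nH; first by case: nH; rewrite H0.
case: (pselect (H m x)) => [Hm|/IH[n nm Dn]]; first by exists m.
by exists n => //; apply: leq_trans nm _.
Qed.

(* The root of a component of [Delta n] is singled out among the vertices
   adjacent to [H n.+1] by refining with the sets [U k] one after the other. *)
Fixpoint root_cand n k : set X :=
  if k is k'.+1 then
    [set z | root_cand n k' z /\ (U k' z \/
       ~ exists2 z', conn setT z z' & conn (Delta n) z z' /\ root_cand n k' z' /\ U k' z')]
  else [set z | Delta n z /\ exists2 u, adj z u & H n.+1 u].

Definition root n : set X := [set z | forall k, root_cand n k z].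

Lemma Delta_comp_finite n x : finite_set [set z | conn (Delta n) x z].
Proof.
apply: sub_finite_set (bypassed_finite adjC locfin x (Hbyp n.+1)) => z.
by apply: conn_sub => t [].
Qed.

(** As [H n] is connected within a component, a path in [H n] joins [x] to [H n.+1]; the last vertex
    before it first enters [H n.+1] is a candidate at level 0. *)
Lemma root_cand_ex n k x : Delta n x -> exists2 z, conn (Delta n) x z & root_cand n k z.
Proof.
move=> [Hx nHx]; elim: k => [|k [z xz cz]].
  have [u xu] := (Hbyp n.+1).1 x.
  have cxu : conn (H n) x u.
    apply: (bypassed_conn adjC (Hbyp n) (exit_conn xu)); apply: exit_self => //.
    by apply: Hdec; case: xu.
  have [z [Hz H'z xz]] := conn_first cxu (or_intror xu.1).
  case: xz => [eqz|[t xt tz]]; first by rewrite eqz in H'z.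
  by exists t => //; split; [exact: conn_r xt|exists z].
case: (pselect (exists2 z', conn setT z z' &
    conn (Delta n) z z' /\ root_cand n k z' /\ U k z')).
  move=> [z' _ [zz' [cz' Uz']]]; exists z'; first exact: conn_trans xz zz'.
  by split=> //; left.
by move=> nex; exists z => //; split=> //; right.
Qed.

Lemma root_cand_leq n k l z : k <= l -> root_cand n l z -> root_cand n k z.
Proof. by move=> /subnK <-; elim: (l - k) => // m IH; rewrite addSn => -[/IH]. Qed.

(** In the component of [x] the candidates form a decreasing sequence of nonempty subsets of a
    finite set. *)
Lemma root_ex n x : Delta n x -> exists2 z, conn (Delta n) x z & root n z.
Proof.
move=> Dx; apply: contrapT => nroot.
have [||k nk] := @finite_bound X [set z | conn (Delta n) x z]
  (fun k z => ~ root_cand n k z) (Delta_comp_finite n x).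
- by move=> k l z kl nc cz; apply: nc; apply: root_cand_leq cz.
- move=> z xz; apply: contrapT => all; apply: nroot; exists z => // k.
  by apply: contrapT => nc; apply: all; exists k.
by have [z xz /nk] := root_cand_ex k Dx; apply.
Qed.

Lemma root_uniq n z z' : root n z -> root n z' -> conn (Delta n) z z' -> z = z'.
Proof.
move=> rz rz' zz'; apply: contrapT => /Usep.2[k Uz nUz'].
have [_ [//|nex]] := rz' k.+1; apply: nex; exists z.
  by apply: conn_sub (conn_sym adjC zz').
by split; [apply: conn_sym|split; [apply: rz|]].
Qed.

Fixpoint rdist n k : set X :=
  if k is k'.+1 then
    [set z | rdist n k' z \/ (Delta n z /\ exists2 z', adj z z' & Delta n z' /\ rdist n k' z')]
  else root n.

Lemma rdist_leq n k l z : k <= l -> rdist n k z -> rdist n l z.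
Proof. by move=> /subnK <-; elim: (l - k) => // m IH /IH; rewrite addSn; left. Qed.

Lemma rdist_ex n x : Delta n x -> exists k, rdist n k x.
Proof.
move=> /root_ex[z xz rz]; elim: xz rz => [u _ ru|u v w Du uv vw IH /IH[k vk]].
  by exists 0.
by exists k.+1; right; split=> //; exists v => //; split=> //; apply: conn_l vw.
Qed.

(** Away from the root, the last condition says that [z'] is strictly closer to the root than [z],
    without naming the distance. *)
Definition step n z z' := adj z z' /\ ((root n z /\ H n.+1 z') \/
  (~ root n z /\ Delta n z' /\ exists k, rdist n k z' /\ ~ rdist n k z)).

Lemma step_ex n x : Delta n x -> exists z, step n x z.
Proof.
move=> Dx; case: (pselect (root n x)) => [rx|nrx].
  by have [_ [u xu Hu]] := rx 0; exists u; split=> //; left.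
have [k] := rdist_ex Dx; elim: k => [//|k IH] rk.
case: (pselect (rdist n k x)) => // nrk.
case: rk => // -[_ [z xz [Dz rz]]].
by exists z; split=> //; right; split=> //; split=> //; exists k.
Qed.

Definition good_step x i := exists n, Delta n x /\ step n x (nb i x).

(** The least admissible index is taken, which keeps the choice Borel. The default value [x] is
    taken at the points lying in every [H n]; none of them is in [lucky_domain]. *)
Definition smap (x : X) : X :=
  if pselect (exists i, good_step x i /\ forall j, j < i -> ~ good_step x j) is left e
  then nb (projT1 (cid e)) x else x.

Lemma smap_spec x i : good_step x i -> (forall j, j < i -> ~ good_step x j) ->
  smap x = nb i x.
Proof.
move=> gi mini; rewrite /smap; case: pselect => [e|]; last by case; exists i.
case: cid => j [gj minj] /=.
suff -> : j = i by [].
apply/eqP; rewrite eqn_leq; apply/andP; split.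
  by rewrite leqNgt; apply/negP => /minj.
by rewrite leqNgt; apply/negP => /mini.
Qed.

Lemma least_ex (P : nat -> Prop) i : P i -> exists j, P j /\ forall l, l < j -> ~ P l.
Proof.
elim/ltn_ind: i => i IH Pi.
case: (pselect (exists2 j, j < i & P j)) => [[j /IH h /h//]|nex].
by exists i; split=> // l li Pl; apply: nex; exists l.
Qed.

Lemma smap_step n x : Delta n x -> step n x (smap x).
Proof.
move=> Dx; have [z xz] := step_ex Dx; have [i eqi] := nb_ex xz.1.
have [|j [gj minj]] := @least_ex (good_step x) i; first by exists n; rewrite eqi.
rewrite (smap_spec gj minj); have [m [Dm stm]] := gj.
by rewrite (Delta_uniq Dx Dm).
Qed.

Lemma smap_out x : (forall n, ~ Delta n x) -> smap x = x.
Proof.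
move=> nD; rewrite /smap; case: pselect => // e; exfalso.
by case: e => i [[n [Dn _]] _]; apply: nD Dn.
Qed.

Lemma smap_or x : smap x = x \/ adj x (smap x).
Proof.
case: (pselect (exists n, Delta n x)) => [[n /smap_step[]]|nex]; first by right.
by left; apply: smap_out => n Dn; apply: nex; exists n.
Qed.

Lemma Hsmap m x : H m x -> H m (smap x).
Proof.
move=> Hx; case: (pselect (exists n, Delta n x)) => [[n Dn]|nex]; last first.
  by rewrite smap_out // => n Dn; apply: nex; exists n.
have mn : m <= n by rewrite leqNgt; apply/negP => nm; apply: Dn.2; apply: Hmono Hx.
apply: (Hmono mn).
by have [_ [[_ /Hdec]|[_ [[]]]]] := smap_step Dn.
Qed.

Lemma Hiter m k x : H m x -> H m (iter k smap x).
Proof. by elim: k => //= k IH /IH; apply: Hsmap. Qed.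

Lemma orbit_root n x : Delta n x -> exists j, root n (iter j smap x) /\
  forall i, i <= j -> conn (Delta n) x (iter i smap x).
Proof.
move=> Dx; have [k] := rdist_ex Dx.
elim/ltn_ind: k x Dx => k IH x Dx rk.
case: (pselect (root n x)) => [rx|nrx].
  by exists 0; split=> // -[|//] _; apply: conn_refl.
have [xy [[]//|[_ [Dy [l [rl nrl]]]]]] := smap_step Dx.
have lk : l < k by rewrite ltnNge; apply/negP => kl; apply: nrl; apply: rdist_leq rk.
have [j [rj oj]] := IH _ lk _ Dy rl.
exists j.+1; rewrite iterSr; split=> // -[_|i ij]; first exact: conn_refl.
by rewrite iterSr; apply: conn_step Dx xy (oj _ ij).
Qed.

Lemma orbit_entry m x : exists j, H m (iter j smap x) /\
  forall i, i < j -> ~ H m (iter i smap x).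
Proof.
elim: m => [|m [j [Hj bj]]]; first by exists 0; rewrite H0.
case: (pselect (H m.+1 (iter j smap x))) => [H'j|nH'j].
  by exists j; split=> // i /bj nH /Hdec.
have Dj : Delta m (iter j smap x) by [].
have [l [rl ol]] := orbit_root Dj.
exists (l.+1 + j); rewrite iterD; split.
  have [_ [[_ //]|[]]] := smap_step (conn_r (ol _ (leqnn _))); last by [].
move=> i ilj; case: (ltnP i j) => [/bj nH /Hdec //|ji].
have := ol (i - j); rewrite -iterD subnK // => h; apply: (conn_r (h _)).2; lia.
Qed.

(** Translates orbits into detours: the orbits of two neighbours enter [H m] at exits, which the
    detour property links inside [H m]. *)
Lemma entry_exit m x j : H m (iter j smap x) ->
  (forall i, i < j -> ~ H m (iter i smap x)) -> exit_of adj (H m) x (iter j smap x).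
Proof.
move=> Hj bj; split=> //; case: j Hj bj => [|j] Hj bj; first by left.
have edge i : i <= j -> adj (iter i smap x) (iter i.+1 smap x).
  move=> ij; have [n _ Dn] := Delta_ex (bj i ij).
  by have [] := smap_step Dn.
right; exists (iter j smap x); last exact: edge.
have : j <= j by []; move: {1 3}j; elim=> [|i IH] ij.
  by apply: conn_refl; apply: (bj 0).
apply: conn_trans (IH (ltnW ij)) _; apply: conn_edge; last by apply: edge; apply: ltnW.
  by apply: bj; lia.
exact: bj.
Qed.

Definition merge x y := exists i j, iter i smap x = iter j smap y.

Lemma merge_trans x y z : merge x y -> merge y z -> merge x z.
Proof.
move=> [i [j xy]] [k [l yz]]; exists (k + i), (j + l).
by rewrite iterD xy -iterD addnC iterD yz -iterD.
Qed.

Lemma merge_iter i j x y : merge (iter i smap x) (iter j smap y) -> merge x y.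
Proof. by move=> [k [l]]; rewrite -!iterD; exists (k + i), (l + j). Qed.

Lemma merge_adj n a b : adj a b ->
  (forall z, nearby (D n).+1 a z -> ~ H n.+1 z) -> merge a b.
Proof.
move=> ab far; have [i [Hi bi]] := orbit_entry n a; have [j [Hj bj]] := orbit_entry n b.
apply: (@merge_iter i j).
have := bypassed_edge adjC (Hbyp n) ab (entry_exit Hi bi) (entry_exit Hj bj).
move: (iter i smap a) (iter j smap b) => x y xy.
have {}xy : conn (Delta n) x y by apply: conn_sub xy => z [Hz /far].
have [k [rk ok]] := orbit_root (conn_l xy).
have [l [rl ol]] := orbit_root (conn_r xy).
exists k, l; apply: root_uniq rk rl _.
apply: conn_trans (conn_sym adjC (ok _ (leqnn _))) _.
exact: conn_trans xy (ol _ (leqnn _)).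
Qed.

Lemma lucky_domain_inv x y : conn setT x y -> lucky_domain x -> lucky_domain y.
Proof.
move=> xy [x0 xx0 h]; exists x0 => //.
by apply: conn_trans (conn_sym adjC xy) _.
Qed.

Lemma lucky_domain_far x d : lucky_domain x -> exists n, forall z, nearby (d + (D n).+1) x z ->
  ~ H n.+1 z.
Proof.
move=> [x0 xx0 h]; have [k xk] := conn_nearby xx0.
have [n kn ln] := h (k + d); exists n => z xz; apply: ln.
have := nearby_trans (nearby_sym adjC xk) xz.
by apply: nearby_leq; lia.
Qed.

Lemma lucky_domain_Delta x : lucky_domain x -> exists n, Delta n x.
Proof.
move=> /(lucky_domain_far 0)[n /(_ x (nearby_refl _ _ _))].
by move=> /Delta_ex[m _]; exists m.
Qed.

Lemma smap_merge x y : lucky_domain x -> conn setT x y -> merge x y.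
Proof.
move=> + xy; elim: xy => [z _ _|a b c _ ab _ IH La]; first by exists 0, 0.
apply: merge_trans (IH (lucky_domain_inv (conn_edge _ _ ab) La)) => //.
have [n far] := lucky_domain_far 0 La.
exact: merge_adj ab far.
Qed.

(** Orbits never leave [H n.+1] once they are in it. With [x] in [Delta n], an orbit leading to [x]
    therefore stays in the pocket of [x] outside [H n.+1], which is finite. *)
Lemma smap_back_finite x : lucky_domain x ->
  finite_set [set y | exists k, iter k smap y = x].
Proof.
move=> /lucky_domain_Delta[n Dx].
apply: sub_finite_set (bypassed_finite adjC locfin x (Hbyp n.+1)) => y [k eqx] /=.
apply: (conn_sym adjC).
have out i : i <= k -> ~ H n.+1 (iter i smap y).
  move=> ik Hi; apply: Dx.2; rewrite -eqx -(subnK ik) iterD; exact: Hiter.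
rewrite -eqx; elim: k {eqx} out => [|k IH] out.
  by apply: conn_refl; apply: (out 0).
have cyk : conn (~` H n.+1) y (iter k smap y).
  by apply: IH => i ik; apply: out; apply: leqW.
apply: (conn_trans cyk) => /=.
case: (smap_or (iter k smap y)) => [->|kk]; first by apply: conn_refl; apply: conn_r cyk.
apply: conn_edge => //; first exact: conn_r cyk.
exact: (out k.+1).
Qed.

Lemma borel_Delta n : borel (Delta n).
Proof. by apply: borel_and; [apply: Hborel|apply: borel_not; apply: Hborel]. Qed.

Lemma borel_root_cand n k : borel (root_cand n k).
Proof.
elim: k => [|k IH] /=.
  apply: borel_and; first exact: borel_Delta.
  apply: (borel_ex_adj Usep adjxx nbB nb_ex nb_or (Q := fun x z => H n.+1 z) [::]).
  by move=> v; apply: borel_preimage_walk => //; apply: Hborel.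
apply: borel_and => //; apply: borel_or; first exact: Usep.1.
apply: borel_not; apply: (borel_ex_conn nb_ex nb_or) => v.
apply: borel_and.
  exact: (walk_borel_conn Usep adjxx nbB nb_ex nb_or (borel_Delta n) [::] v).
apply: borel_and; first exact: borel_preimage_walk.
by apply: borel_preimage_walk => //; apply: Usep.1.
Qed.

Lemma borel_root n : borel (root n).
Proof.
by apply: (@borel_all _ nat (root_cand n)) => k; apply: borel_root_cand.
Qed.

Lemma borel_rdist n k : borel (rdist n k).
Proof.
elim: k => [|k IH] /=; first exact: borel_root.
apply: borel_or => //; apply: borel_and; first exact: borel_Delta.
apply: (borel_ex_adj Usep adjxx nbB nb_ex nb_or
  (Q := fun x z => Delta n z /\ rdist n k z) [::]) => v.
by apply: borel_and; apply: borel_preimage_walk => //; apply: borel_Delta.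
Qed.

Lemma borel_good_step i : borel [set x | good_step x i].
Proof.
apply: borel_ex_nat => n; apply: borel_and; first exact: borel_Delta.
apply: borel_and; first exact: (walk_borel_adj Usep adjxx nbB nb_ex nb_or [::] [:: i]).
apply: borel_or.
  by apply: borel_and; [apply: borel_root|exact: (nbB i (Hborel _))].
apply: borel_and; first by apply: borel_not; apply: borel_root.
apply: borel_and; first exact: (nbB i (borel_Delta n)).
apply: borel_ex_nat => k; apply: borel_and; first exact: (nbB i (borel_rdist n k)).
by apply: borel_not; apply: borel_rdist.
Qed.

Lemma borel_smap : borel_fun smap.
Proof.
move=> B bB.
apply: (@borel_eqP _ (fun x =>
   (exists i, good_step x i /\ ((forall j, j < i -> ~ good_step x j) /\ B (nb i x))) \/
   ((~ exists i, good_step x i) /\ B x))).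
  move=> x /=; split=> [[[i [gi [mini Bi]]]|[nex Bx]]|].
  - by rewrite (smap_spec gi mini).
  - rewrite smap_out // => n Dn; apply: nex.
    have [z xz] := step_ex Dn; have [i eqi] := nb_ex xz.1.
    by exists i, n; rewrite eqi.
  - move=> Bx; case: (pselect (exists i, good_step x i)) => [[i /least_ex[j [gj minj]]]|nex].
      by move: Bx; rewrite (smap_spec gj minj) => Bx; left; exists j.
    right; split=> //; move: Bx; rewrite smap_out // => n Dn; apply: nex.
    have [z xz] := step_ex Dn; have [i eqi] := nb_ex xz.1.
    by exists i, n; rewrite eqi.
apply: borel_or.
  apply: borel_ex_nat => i; apply: borel_and; first exact: borel_good_step.
  apply: borel_and; last exact: (nbB i bB).
  apply: borel_all => j; apply: borel_imp; first exact: borel_cst.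
  by apply: borel_not; apply: borel_good_step.
apply: borel_and => //; apply: borel_not; apply: borel_ex_nat => i.
exact: borel_good_step.
Qed.

Lemma borel_lucky n : borel (lucky n).
Proof.
apply: (@borel_eqP _ (fun x => forall v, nearby (n + D n).+2 x (walk nb v x) ->
    ~ H n.+1 (walk nb v x))).
  move=> x; split=> [h z xz|h v]; last exact: h.
  have [v eqz] := walk_conn nb_ex (nearby_conn xz); rewrite eqz; apply: h.
  by rewrite -eqz.
apply: borel_all => v; apply: borel_imp.
  exact: (walk_borel_nearby Usep adjxx nbB nb_ex nb_or _ [::] v).
by apply: borel_not; apply: borel_preimage_walk => //; apply: Hborel.
Qed.

Lemma borel_lucky_domain : borel lucky_domain.
Proof.
apply: (borel_ex_conn nb_ex nb_or) => v.
apply: borel_all => m.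
apply: (@borel_eqP _ (fun x => exists n, m <= n /\ lucky n (walk nb v x))).
  by move=> x; split=> [[n [? ?]]|[n ? ?]]; exists n.
apply: borel_ex_nat => n; apply: borel_and; first exact: borel_cst.
by apply: borel_preimage_walk => //; apply: borel_lucky.
Qed.

End SpanningMap.

(** * The tree of a one-ended map *)

Section Reachable.
Variable X : choiceType.
Implicit Types (G : sgraph X) (A C : set X).

Lemma reachable_conn G x y : reachable G x y <-> conn (adj G) setT x y.
Proof.
split=> [[p]|].
  elim: p x => [x _ <-|z p IH x /= /andP[xz zp] l]; first exact: conn_refl.
  exact: conn_step xz (IH _ zp l).
elim=> [u _|u v w _ uv _ [p vp <-]]; first by exists [::].
by exists (v :: p) => //=; apply/andP.
Qed.

Lemma reachable_induced G A x y : A x ->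
  reachable (induced_sgraph G A) x y <-> conn (adj G) A x y.
Proof.
move=> Ax; rewrite reachable_conn; split=> h.
  elim: h Ax => [u _ Au|u v w _ /and3P[uv /set_mem Au /set_mem Av] _ IH _].
    exact: conn_refl.
  exact: conn_step Au uv (IH Av).
elim: h {Ax} => [u _|u v w Au uv vw IH]; first exact: conn_refl.
apply: conn_step IH => //; apply/and3P; split=> //; apply/mem_set => //.
exact: conn_l vw.
Qed.

End Reachable.

Section TreeOfMap.
Variables (X : ptopologicalType) (U : nat -> set X) (G : sgraph X) (f : X -> X).
Hypothesis Usep : separating U.
Let Z := vset G.
Hypothesis bZ : borel Z.
Hypothesis bf : borel_fun f.
Hypothesis f_adj : forall x, Z x -> adj G x (f x).
Hypothesis f_back : forall x, Z x -> finite_set [set y | Z y /\ exists k, iter k f y = x].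
Hypothesis f_merge : forall x y, Z x -> conn (adj G) setT x y ->
  exists i j, iter i f x = iter j f y.
Hypothesis infc : forall x, Z x -> infinite_set [set y | conn (adj G) setT x y].

Let Zf x : Z x -> Z (f x).
Proof. by move=> /f_adj /adj_vset[]. Qed.

Let Ziter k x : Z x -> Z (iter k f x).
Proof. by elim: k => //= k IH /IH; apply: Zf. Qed.

Let Zconn x y : Z x -> conn (adj G) setT x y -> Z y.
Proof.
move=> Zx; apply: (@conn_closed _ _ setT Z) => // u v _ _ /adj_vset[] //.
Qed.

Definition map_adj : rel X :=
  fun x y => [&& x \in Z, y \in Z & (f x == y) || (f y == x)].

Lemma map_adj_vset x y : map_adj x y -> Z x /\ Z y.
Proof. by case/and3P => /set_mem ? /set_mem ?. Qed.

Lemma map_adj_sym : symmetric map_adj.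
Proof. by move=> x y; rewrite /map_adj andbCA orbC. Qed.

Lemma map_adj_irr : irreflexive map_adj.
Proof.
move=> x; apply/negP => /and3P[/set_mem Zx _]; rewrite orbb => /eqP fx.
by have := f_adj Zx; rewrite fx adj_irr.
Qed.

Definition map_tree : sgraph X := SGraph map_adj_vset map_adj_sym map_adj_irr.

Lemma map_adj_f x : Z x -> map_adj x (f x).
Proof. by move=> Zx; apply/and3P; split; rewrite ?eqxx //; apply/mem_set => //; apply: Zf. Qed.

Lemma map_adj_sub x y : map_adj x y -> adj G x y.
Proof.
case/and3P => /set_mem Zx /set_mem Zy /orP[/eqP <-|/eqP <-]; first exact: f_adj.
by rewrite adj_sym; apply: f_adj.
Qed.

Lemma map_conn_iter (A : set X) k x : Z x -> (forall i, i <= k -> A (iter i f x)) ->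
  conn map_adj A x (iter k f x).
Proof.
move=> Zx; elim: k => [|k IH] Ai; first by apply: conn_refl; apply: (Ai 0).
apply: conn_trans (IH _) _; first by move=> i ik; apply: Ai; apply: leqW.
by apply: conn_edge; [exact: Ai|exact: (Ai k.+1)|apply: map_adj_f; apply: Ziter].
Qed.

Lemma conn_iterG k x : Z x -> conn (adj G) setT x (iter k f x).
Proof.
move=> Zx; have := @map_conn_iter setT k x Zx (fun _ _ => I).
elim=> [u _|u v w _ /map_adj_sub uv _]; first exact: conn_refl.
exact: conn_step.
Qed.

Lemma map_conn x y : Z x -> conn (adj G) setT x y -> conn map_adj setT x y.
Proof.
move=> Zx xy; have [i [j e]] := f_merge Zx xy.
apply: conn_trans (map_conn_iter (k := i) Zx (fun _ _ => I)) _; rewrite e.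
apply: conn_sym; first by move=> ? ?; rewrite map_adj_sym.
by apply: map_conn_iter => //; apply: Zconn xy.
Qed.

Lemma map_connG x y : conn map_adj setT x y -> conn (adj G) setT x y.
Proof.
elim=> [u _|u v w _ /map_adj_sub uv _]; first exact: conn_refl.
exact: conn_step.
Qed.

(** All forward orbits of the component would fall into the cycle of [x], and only finitely many
    points lead to a cycle: the component would be finite. *)
Lemma f_aperiodic k x : Z x -> iter k.+1 f x <> x.
Proof.
move=> Zx e; apply: (infc Zx); apply: sub_finite_set
  (_ : finite_set (\bigcup_(i in `I_k.+1) [set y | Z y /\ exists l, iter l f y = iter i f x])).
  move=> y xy; have [i [j eij]] := f_merge Zx xy.
  exists (i %% k.+1); first by rewrite /= ltn_mod.
  split; first exact: Zconn xy.
  exists j; rewrite -eij {1}(divn_eq i k.+1) addnC iterD; congr iter.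
  by elim: (i %/ k.+1) => // m IH; rewrite mulSn iterD IH.
apply: bigcup_finite => [|i _]; first exact: finite_II.
by apply: f_back; apply: Ziter.
Qed.

(** Once a path without repetition goes against [f], it does so up to its end: a step along [f]
    would return to the previous vertex. *)
Lemma map_path_back x y p : path map_adj y p -> uniq (x :: y :: p) -> f y = x ->
  forall z t, last y p = z -> f z = t -> t = last x (belast y p).
Proof.
elim: p x y => [|a p IH] x y /=; first by move=> _ _ fy z t <- <-.
move=> /andP[/and3P[_ _ /orP[/eqP fya|/eqP fay]] ap] /and3P[xn yn pu] fy.
  by move: xn; rewrite !inE -fy fya eqxx !orbT.
by apply: (IH y a) => //=; apply/andP.
Qed.

(** If [f] preserves the vertices of a cycle, one of them is periodic. Otherwise some [v] on it is
    mapped off the cycle; both neighbours of [v] are then mapped to [v], and going round the cycle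
    against [f] from [v] shows that the last vertex is also mapped to its predecessor, which differs
    from [v]. *)
Lemma map_tree_acyclic : acyclic_graph map_tree.
Proof.
move=> p szp /andP[/= cp up].
have inZ z : z \in p -> Z z.
  by move=> zp; have /map_adj_vset[] := next_cycle cp zp.
case: (pselect (forall v, v \in p -> f v \in p)) => [fp|nfp].
  have [v vp] : exists v, v \in p by case: p szp {cp up inZ fp} => // a; exists a; rewrite inE eqxx.
  have ip i : iter i f v \in p by elim: i => //= i; apply: fp.
  have : ~~ uniq [seq iter i f v | i <- iota 0 (size p).+1].
    apply/negP => /uniq_leq_size h.
    have : {subset [seq iter i f v | i <- iota 0 (size p).+1] <= p}.
      by move=> z /mapP[i _ ->].
    by move=> /h; rewrite size_map size_iota ltnn.
  case/(uniqPn v) => i [j [ij]]; rewrite size_map size_iota => jp.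
  rewrite !(nth_map 0) ?size_iota //; last exact: ltn_trans jp.
  rewrite !nth_iota // ?(ltn_trans ij) // !add0n => e.
  apply: (@f_aperiodic (j - i).-1 (iter i f v)); first exact/Ziter/inZ.
  by rewrite prednK ?subn_gt0 // -iterD subnK // ltnW.
have [v vp fvp] : exists2 v, v \in p & f v \notin p.
  apply: contrapT => nex; apply: nfp => v vp.
  by apply: contrapT => /negP fvp; apply: nex; exists v.
have [k q eq_rot] := rot_to vp.
have : cycle map_adj (v :: q) by rewrite -eq_rot rot_cycle.
have uq : uniq (v :: q) by rewrite -eq_rot rot_uniq.
have szq : 2 < size (v :: q) by rewrite -eq_rot size_rot.
have fvq : f v \notin v :: q by rewrite -eq_rot mem_rot.
case: q {eq_rot} uq szq fvq => [|a [|b q]] // uq _ fvq /=.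
rewrite rcons_path => /and3P[va ab]; rewrite /= => /andP[bq lv].
have fav : f a = v.
  by case/and3P: va => _ _ /orP[/eqP e|/eqP //]; move: fvq; rewrite e !inE eqxx orbT.
have flv : f (last b q) = v.
  case/and3P: lv => _ _ /orP[/eqP //|/eqP e].
  by move: fvq; rewrite e 2!in_cons (mem_last b q) !orbT.
have := @map_path_back v a (b :: q) _ uq fav (last b q) v erefl flv.
rewrite /= ab bq => /(_ isT) e.
have : v \in a :: belast b q.
  by rewrite {1}e mem_last.
by move: uq; rewrite lastI rcons_uniq => /andP[_] /= /andP[/negP nv _] /nv.
Qed.

Lemma map_tree_borel : borel_edges map_tree.
Proof.
have b1 : borel_fun (fst : X * X -> X).
  apply: borel_fun_open => B oB; apply: borel_open.
  by apply: open_comp oB => x _; apply: cvg_fst.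
have b2 : borel_fun (snd : X * X -> X).
  apply: borel_fun_open => B oB; apply: borel_open.
  by apply: open_comp oB => x _; apply: cvg_snd.
apply: (@borel_eqP _ (fun q : X * X => Z q.1 /\ (Z q.2 /\ (f q.1 = q.2 \/ f q.2 = q.1)))).
  move=> q; rewrite /= /map_adj; split.
    by move=> [/mem_set -> [/mem_set -> [->|->]]]; rewrite eqxx ?orbT.
  by case/and3P => /set_mem Z1 /set_mem Z2 /orP[/eqP|/eqP]; split=> //; split=> //; [left|right].
apply: borel_and; first exact: b1.
apply: borel_and; first exact: b2.
apply: borel_or.
  by apply: (borel_eq_fun Usep) => //; apply: borel_fun_comp b1 bf.
by apply: (borel_eq_fun Usep) => //; apply: borel_fun_comp b2 bf.
Qed.

Lemma map_tree_connected C : graph_component G C -> connected_graph (induced_sgraph map_tree C).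
Proof.
move=> [x Zx ->] u v /= [Zu xu] [Zv xv].
rewrite reachable_induced //; move: xu xv => /= /reachable_conn xu /reachable_conn xv.
have uv : conn (adj G) setT u v.
  by apply: conn_trans (conn_sym _ xu) xv => ? ?; rewrite adj_sym.
have [i [j e]] := f_merge Zu uv.
apply: (@conn_trans _ _ _ _ (iter i f u)).
  by apply: map_conn_iter => // l _; apply/reachable_conn; apply: conn_trans xu (conn_iterG _ Zu).
rewrite e; apply: conn_sym; first by move=> ? ?; rewrite map_adj_sym.
by apply: map_conn_iter => // l _; apply/reachable_conn; apply: conn_trans xv (conn_iterG _ Zv).
Qed.

(** Only the finite set [Fd] of the points whose forward orbit meets [F] is disturbed by the removal
    of [F]. The other points are joined to each other by their forward orbits, and every infinite
    part contains one of them. *)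
Lemma map_tree_one_ended : one_ended_graph map_tree.
Proof.
move=> C [x0 Zx0 CE] F FC finF.
have Cconn y : C y <-> conn (adj G) setT x0 y.
  rewrite CE /= reachable_conn; split; first exact: map_connG.
  exact: map_conn.
have CZ y : C y -> Z y by move=> /Cconn; apply: Zconn.
have Citer k y : C y -> C (iter k f y).
  move=> Cy; apply/Cconn; apply: conn_trans (conn_iterG _ (CZ _ Cy)); exact/Cconn.
pose Fd := [set y | Z y /\ exists k, F (iter k f y)].
have finFd : finite_set Fd.
  apply: sub_finite_set (_ : finite_set (\bigcup_(v in F) [set y | Z y /\ exists k, iter k f y = v])).
    by move=> y [Zy [k Fk]]; exists (iter k f y) => //; split=> //; exists k.
  by apply: bigcup_finite => // v Fv; apply: f_back; have [] := FC _ Fv.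
have infCF : infinite_set (C `\` Fd).
  apply: infinite_setD => //; move=> finC; apply: (infc Zx0).
  by apply: sub_finite_set finC => y /= /Cconn.
set T' := induced_sgraph _ _.
have linkT x y : C x -> ~ F x -> ~ Fd x -> C y -> ~ Fd y -> reachable T' x y.
  move=> Cx nFx nFdx Cy nFdy; rewrite reachable_induced //.
  have Zx := CZ _ Cx; have Zy := CZ _ Cy.
  have xy : conn (adj G) setT x y.
    apply: conn_trans (conn_sym _ ((Cconn _).1 Cx)) ((Cconn _).1 Cy).
    by move=> ? ?; rewrite adj_sym.
  have toA u k : C u -> ~ Fd u -> conn (adj (induced_sgraph map_tree C)) (~` F) u (iter k f u).
    move=> Cu nFdu.
    have nF i : ~ F (iter i f u) by move=> Fi; apply: nFdu; split; [apply: CZ|exists i].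
    elim: k => [|k IH]; first by apply: conn_refl; apply: (nF 0).
    apply: (conn_trans IH); apply: conn_edge; [exact: nF|exact: (nF k.+1)|].
    apply/and3P; split; last 2 first.
    - by apply/mem_set; apply: Citer.
    - by apply/mem_set; apply: (Citer k.+1).
    by apply: map_adj_f; apply: Ziter; apply: CZ.
  have [i [j e]] := f_merge Zx xy.
  apply: conn_trans (toA _ i Cx nFdx) _; rewrite e.
  by apply: conn_sym; [move=> ? ?; rewrite adj_sym|apply: toA].
have FFd y : C y -> F y -> Fd y by move=> Cy Fy; split; [apply: CZ|exists 0].
have [x [Cx nFdx]] : (C `\` Fd) !=set0 by apply: infinite_setN0.
have nFx : ~ F x by move=> Fx; apply/nFdx/FFd.
exists [set y | reachable T' x y]; split.
  split; first by exists x => //; split=> //; split=> //; apply: CZ.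
  by apply: sub_infinite_set infCF => y [Cy nFdy]; apply: linkT.
move=> C' [[y [[Zy Cy] nFy] ->] infC'].
have [z [Rz nFdz]] : ([set z | reachable T' y z] `\` Fd) !=set0.
  exact/infinite_setN0/infinite_setD.
have T'C u v : C u -> conn (adj T') setT u v -> C v.
  move=> Cu; apply: (@conn_closed _ _ setT C) => // a b _ _ /and3P[/and3P[_ _ /set_mem]] //.
have Cz : C z by apply: T'C Cy _; apply/reachable_conn.
have nFz : ~ F z by move=> Fz; apply/nFdz/FFd.
have symT u v : reachable T' u v -> reachable T' v u.
  rewrite !reachable_conn => h; apply: conn_sym h => ? ?; by rewrite adj_sym.
have transT u v w : reachable T' u v -> reachable T' v w -> reachable T' u w.
  rewrite !reachable_conn; exact: conn_trans.
have xz : reachable T' x z by apply: linkT.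
apply/seteqP; split=> w /= h.
  exact: transT _ _ _ Rz (transT _ _ _ (symT _ _ xz) h).
exact: transT _ _ _ xz (transT _ _ _ (symT _ _ Rz) h).
Qed.

Theorem map_tree_spanning : admits_borel_one_ended_spanning_tree G.
Proof.
exists map_tree; split.
- by split=> // x y; apply: map_adj_sub.
- exact: map_tree_borel.
- exact: map_tree_acyclic.
- exact: map_tree_connected.
- exact: map_tree_one_ended.
Qed.

End TreeOfMap.

(* [nb i x = x] is allowed: it pads the enumeration of the neighbours of [x]. *)
Record enumerated (X : topologicalType) (adj : X -> X -> Prop)
    (U : nat -> set X) (nb : nat -> X -> X) : Prop := Enumerated {
  en_sep : separating U;
  en_sym : forall x y, adj x y -> adj y x;
  en_irr : forall x, ~ adj x x;
  en_fin : forall x, finite_set [set y | adj x y];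
  en_inf : forall x, infinite_set [set y | conn adj setT x y];
  en_borel : forall i, borel_fun (nb i);
  en_ex : forall x y, adj x y -> exists i, nb i x = y;
  en_or : forall i x, nb i x = x \/ adj x (nb i x) }.

Definition one_ended_map (X : topologicalType) (adj : X -> X -> Prop) (Z : set X)
    (f : X -> X) :=
  [/\ borel_fun f, forall x, Z x -> adj x (f x),
      forall x, Z x -> finite_set [set y | Z y /\ exists k, iter k f y = x] &
      forall x y, Z x -> conn adj setT x y -> exists i j, iter i f x = iter j f y].

Definition conn_invariant (X : Type) (adj : X -> X -> Prop) (Z : set X) :=
  forall x y, conn adj setT x y -> Z x -> Z y.

(** * Stages of layers, and gluing of maps *)

Section Stages.
Variables (X : topologicalType) (adj : X -> X -> Prop) (U : nat -> set X)
  (nb : nat -> X -> X).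
Hypothesis en : enumerated adj U nb.

Local Notation conn := (conn adj).
Local Notation nearby := (nearby adj).
Local Notation piece := (piece nb).

Record layer := Layer {
  layer_set : set X;
  layer_in : seq (seq nat);
  layer_ring : seq (seq nat);
  layer_diam : nat;
  layer_borel : borel layer_set;
  layer_ok : layer_valid adj layer_diam layer_set (piece layer_in) (piece layer_ring) }.

(** The head of the list acts last, so a stage appended at the end acts before all the others. *)
Definition stage_op (s : seq layer) (Y : set X) : set X :=
  foldr (fun L Y => layer_op (layer_set L) (piece (layer_in L)) (piece (layer_ring L)) Y) Y s.

Definition stage_diam (s : seq layer) : nat := sumn (map layer_diam s).

Lemma stage_op_cat s t Y : stage_op (s ++ t) Y = stage_op s (stage_op t Y).
Proof. exact: foldr_cat. Qed.

Lemma stage_op_mono s Y Y' : Y `<=` Y' -> stage_op s Y `<=` stage_op s Y'.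
Proof. by move=> YY'; elim: s => //= L s IH; apply: layer_op_mono. Qed.

Lemma stage_op_borel s Y : borel Y -> borel (stage_op s Y).
Proof.
move=> bY; elim: s => //= L s IH.
apply: (borel_layer_op (en_sep en) (en_sym en) (en_borel en) (en_ex en) (en_or en)) => //.
exact: layer_borel.
Qed.

Lemma stage_op_bypassed s D Y : bypassed adj D Y ->
  bypassed adj (D + stage_diam s) (stage_op s Y).
Proof.
move=> hY; elim: s => [|L s IH]; first by rewrite addn0.
rewrite /stage_diam /= [layer_diam L + _]addnC addnA.
by apply: (bypassed_layer_op (en_sym en) (en_fin en) (en_inf en)) => //; apply: layer_ok.
Qed.

Lemma stage_op_nearby s Y z : stage_op s Y z ->
  exists2 w, Y w & nearby (stage_diam s) z w.
Proof.
elim: s z => [|L s IH] z /=; first by move=> Yz; exists z => //; apply: nearby_refl.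
move=> /(layer_op_nearby (layer_ok L))[w /IH[v Yv wv] zw].
by exists v => //; apply: nearby_trans zw wv.
Qed.

Definition cleared k (s : seq layer) : set X :=
  [set x | forall z, nearby k x z -> ~ stage_op s setT z].

Lemma borel_cleared k s : borel (cleared k s).
Proof.
apply: (@borel_eqP _ (fun x => forall v, nearby k x (walk nb v x) ->
    ~ stage_op s setT (walk nb v x))).
  move=> x; split=> [h z xz|h v]; last exact: h.
  have [v eqz] := walk_conn (en_ex en) (nearby_conn xz); rewrite eqz; apply: h.
  by rewrite -eqz.
apply: borel_all => v; apply: borel_imp.
  exact: (walk_borel_nearby (en_sep en) (en_irr en) (en_borel en) (en_ex en) (en_or en) _ [::] v).
apply: borel_not; apply: borel_preimage_walk; first exact: en_borel en.
by apply: stage_op_borel; apply: borel_cst.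
Qed.

(** The radius [(n + D).+2] is what [lucky] requires; the additional [D] pays for the displacement
    caused by the older stages, whose total diameter is at most [D]. *)
Definition clear_radius n D := (n + D).+2 + D.

Section StageSequence.
Variables (st : nat -> seq layer) (D : nat -> nat).

Fixpoint cumul n : seq layer := if n is n'.+1 then cumul n' ++ st n' else [::].

Hypothesis Dge : forall n, stage_diam (cumul n) <= D n.

Let H n := stage_op (cumul n) setT.

Definition stage_domain : set X := lucky_domain adj H D.

Lemma cleared_lucky n : cleared (clear_radius n (D n)) (st n) `<=` lucky adj H D n.
Proof.
move=> x cx z xz; rewrite /H /= stage_op_cat => /stage_op_nearby[w tw zw].
apply: (cx w) tw; apply: nearby_leq (nearby_trans xz zw).
by have := Dge n; rewrite /clear_radius; lia.
Qed.

Lemma stage_domain_ex x : (forall m, exists2 n, m <= n &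
  cleared (clear_radius n (D n)) (st n) x) -> stage_domain x.
Proof.
move=> h; exists x; first exact: conn_refl.
by move=> m; have [n mn /cleared_lucky] := h m; exists n.
Qed.

Let H0 : H 0 = setT. Proof. by []. Qed.
Let Hdec n : H n.+1 `<=` H n.
Proof. by rewrite /H /= stage_op_cat; apply: stage_op_mono. Qed.
Let Hborel n : borel (H n).
Proof. by apply: stage_op_borel; apply: borel_cst. Qed.
Let Hbyp n : bypassed adj (D n) (H n).
Proof.
apply: bypassed_leq (Dge n) _; rewrite -[stage_diam _]add0n.
exact/stage_op_bypassed/bypassed_setT.
Qed.

Lemma borel_stage_domain : borel stage_domain.
Proof.
exact: (borel_lucky_domain (en_sep en) (en_irr en) (en_borel en) (en_ex en)
  (en_or en) D Hborel).
Qed.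

Lemma stage_domain_inv : conn_invariant adj stage_domain.
Proof. move=> x y; exact: (lucky_domain_inv (en_sym en)). Qed.

Lemma stage_map : exists f, one_ended_map adj stage_domain f.
Proof.
exists (smap adj nb U H); split.
- exact: (borel_smap (en_sep en) (en_sym en) (en_irr en) (en_fin en) (en_borel en)
    (en_ex en) (en_or en) Hdec Hborel Hbyp).
- move=> x /(lucky_domain_Delta (en_sym en) H0)[n Dn].
  by have [] := smap_step U (en_sym en) (en_fin en) (en_ex en) Hdec Hbyp Dn.
- move=> x Lx; apply: sub_finite_set (smap_back_finite U (en_sym en)
    (en_fin en) (en_ex en) H0 Hdec Hbyp Lx) => y [_ []] //.
  by move=> k eqx; exists k.
- move=> x y Lx xy.
  exact: (smap_merge (en_sep en) (en_sym en) (en_fin en) (en_ex en) H0 Hdec Hbyp Lx xy).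
Qed.

End StageSequence.

Section History.
Variable pick : seq (seq layer) -> seq layer.

(** A stage is picked in view of all the previous ones, since their diameters determine the radius
    it has to clear. *)
Fixpoint hist n : seq (seq layer) :=
  if n is n'.+1 then rcons (hist n') (pick (hist n')) else [::].

Lemma size_hist n : size (hist n) = n.
Proof. by elim: n => //= n IH; rewrite size_rcons IH. Qed.

Lemma cumul_hist n : cumul (fun n => pick (hist n)) n = flatten (hist n).
Proof. by elim: n => //= n ->; rewrite -cats1 flatten_cat /= cats0. Qed.

End History.

(** The [Z i] are unions of components and orbits stay in their component, so using on each
    component the first available map never mixes two maps along an orbit. *)
Lemma one_ended_map_glue N (Z : nat -> set X) :
  (forall i, i < N -> borel (Z i)) ->
  (forall i, i < N -> conn_invariant adj (Z i)) ->
  (forall i, i < N -> exists f, one_ended_map adj (Z i) f) ->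
  exists f, one_ended_map adj [set x | exists2 i, i < N & Z i x] f.
Proof.
elim: N Z => [|N IH] Z bZ iZ fZ.
  by exists id; split=> [//|x [i]//|x [i]//|x y [i]//].
have [f [bf fadj fback fmerge]] := fZ 0 isT.
have [|||g] := IH (fun i => Z i.+1).
- by move=> i iN; apply: bZ.
- by move=> i iN; apply: iZ.
- by move=> i iN; apply: fZ.
have b0 := bZ 0 isT; have i0 := iZ 0 isT.
set W := [set x | _] => -[bg gadj gback gmerge].
have iW : conn_invariant adj W by move=> x y xy [i iN Zx]; exists i => //; apply: iZ xy Zx.
pose h x := if x \in Z 0 then f x else g x.
have hin x : Z 0 x -> h x = f x by move=> Zx; rewrite /h mem_set.
have hout x : ~ Z 0 x -> h x = g x by move=> nZ; rewrite /h memNset.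
have inv x y : conn setT x y -> Z 0 y -> Z 0 x by move=> /(conn_sym (en_sym en)); apply: i0.
have orb0 x k : Z 0 x -> iter k h x = iter k f x /\ Z 0 (iter k f x).
  move=> Zx; elim: k => //= k [-> Zk]; split; first exact: hin.
  by apply: (i0 _ _ _ Zk); apply: conn_edge => //; apply: fadj.
have orb1 x k : ~ Z 0 x -> W x -> [/\ iter k h x = iter k g x, ~ Z 0 (iter k g x) & W (iter k g x)].
  move=> nZ Wx; elim: k => //= k [-> nZk Wk]; have e := gadj _ Wk; split.
  - exact: hout.
  - by apply: contra_not nZk; apply: inv; apply: conn_edge.
  - by apply: (iW _ _ _ Wk); apply: conn_edge.
exists h; split.
- move=> B bB.
  apply: (@borel_eqP _ (fun x => (Z 0 x /\ B (f x)) \/ (~ Z 0 x /\ B (g x)))).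
    move=> x /=; case: (pselect (Z 0 x)) => Zx; [rewrite hin //|rewrite hout //].
      by split=> [[[]|[]]//|]; left.
    by split=> [[[]|[]]//|]; right.
  apply: borel_or; apply: borel_and => //; [exact: bf|exact: borel_not|exact: bg].
- move=> x [i iN Zx]; case: (pselect (Z 0 x)) => Z0x; first by rewrite hin //; apply: fadj.
  rewrite hout //; apply: gadj; case: i iN Zx => // i iN Zx; by exists i.
- move=> x [i iN Zx]; case: (pselect (Z 0 x)) => Z0x.
    apply: sub_finite_set (fback _ Z0x) => y [[j jN Zy] [k eqx]] /=.
    case: (pselect (Z 0 y)) => Z0y.
      by split=> //; exists k; rewrite -(orb0 _ k Z0y).1.
    case: j jN Zy => // j jN Zy.
    have Wy : W y by exists j.
    by have [e n _] := orb1 y k Z0y Wy; case: n; rewrite -e eqx.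
  have Wx : W x by case: i iN Zx => // i iN Zx; exists i.
  apply: sub_finite_set (gback _ Wx) => y [[j jN Zy] [k eqx]] /=.
  case: (pselect (Z 0 y)) => Z0y.
    by have [e z] := orb0 y k Z0y; case: Z0x; rewrite -eqx e.
  have Wy : W y by case: j jN Zy => // j jN Zy; exists j.
  by split=> //; exists k; have [<-] := orb1 y k Z0y Wy.
- move=> x y [i iN Zx] xy; case: (pselect (Z 0 x)) => Z0x.
    have Z0y := i0 _ _ xy Z0x; have [k [l e]] := fmerge _ _ Z0x xy; exists k, l.
    by rewrite (orb0 x k Z0x).1 (orb0 y l Z0y).1.
  have Wx : W x by case: i iN Zx => // i iN Zx; exists i.
  have nZy : ~ Z 0 y by move=> Z0y; apply: Z0x; apply: inv xy Z0y.
  have [k [l e]] := gmerge _ _ Wx xy; exists k, l.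
  by have [-> _ _] := orb1 x k Z0x Wx; have [-> _ _] := orb1 y l nZy (iW _ _ xy Wx).
Qed.

End Stages.

(** * One-ended graphs *)

Section OneEnded.
Variables (X : choiceType) (G : sgraph X).
Hypothesis GT : vset G = setT.
Hypothesis locfin : locally_finite_graph G.
Hypothesis oneend : one_ended_graph G.

Local Notation adj := (adj G).
Local Notation conn := (conn adj).
Let cls x : set X := [set y | conn setT x y].

Let adjC x y : adj x y -> adj y x. Proof. by rewrite adj_sym. Qed.

(** The set [V] is the infinite component left by one-endedness. It is cofinite in the class of [x]
    because every other component of the complement is finite and contains one of the finitely many
    neighbours of [F]. *)
Lemma infinite_part x (F : set X) : finite_set F -> exists V : set X,
  [/\ V `<=` cls x `\` F, forall u v, V u -> V v -> conn V u v,
      forall u w, V u -> adj u w -> ~ F w -> V w, infinite_set V &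
      finite_set (cls x `\` V)].
Proof.
move=> finF; set C := [set y | reachable G x y].
have Ccls : C = cls x by apply/seteqP; split=> y /reachable_conn.
have compC : graph_component G C by exists x; rewrite ?GT.
pose F' := F `&` C.
have F'sub : F' `<=` vset (induced_sgraph G C) by move=> y [_ Cy]; split=> //; rewrite GT.
have finF' : finite_set F' by apply: sub_finite_set finF => y [].
have [V [[[v0 [[_ Cv0] nFv0] VE] infV] Vuniq]] := oneend compC F'sub finF'.
have Cclosed u w : C u -> adj u w -> C w.
  rewrite Ccls /= => xu uw; apply: (conn_trans xu); exact: conn_edge.
have toG a b : C a -> ~ F' a ->
    reachable (induced_sgraph (induced_sgraph G C) (~` F')) a b <-> conn (~` F') a b.
  move=> Ca nFa; rewrite reachable_induced //; split.
    elim=> [u nu|u v w nu /and3P[uv _ _] _]; first exact: conn_refl.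
    exact: conn_step.
  move=> h; elim: h Ca {nFa} => [u nu _|u v w nu uv vw IH Cu]; first exact: conn_refl.
  apply: conn_step nu _ (IH (Cclosed _ _ Cu uv)).
  by apply/and3P; split=> //; apply/mem_set => //; apply: Cclosed uv.
have VP y : V y <-> conn (~` F') v0 y by rewrite VE /= toG.
have closedV u w : V u -> adj u w -> ~ F w -> V w.
  move=> /VP vu uw nFw; apply/VP; apply: (conn_trans vu); apply: conn_edge => //.
    exact: conn_r vu.
  by move=> [].
have VC y : V y -> C y.
  move=> /VP; apply: (@conn_closed _ _ _ C) => // u v Cu _; exact: Cclosed.
have connV u v : V u -> V v -> conn V u v.
  move=> Vu Vv; have uv : conn (~` F') u v.
    exact: conn_trans (conn_sym adjC ((VP _).1 Vu)) ((VP _).1 Vv).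
  have : conn ((~` F') `&` V) u v.
    apply: conn_inside uv => // a b /VP Va nb ab; apply/VP; apply: (conn_trans Va).
    apply: conn_edge => //; exact: conn_r Va.
  by apply: conn_sub => z [].
exists V; split=> //.
  move=> y Vy; rewrite -Ccls; split; first exact: VC.
  by move=> Fy; apply: (conn_r ((VP _).1 Vy)); split=> //; apply: VC.
rewrite -Ccls.
pose N := [set t | exists2 z, F' z & adj z t].
have finN : finite_set N.
  apply: sub_finite_set (_ : finite_set (\bigcup_(z in F') [set t | adj z t])).
    by move=> t [z Fz zt]; exists z.
  apply: bigcup_finite => [|z _]; [exact: finF'|by apply: locfin; rewrite GT].
pose K t := [set y | conn (~` F') t y].
have finK t : C t -> ~ F' t -> ~ V t -> finite_set (K t).
  move=> Ct nFt nVt; apply: contrapT => infK; apply: nVt.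
  rewrite (Vuniq (K t)); first exact: conn_refl.
  split=> //; exists t; first by split=> //; split=> //; rewrite GT.
  by apply/seteqP; split=> y /toG; apply.
apply: sub_finite_set (_ : finite_set (F' `|`
    \bigcup_(t in N `&` [set t | C t /\ ~ F' t /\ ~ V t]) K t)).
  move=> y [Cy nVy]; case: (pselect (F' y)) => [|nFy]; [by left|right].
  have yv0 : conn setT y v0.
    move: Cy Cv0; rewrite Ccls /= => xy xv0.
    exact: conn_trans (conn_sym adjC xy) xv0.
  case: (pselect (conn (~` F') y v0)) => [/(conn_sym adjC)/VP //|ncon].
  have [t yt [z Fz tz]] : exists2 t, conn (~` F') y t & exists2 z, F' z & adj t z.
    elim: yv0 nFy ncon {Cy nVy} => [u _ nu nc|u v w _ uv vw IH nu nc].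
      by case: nc; apply: conn_refl.
    case: (pselect (F' v)) => Fv.
      by exists u; [apply: conn_refl|exists v].
    have [|t vt tz] := IH Fv.
      by move=> vw'; apply: nc; apply: conn_step uv vw'.
    by exists t => //; apply: conn_step uv vt.
  exists t; last exact: conn_sym yt.
  split; first by exists z => //; apply: adjC.
  have Ct : C t by apply: (@conn_closed _ _ _ C) yt => // u v Cu _; apply: Cclosed.
  split=> //; split; first exact: conn_r yt.
  move=> /VP Vt; apply: ncon; apply: conn_trans yt (conn_sym adjC Vt).
rewrite finite_setU; split=> //; apply: bigcup_finite => [|t [_ [Ct [nFt nVt]]]].
  by apply: sub_finite_set finN => t [].
exact: finK.
Qed.

Lemma infinite_class x : infinite_set (cls x).
Proof.
have [V [Vsub _ _ infV _]] := @infinite_part x set0 (finite_set0 _).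
by apply: sub_infinite_set infV => y /Vsub[].
Qed.

Lemma one_ended_cut x (F A B : set X) : finite_set F -> cls x `<=` F `|` (A `|` B) ->
  A `&` B = set0 ->
  (forall u w, A u -> adj u w -> ~ F w -> A w) ->
  (forall u w, B u -> adj u w -> ~ F w -> B w) ->
  finite_set (cls x `&` A) \/ finite_set (cls x `&` B).
Proof.
move=> finF cov dis clA clB.
have [V [Vsub Vconn _ infV fin]] := @infinite_part x F finF.
have [v Vv] := infinite_setN0 infV.
have inD (D : set X) : D v -> (forall u w, D u -> adj u w -> ~ F w -> D w) -> V `<=` D.
  move=> Dv clD w Vw; apply: (@conn_closed _ _ V D) (Vconn _ _ Vv Vw) => // a b Da Vb ab.
  by apply: clD ab _ => //; have [] := Vsub _ Vb.
have [cv nFv] := Vsub _ Vv.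
case: (cov _ cv) => [//|[Av|Bv]].
  right; apply: sub_finite_set fin => w [cw Bw]; split=> // Vw.
  have : (A `&` B) w by split=> //; apply: (inD _ Av clA).
  by rewrite dis.
left; apply: sub_finite_set fin => w [cw Aw]; split=> // Vw.
have : (A `&` B) w by split=> //; apply: (inD _ Bv clB).
by rewrite dis.
Qed.

End OneEnded.

Lemma finite_connected_hull (X : choiceType) (adj : X -> X -> Prop) (V N : set X) :
  (forall x y, adj x y -> adj y x) ->
  (forall u v, V u -> V v -> conn adj V u v) -> N `<=` V -> finite_set N ->
  exists R : set X, [/\ finite_set R, N `<=` R, R `<=` V &
    forall u v, R u -> R v -> conn adj R u v].
Proof.
move=> adjC Vconn NV /finite_seqP[s Ns]; rewrite {}Ns in NV *.
have pathset u v : conn adj V u v -> exists Q : set X, [/\ finite_set Q, Q `<=` V, Q v &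
    forall w, Q w -> conn adj Q u w].
  elim=> [x Vx|x y z Vx xy yz [Q [finQ QV Qz Qc]]].
    exists [set x]; split=> // [w -> //|w ->]; exact: conn_refl.
  exists (x |` Q); split.
  - by rewrite finite_setU; split.
  - by move=> w [->|/QV].
  - by right.
  - have Qy : Q y by apply: conn_l (Qc _ Qz).
    move=> w [->|Qw]; first by apply: conn_refl; left.
    apply: (@conn_step _ _ _ _ y) => //; first by left.
    by apply: conn_sub (Qc _ Qw) => ?; right.
case: s NV => [|x0 s] NV; first by exists set0; split=> // u v [].
have Vx0 : V x0 by apply: NV; rewrite /= inE eqxx.
have [R [finR Rx0 sR RV Rc]] : exists R : set X, [/\ finite_set R, R x0,
    (forall z, z \in s -> R z), R `<=` V & forall w, R w -> conn adj R x0 w].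
  elim: s NV => [|a s IH] NV.
    exists [set x0]; split=> // [w -> //|w ->]; exact: conn_refl.
  have [|R [finR Rx0 sR RV Rc]] := IH.
    by move=> z; rewrite /= inE => /predU1P[->//|zs]; apply: NV; rewrite /= !inE zs !orbT.
  have Va : V a by apply: NV; rewrite /= !inE eqxx orbT.
  have [Q [finQ QV Qa Qc]] := pathset _ _ (Vconn _ _ Vx0 Va).
  exists (R `|` Q); split.
  - by rewrite finite_setU.
  - by left.
  - by move=> z; rewrite inE => /predU1P[->|/sR]; [right|left].
  - by move=> z [/RV|/QV].
  - move=> w [/Rc|/Qc]; apply: conn_sub => z; [by left|by right].
exists R; split=> // [z|u v /Rc Ru /Rc Rv].
  by rewrite /= inE => /predU1P[->|/sR].
exact: conn_trans (conn_sym adjC Ru) Rv.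
Qed.

Local Open Scope ring_scope.

Definition countable_base (X : topologicalType) (U : nat -> set X) :=
  (forall k, open (U k)) /\
  (forall x A, nbhs x A -> exists2 k, U k x & U k `<=` A).

Record complete_dist (R : realType) (X : topologicalType) (d : X -> X -> R) : Prop :=
  CompleteDist {
  dist0 : forall x y, d x y = 0 <-> x = y;
  distC : forall x y, d x y = d y x;
  dist_tri : forall x y z, d x z <= d x y + d y z;
  dist_nbhs : forall (x : X) (A : set X),
    nbhs x A <-> exists2 e : R, 0 < e & [set y | d x y < e] `<=` A;
  dist_complete : forall u : nat -> X,
    (forall e : R, 0 < e -> exists N : nat, forall m n : nat,
       (N <= m)%N -> (N <= n)%N -> d (u m) (u n) < e) ->
    exists x : X, u @ \oo --> x }.

(** * Polish spaces *)

Section PolishBase.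
Variables (R : realType) (X : ptopologicalType) (d : X -> X -> R).
Hypothesis dd : complete_dist d.
Variable q : nat -> X.
Hypothesis qdense : forall x (e : R), 0 < e -> exists n, d (q n) x < e.

Lemma distxx x : d x x = 0. Proof. exact/(dist0 dd). Qed.

Lemma dist_ge0 x y : 0 <= d x y.
Proof.
have := dist_tri dd x y x; rewrite distxx (distC dd y x) -mulr2n.
by rewrite pmulrn_lge0.
Qed.

Lemma open_ball_dist x (e : R) : open [set y | d x y < e].
Proof.
rewrite openE => y /= xy; apply/(dist_nbhs dd); exists (e - d x y).
  by rewrite subr_gt0.
move=> z /=; rewrite ltrBrDl; exact/le_lt_trans/(dist_tri dd).
Qed.

Lemma polish_hausdorff (x y : X) : x <> y -> exists A B : set X,
  [/\ open A, open B, A x, B y & A `&` B = set0].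
Proof.
move=> xy; have dpos : 0 < d x y.
  by rewrite lt_neqAle dist_ge0 andbT eq_sym; apply/eqP => /(dist0 dd).
exists [set z | d x z < d x y / 2], [set z | d y z < d x y / 2]; split.
- exact: open_ball_dist.
- exact: open_ball_dist.
- by rewrite /= distxx divr_gt0.
- by rewrite /= distxx divr_gt0.
- apply/seteqP; split=> z //= -[xz yz].
  have := dist_tri dd x z y; rewrite leNgt (distC dd z y) => /negP; apply.
  by rewrite (splitr (d x y)) ltrD.
Qed.

Definition rational_ball (k : nat) : set X :=
  if unpickle k is Some (n, m) then [set y | d (q n) y < m.+1%:R^-1] else set0.

Lemma rational_ball_base : countable_base rational_ball.
Proof.
split=> [k|x A /(dist_nbhs dd)[e e0 eA]].
  rewrite /rational_ball; case: (unpickle k) => [[n m]|]; last exact: open0.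
  exact: open_ball_dist.
have [m me] : exists m : nat, m.+1%:R^-1 < e / 2 :> R.
  have e2 : 0 < e / 2 by rewrite divr_gt0.
  by have [N _ /(_ N (leqnn N)) /= h] := near_infty_natSinv_lt (PosNum e2); exists N.
have m0 : 0 < m.+1%:R^-1 :> R by rewrite invr_gt0.
have [n nx] := qdense x m0.
exists (pickle (n, m)); rewrite /rational_ball pickleK //= => y ny.
apply: eA => /=; apply: le_lt_trans (dist_tri dd x (q n) y) _.
rewrite (splitr e) ltrD // ?(distC dd x); exact: lt_trans me.
Qed.

End PolishBase.

Lemma polish_data (R : realType) (X : ptopologicalType) : polish R X ->
  exists (d : X -> X -> R) (q : nat -> X), complete_dist d /\
    forall x (e : R), 0 < e -> exists n, d (q n) x < e.
Proof.
move=> [[D cD dD] [d [h1 h2 h3 h4 h5]]]; exists d.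
have dd : complete_dist d by [].
have [f fi] : exists f : X -> nat, set_inj D f by apply/countable_injP.
exists (fun n => if pselect (exists x, D x /\ f x = n) is left e then projT1 (cid e) else point).
split=> // x e e0.
have [||y [/= xy Dy]] := dD [set y | d x y < e].
- by exists x; rewrite /= (distxx dd).
- exact: open_ball_dist.
exists (f y); case: pselect => [e'|]; last by case; exists y.
case: cid => z [Dz fz] /=; rewrite (fi z y) ?inE //; by rewrite (distC dd).
Qed.

Section BaseLemmas.
Variables (X : topologicalType) (U : nat -> set X).
Hypothesis Ubase : countable_base U.

Lemma base_separating :
  (forall x y : X, x <> y -> exists A B : set X,
    [/\ open A, open B, A x, B y & A `&` B = set0]) -> separating U.
Proof.
move=> T2; split=> [k|x y /T2[A [B [oA oB Ax By AB]]]].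
  by apply: borel_open; apply: Ubase.1.
have [k Ux UA] := Ubase.2 x A (open_nbhs_nbhs (conj oA Ax)).
exists k => // Uy; have : (A `&` B) y by split=> //; apply: UA.
by rewrite AB.
Qed.

Lemma base_open (A : set X) : open A ->
  A = \bigcup_(k in [set k | U k `<=` A]) U k.
Proof.
move=> oA; apply/seteqP; split=> [x Ax|x [k /= UA /UA //]].
have [k Ux UA] := Ubase.2 x A (open_nbhs_nbhs (conj oA Ax)).
by exists k.
Qed.

Lemma base_isolate x (F : set X) : separating U -> finite_set F ->
  exists2 k, U k x & forall z, F z -> U k z -> z = x.
Proof.
move=> Usep /finite_seqP[s ->].
have [A oA [Ax hA]] : exists2 A : set X, open A & A x /\ forall z, z \in s -> A z -> z = x.
  elim: s => [|a s [A oA [Ax hA]]].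
    by exists setT; first exact: openT.
  case: (eqVneq a x) => [->|ax].
    exists A => //; split=> // z; rewrite inE => /predU1P[//|]; exact: hA.
  have [k Ux nUa] := Usep.2 x a (fun e => elimN eqP ax (esym e)).
  exists (A `&` U k); first by apply: openI => //; apply: Ubase.1.
  split=> // z; rewrite inE => /predU1P[-> []//|zs [Az _]]; exact: hA.
have [k Ux UA] := Ubase.2 x A (open_nbhs_nbhs (conj oA Ax)).
by exists k => // z zs /UA; apply: hA.
Qed.

End BaseLemmas.

(** * Borel discrete sets of centres *)

Section Discrete.
Variables (X : topologicalType) (adj : X -> X -> Prop) (U : nat -> set X)
  (nb : nat -> X -> X).
Hypothesis en : enumerated adj U nb.
Hypothesis Ubase : countable_base U.

Local Notation nearby := (nearby adj).

Definition discrete_set k (A : set X) := forall x y, A x -> A y -> nearby k x y -> x = y.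

(** The classical countable Borel colouring of a locally finite graph: [x] gets the colour [i] when
    the basic set [U i] isolates it in its ball of radius [k]. *)
Definition discrete_cover k i : set X :=
  [set x | U i x /\ forall z, nearby k x z -> U i z -> z = x].

Lemma borel_all_nearby k (Q : X -> X -> Prop) :
  (forall v, borel [set x | Q x (walk nb v x)]) ->
  borel [set x | forall z, nearby k x z -> Q x z].
Proof.
move=> bQ; apply: (@borel_eqP _ (fun x => forall v, nearby k x (walk nb v x) ->
    Q x (walk nb v x))).
  move=> x; split=> [h z xz|h v]; last exact: h.
  have [v eqz] := walk_conn (en_ex en) (nearby_conn xz); rewrite eqz; apply: h.
  by rewrite -eqz.
apply: borel_all => v; apply: borel_imp; last exact: bQ.
exact: (walk_borel_nearby (en_sep en) (en_irr en) (en_borel en) (en_ex en) (en_or en) _ [::] v).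
Qed.

Lemma borel_discrete_cover k i : borel (discrete_cover k i).
Proof.
apply: borel_and; first exact: (en_sep en).1.
apply: borel_all_nearby => v; apply: borel_imp.
  by apply: borel_preimage_walk; [exact: en_borel en|exact: (en_sep en).1].
exact: (walk_borel_eq (en_sep en) (en_borel en) v [::]).
Qed.

Lemma discrete_cover_discrete k i : discrete_set k (discrete_cover k i).
Proof. by move=> x y [Ux hx] [Uy hy] xy; rewrite (hx y). Qed.

Lemma discrete_cover_ex k x : exists i, discrete_cover k i x.
Proof.
have [i Ux hi] := base_isolate Ubase x (en_sep en) (nearby_finite (en_fin en) k x).
by exists i; split.
Qed.

Fixpoint greedy_set (A : set X) k n : set X :=
  if n is n'.+1 then greedy_set A k n' `|`
    [set x | A x /\ discrete_cover k n' x /\ forall z, nearby k x z -> ~ greedy_set A k n' z]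
  else set0.

Lemma greedy_mono A k m n : (m <= n)%N -> greedy_set A k m `<=` greedy_set A k n.
Proof. by move=> /subnK <-; elim: (n - m)%N => // l IH x; rewrite addSn; left; apply: IH. Qed.

Lemma greedy_sub A k n : greedy_set A k n `<=` A.
Proof. by elim: n => //= n IH x [/IH|[]]. Qed.

Lemma greedy_discrete A k n : discrete_set k (greedy_set A k n).
Proof.
elim: n => [x y []|n IH x y /=]; move=> [gx|[Ax [cx nx]]] [gy|[Ay [cy ny]]] xy.
- exact: IH.
- by case: (ny x) => //; apply: (nearby_sym (en_sym en)).
- by case: (nx y).
- exact: discrete_cover_discrete cx cy xy.
Qed.

Lemma borel_greedy A k n : borel A -> borel (greedy_set A k n).
Proof.
move=> bA; elim: n => [|n IH]; first exact: (@borel_cst _ False).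
apply: borel_or => //; apply: borel_and => //; apply: borel_and.
  exact: borel_discrete_cover.
apply: (@borel_all_nearby k (fun _ z => ~ greedy_set A k n z)) => v.
by apply: borel_not; apply: borel_preimage_walk; first exact: en_borel en.
Qed.

(** The colours are examined one after the other. A colour class is itself [k]-discrete, so all its
    points that are far from the previous ones can be added together. *)
Lemma maximal_discrete A k : borel A -> exists C : set X,
  [/\ borel C, C `<=` A, discrete_set k C &
      forall x, A x -> exists2 z, C z & nearby k x z].
Proof.
move=> bA; exists (\bigcup_n greedy_set A k n); split.
- apply: (@borel_eqP _ (fun x => exists n, greedy_set A k n x)).
    by move=> x; split=> -[n]; exists n.
  by apply: borel_ex_nat => n; apply: borel_greedy.
- by move=> x [n _ /greedy_sub].
- move=> x y [n _ gx] [m _ gy]; apply: (@greedy_discrete A k (maxn n m)).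
    by apply: greedy_mono gx; apply: leq_maxl.
  by apply: greedy_mono gy; apply: leq_maxr.
- move=> x Ax; have [i ci] := discrete_cover_ex k x.
  case: (pselect (exists2 z, greedy_set A k i z & nearby k x z)) => [[z gz xz]|nex].
    by exists z => //; exists i.
  exists x; last exact: nearby_refl.
  exists i.+1 => //; right; split=> //; split=> // z xz gz; apply: nex.
  by exists z.
Qed.

End Discrete.

Local Close Scope ring_scope.

Local Open Scope ring_scope.

(** * Analytic sets and Lusin-Novikov uniformization *)

Definition t2 (X : topologicalType) := forall x y : X, x <> y ->
  exists A B : set X, [/\ open A, open B, A x, B y & A `&` B = set0].

(* A set is analytic when it is the kernel of a regular scheme: along every
   branch through nonempty sets the scheme shrinks to a point of the set. *)
Definition analytic (X : topologicalType) (A : set X) := exists D : seq nat -> set X,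
  [/\ D [::] = A, forall s i, D (rcons s i) `<=` D s,
      forall s x, D s x -> exists i, D (rcons s i) x &
      forall a : nat -> nat, (forall n, D (mkseq a n) !=set0) ->
        exists x, A x /\ forall O, open O -> O x -> exists n, D (mkseq a n) `<=` O].

Lemma mkseqS_rcons (T : Type) (a : nat -> T) n : mkseq a n.+1 = rcons (mkseq a n) (a n).
Proof. by rewrite mkseqS. Qed.

Section Novikov.
Variables (X : topologicalType).
Hypothesis XT2 : t2 X.
Variable A : nat -> set X.

Definition separated (D : nat -> set X) := exists B : nat -> set X,
  (forall n, borel (B n) /\ D n `<=` B n) /\ \bigcap_n B n = set0.

(** Used by contraposition: when one set of a family that cannot be separated is split into
    countably many parts, one of the parts still gives such a family. *)
Lemma separated_split (D : nat -> set X) n (E : nat -> set X) :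
  D n `<=` \bigcup_i E i ->
  (forall i, separated (fun m => if m == n then E i else D m)) -> separated D.
Proof.
move=> DE /choice[B hB].
exists (fun m => if m == n then \bigcup_i B i n else \bigcap_i B i m); split=> [m|].
  case: (eqVneq m n) => [->|mn].
    split.
      apply: sigma_algebra_bigcup => i; exact: ((hB i).1 n).1.
    by move=> x /DE[i _ Ex]; exists i => //; have [_] := (hB i).1 n; rewrite eqxx; apply.
  split.
    apply: (@borel_eqP _ (fun x => forall i, B i m x)).
      by move=> x; split=> [h i _|h i]; apply: h.
    by apply: borel_all => i; have [] := (hB i).1 m.
  by move=> x Dx i _; have [_] := (hB i).1 m; rewrite (negPf mn); apply.
apply/seteqP; split=> // x hx.
have := hx n I; rewrite eqxx => -[i _ Bx].
rewrite -(hB i).2 => m _; have := hx m I; case: (eqVneq m n) => [->//|_]; exact.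
Qed.

(** If separation failed, the schemes could be refined along branches while keeping it impossible,
    and each branch would shrink to a point of its [A n]. Two distinct limits would have disjoint
    neighbourhoods, which separate a late stage; so all limits agree, in the empty intersection. *)
Theorem novikov : (forall n, analytic (A n)) -> \bigcap_n A n = set0 -> separated A.
Proof.
move=> /choice[D hD] A0; apply: contrapT => nsep.
pose DD (s : nat -> seq nat) := fun n => D n (s n).
have ext t s : ~ separated (DD s) -> exists i : nat -> nat,
    ~ separated (DD (fun n => if (n < t)%N then rcons (s n) (i n) else s n)).
  move=> ns; elim: t => [|t [i IH]]; first by exists (fun=> 0%N).
  apply: contrapT => nex; apply: IH.
  apply: (@separated_split _ t (fun j => D t (rcons (s t) j))).
    by move=> x; rewrite /DD ltnn => Dx; have [_ _ h _] := hD t; have [j] := h _ _ Dx; exists j.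
  move=> j; apply: contrapT => nj; apply: nex.
  exists (fun n => if n == t then j else i n) => sp; apply: nj.
  move: sp; congr separated; apply/funext => n; rewrite /DD ltnS leq_eqVlt.
  by case: (eqVneq n t) => [->|nt] //=; rewrite ltnn.
have [next hnext] : exists next : nat -> (nat -> seq nat) -> (nat -> nat), forall t s,
    ~ separated (DD s) ->
    ~ separated (DD (fun n => if (n < t)%N then rcons (s n) (next t s n) else s n)).
  have /choice[g hg] (ts : nat * (nat -> seq nat)) : exists i : nat -> nat,
      ~ separated (DD ts.2) ->
      ~ separated (DD (fun n => if (n < ts.1)%N then rcons (ts.2 n) (i n) else ts.2 n)).
    case: (pselect (separated (DD ts.2))) => [|ns]; first by exists (fun=> 0%N).
    by have [i hi] := ext ts.1 ts.2 ns; exists i.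
  by exists (fun t s => g (t, s)) => t s; apply: (hg (t, s)).
(* Passing to time [t] refines the sets of index less than [t] only, finitely many splits; hence the
   [n]-th branch starts at time [n]. *)
pose fix sg t := if t is t'.+1 then
  (fun n => if (n < t'.+1)%N then rcons (sg t' n) (next t'.+1 (sg t') n) else sg t' n)
  else (fun=> [::]).
have sgn t : ~ separated (DD (sg t)).
  elim: t => [|t IH] /=; last exact: hnext.
  move=> sp; apply: nsep; move: sp; congr separated; apply/funext => n.
  by have [] := hD n.
have sg0 n t : (t <= n)%N -> sg t n = [::].
  elim: t => //= t IH tn; rewrite ltnS leqNgt tn /=; apply: IH; exact: ltnW.
pose al n k := next (n + k).+1 (sg (n + k)%N) n.
have sgal n k : sg (n + k)%N n = mkseq (al n) k.
  elim: k => [|k IH]; first by rewrite addn0 sg0.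
  by rewrite addnS /= ltnS leq_addr mkseqS_rcons IH.
have mono n s t : (s <= t)%N -> D n (sg t n) `<=` D n (sg s n).
  move=> /subnK <-; elim: (t - s)%N => // k IH; rewrite addSn /=.
  case: ifP => // _; apply: subset_trans IH; have [_ h _ _] := hD n; exact: h.
have ne n t : D n (sg t n) !=set0.
  apply: contrapT => /set0P/negP/negPn/eqP e; apply: (sgn t).
  exists (fun m => if m == n then set0 else setT); split=> [m|].
    case: eqP => [->|_]; first by split; [exact: (@borel_cst _ False)|rewrite /DD e].
    by split=> //; exact: (@borel_cst _ True).
  by apply/seteqP; split=> // x /(_ n I); rewrite eqxx.
have lim n : exists x, A n x /\ forall O, open O -> O x -> exists t, D n (sg t n) `<=` O.
  have [_ _ _ h] := hD n; have [|x [Ax hx]] := h (al n).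
    by move=> k; rewrite -sgal; apply: ne.
  by exists x; split=> // O oO Ox; have [k] := hx O oO Ox; exists (n + k)%N; rewrite sgal.
have [x hx] := choice lim.
have eqx n : x n = x 0%N.
  apply: contrapT => /XT2[V1 [V2 [w1 w2 V1x V2x dis]]].
  have [t1 h1] := (hx n).2 V1 w1 V1x; have [t2' h2] := (hx 0%N).2 V2 w2 V2x.
  have n0 : n != 0%N.
    apply/eqP => n0; rewrite n0 in V1x; have : (V1 `&` V2) (x 0%N) by [].
    by rewrite dis.
  apply: (sgn (maxn t1 t2')).
  exists (fun m => if m == n then V1 else if m == 0%N then V2 else setT); split=> [m|].
    case: (eqVneq m n) => [->|_].
      split; first exact: borel_open.
      by apply: subset_trans h1; apply: mono; apply: leq_maxl.
    case: (eqVneq m 0%N) => [->|_]; last by split=> //; exact: (@borel_cst _ True).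
    split; first exact: borel_open.
    by apply: subset_trans h2; apply: mono; apply: leq_maxr.
  apply/seteqP; split=> // z hz.
  have := hz n I; rewrite eqxx; have := hz 0%N I; rewrite eq_sym (negPf n0) eqxx.
  by move=> ? ?; rewrite -dis.
have : (\bigcap_n A n) (x 0%N) by move=> n _; rewrite -(eqx n); apply: (hx n).1.
by rewrite A0.
Qed.

End Novikov.

Lemma analytic_bigcup (X : topologicalType) (A : nat -> set X) :
  (forall n, analytic (A n)) -> analytic (\bigcup_n A n).
Proof.
move=> /choice[D hD].
exists (fun s => if s is i :: s' then D i s' else \bigcup_n A n); split=> //.
- move=> [|j s] i /=; last by have [_ h _ _] := hD j; apply: h.
  by move=> x; have [-> _ _ _] := hD i; exists i.
- move=> [|j s] x /=; last by have [_ _ h _] := hD j; apply: h.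
  by move=> [i _ Ax]; exists i; have [-> _ _ _] := hD i.
- move=> a ne; have [_ _ _ h] := hD (a 0%N).
  have shift n : mkseq a n.+1 = a 0%N :: mkseq (a \o S) n.
    by rewrite /mkseq /= (iotaDl 1 0) -map_comp.
  have [|x [Ax hx]] := h (a \o S); first by move=> n; have := ne n.+1; rewrite shift.
  exists x; split; first by exists (a 0%N).
  by move=> O oO Ox; have [n hn] := hx O oO Ox; exists n.+1; rewrite shift.
Qed.

Lemma analyticU (X : topologicalType) (A B : set X) :
  analytic A -> analytic B -> analytic (A `|` B).
Proof.
move=> hA hB; rewrite (_ : A `|` B = \bigcup_n (if n is 0%N then A else B)).
  by apply: analytic_bigcup => -[|n].
apply/seteqP; split=> x; first by case=> h; [exists 0%N|exists 1%N].
by case=> -[|n] _ h; [left|right].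
Qed.

Section Interleave.
Let dec (m : nat) : seq nat := odflt [::] (unpickle m).

(* A branch codes countably many branches, the [n]-th one starting at time [n]. *)
Definition thread n (s : seq nat) : seq nat :=
  [seq nth 0%N (dec (nth 0%N s j)) n | j <- iota n (size s - n)].

Lemma thread_rcons n s i : thread n (rcons s i) =
  if (n <= size s)%N then rcons (thread n s) (nth 0%N (dec i) n) else [::].
Proof.
rewrite /thread size_rcons; case: leqP => ns; last first.
  by rewrite (_ : _ - _ = 0)%N //; apply/eqP; rewrite subn_eq0.
rewrite subSn // -addn1 iotaD map_cat cats1 /= subnKC //; congr rcons.
  apply/eq_in_map => j; rewrite mem_iota subnKC // => /andP[_ js].
  by rewrite nth_rcons js.
by rewrite nth_rcons ltnn eqxx.
Qed.

Lemma thread_mkseq n (a : nat -> nat) k :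
  thread n (mkseq a (n + k)) = mkseq (fun k => nth 0%N (dec (a (n + k)%N)) n) k.
Proof.
elim: k => [|k IH]; first by rewrite /thread size_mkseq addn0 subnn.
by rewrite addnS !mkseqS_rcons thread_rcons size_mkseq leq_addr IH.
Qed.

Lemma analytic_bigcap (X : topologicalType) (A : nat -> set X) : t2 X ->
  (forall n, analytic (A n)) -> analytic (\bigcap_n A n).
Proof.
move=> XT2 /choice[D hD].
exists (fun s => \bigcap_n D n (thread n s)); split=> //.
- apply/seteqP; split=> x hx n _; have := hx n I; rewrite /thread /=;
    by have [-> _ _ _] := hD n.
- move=> s i x hx n _; have := hx n I; rewrite thread_rcons.
  case: ifP => [_|/negbT]; first by have [_ h _ _] := hD n; apply: h.
  by rewrite -ltnNge /thread => /ltnW; rewrite -subn_eq0 => /eqP ->.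
- move=> s x hx.
  have /choice[i hi] n : exists i, D n (rcons (thread n s) i) x.
    by have [_ _ h _] := hD n; apply: h; apply: hx.
  (* The threads [0], ..., [size s] are those that grow at this time, whence the length
     [(size s).+1]. *)
  exists (pickle (mkseq i (size s).+1)) => n _; rewrite thread_rcons /dec pickleK /=.
  case: ifP => [ns|/negbT]; first by rewrite nth_mkseq.
  rewrite -ltnNge => /ltnW ns; have := hx n I.
  by rewrite /thread; move: ns; rewrite -subn_eq0 => /eqP ->.
- move=> a ne.
  have /choice[x hx] n : exists x, A n x /\ forall O, open O -> O x ->
      exists k, D n (thread n (mkseq a k)) `<=` O.
    have [_ _ _ h] := hD n.
    have [|x [Ax hx]] := h (fun k => nth 0%N (dec (a (n + k)%N)) n).
      by move=> k; rewrite -thread_mkseq; have [y hy] := ne (n + k)%N; exists y; apply: hy.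
    exists x; split=> // O oO Ox; have [k] := hx O oO Ox.
    by rewrite -thread_mkseq; exists (n + k)%N.
  have mono n k l : (k <= l)%N -> D n (thread n (mkseq a l)) `<=` D n (thread n (mkseq a k)).
    move=> /subnK <-; elim: (l - k)%N => // m IH; rewrite addSn mkseqS_rcons thread_rcons.
    case: ifP => [_|/negbT]; last first.
      rewrite -ltnNge size_mkseq => ltn.
      rewrite /thread size_mkseq (_ : k - n = 0)%N //.
      by apply/eqP; rewrite subn_eq0; apply: leq_trans (ltnW ltn); apply: leq_addl.
    by apply: subset_trans IH; have [_ h _ _] := hD n; apply: h.
  have eqx n : x n = x 0%N.
    apply: contrapT => /XT2[V1 [V2 [w1 w2 V1x V2x dis]]].
    have [t1 h1] := (hx n).2 V1 w1 V1x; have [t2' h2] := (hx 0%N).2 V2 w2 V2x.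
    have [y hy] := ne (maxn t1 t2').
    have : (V1 `&` V2) y.
      split; [apply: h1; apply: mono (hy n I)|apply: h2; apply: mono (hy 0%N I)].
        exact: leq_maxl.
      exact: leq_maxr.
    by rewrite dis.
  exists (x 0%N); split; first by move=> n _; rewrite -(eqx n); apply: (hx n).1.
  move=> O oO Ox; have [k hk] := (hx 0%N).2 O oO Ox; exists k => y hy.
  exact/hk/hy.
Qed.

End Interleave.

Definition rectangle (X Y : Type) (A : set X) (B : set Y) : set (X * Y) :=
  [set p | A p.1 /\ B p.2].

Lemma prod_open_rect (X Y : topologicalType) (O : set (X * Y)) p : open O -> O p ->
  exists A B, [/\ open A, open B, A p.1, B p.2 & rectangle A B `<=` O].
Proof.
move=> oO Op; have : nbhs p O by apply: open_nbhs_nbhs.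
case=> -[A B] /= [nA nB] sub.
exists A°, B°; split; [exact: open_interior|exact: open_interior|exact: nA|exact: nB|].
move=> [x y] /= [/interior_subset Ax /interior_subset By]; exact: (sub (x, y)).
Qed.

Lemma open_rectangle (X Y : topologicalType) (A : set X) (B : set Y) :
  open A -> open B -> open (rectangle A B).
Proof.
move=> oA oB; rewrite openE => -[x y] [Ax By].
exists (A, B) => //=; split; by [apply: open_nbhs_nbhs].
Qed.

Lemma analytic_rectangle (X Y : topologicalType) (A : set X) (B : set Y) :
  analytic A -> analytic B -> analytic (rectangle A B).
Proof.
move=> [D [D0 Dsub Dex Dlim]] [E [E0 Esub Eex Elim]].
pose dec (m : nat) : nat * nat := odflt (0%N, 0%N) (unpickle m).
exists (fun s => rectangle (D (map (fst \o dec) s)) (E (map (snd \o dec) s))); split.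
- by rewrite /= D0 E0.
- by move=> s i [x y]; rewrite !map_rcons => -[/= /Dsub ? /Esub ?].
- move=> s [x y] [/= /Dex[i Di] /Eex[j Ej]]; exists (pickle (i, j)).
  by rewrite !map_rcons /rectangle /= /dec pickleK.
- move=> a ne.
  have e1 n : map (fst \o dec) (mkseq a n) = mkseq (fst \o dec \o a) n by rewrite /mkseq -map_comp.
  have e2 n : map (snd \o dec) (mkseq a n) = mkseq (snd \o dec \o a) n by rewrite /mkseq -map_comp.
  have [|x [Ax hx]] := Dlim (fst \o dec \o a).
    by move=> n; rewrite -e1; have [[u v] [/= hu _]] := ne n; exists u.
  have [|y [By hy]] := Elim (snd \o dec \o a).
    by move=> n; rewrite -e2; have [[u v] [/= _ hv]] := ne n; exists v.
  exists (x, y); split=> // O oO Oxy.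
  have [A' [B' [oA oB Ax' By' sub]]] := prod_open_rect oO Oxy.
  have [n hn] := hx _ oA Ax'; have [m hm] := hy _ oB By'.
  have Dmono k l : (k <= l)%N -> D (mkseq (fst \o dec \o a) l) `<=` D (mkseq (fst \o dec \o a) k).
    move=> /subnK <-; elim: (l - k)%N => // i IH; rewrite addSn mkseqS_rcons.
    exact: subset_trans (Dsub _ _) IH.
  have Emono k l : (k <= l)%N -> E (mkseq (snd \o dec \o a) l) `<=` E (mkseq (snd \o dec \o a) k).
    move=> /subnK <-; elim: (l - k)%N => // i IH; rewrite addSn mkseqS_rcons.
    exact: subset_trans (Esub _ _) IH.
  exists (maxn n m) => -[u v]; rewrite e1 e2 => -[/= hu hv]; apply: sub; split=> /=.
    by apply: hn; apply: Dmono hu; apply: leq_maxl.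
  by apply: hm; apply: Emono hv; apply: leq_maxr.
Qed.

Lemma analytic_fst (X Y : topologicalType) (A : set (X * Y)) :
  analytic A -> analytic [set x | exists y, A (x, y)].
Proof.
move=> [D [D0 Dsub Dex Dlim]].
exists (fun s => [set x | exists y, D s (x, y)]); split.
- by rewrite D0.
- by move=> s i x [y /Dsub]; exists y.
- by move=> s x [y /Dex[i]]; exists i, y.
- move=> a ne; have [|[x y] [Axy hxy]] := Dlim a.
    by move=> n; have [x [y]] := ne n; exists (x, y).
  exists x; split; first by exists y.
  move=> O oO Ox; have [|//|n hn] := hxy (rectangle O setT).
    by apply: open_rectangle => //; exact: openT.
  by exists n => z [t /hn[]].
Qed.

(** Retains what is used of Polish spaces in a form that passes to products, so that no complete
    metric has to be built on [X * X] and [X * X * X]. *)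
Record suslin (X : topologicalType) : Prop := Suslin {
  suslin_t2 : t2 X;
  suslin_base : exists U : nat -> set X, countable_base U;
  suslin_open : forall O : set X, open O -> analytic O /\ analytic (~` O) }.

Lemma borel_analytic (X : topologicalType) (A : set X) : suslin X -> borel A -> analytic A.
Proof.
move=> sX bA; pose C := [set B : set X | analytic B /\ analytic (~` B)].
suff h : <<s @open X >> `<=` C by have [] := h _ bA.
apply: smallest_sub => [|O oO]; last exact: suslin_open.
split.
- by split; [|rewrite setC0]; have [] := suslin_open sX (@openT X) => //; rewrite setCT.
- by move=> B [? ?]; rewrite setTD; split; rewrite ?setCK.
- move=> B CB; split; first by apply: analytic_bigcup => n; have [] := CB n.
  rewrite setC_bigcup; apply: analytic_bigcap; first exact: suslin_t2.
  by move=> n; have [] := CB n.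
Qed.

Lemma suslin_prod (X Y : topologicalType) : suslin X -> suslin Y -> suslin (X * Y)%type.
Proof.
move=> [tX [U Ub] oX] [tY [V Vb] oY].
have tXY : t2 (X * Y)%type.
  move=> [x y] [x' y'] ne; case: (pselect (x = x')) => [exx|/tX[A [B [oA oB Ax Bx dis]]]].
    have [|A [B [oA oB Ay By dis]]] := tY y y'; first by move=> e; apply: ne; rewrite exx e.
    exists (rectangle setT A), (rectangle setT B); split=> //.
    - by apply: open_rectangle => //; exact: openT.
    - by apply: open_rectangle => //; exact: openT.
    - by apply/seteqP; split=> // -[u v] [[_ /= Av] [_ /= Bv]]; have : (A `&` B) v by []; rewrite dis.
  exists (rectangle A setT), (rectangle B setT); split=> //.
  - by apply: open_rectangle => //; exact: openT.
  - by apply: open_rectangle => //; exact: openT.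
  - by apply/seteqP; split=> // -[u v] [[/= Au _] [/= Bu _]]; have : (A `&` B) u by []; rewrite dis.
pose W k := if unpickle k is Some (i, j) then rectangle (U i) (V j) else set0.
have Wb : countable_base W.
  split=> [k|[x y] A nA].
    rewrite /W; case: (unpickle k) => [[i j]|]; last exact: open0.
    by apply: open_rectangle; [apply: Ub.1|apply: Vb.1].
  case: nA => -[A' B'] /= [nA nB] sub.
  have [i Ui UA] := Ub.2 _ _ nA; have [j Vj VB] := Vb.2 _ _ nB.
  exists (pickle (i, j)); rewrite /W pickleK //= => -[u v] [/= /UA ? /VB ?].
  exact: (sub (u, v)).
split=> //; first by exists W.
have aT (Z : topologicalType) : (forall O : set Z, open O -> analytic O /\ analytic (~` O)) ->
    analytic (@setT Z) /\ analytic (@set0 Z).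
  by move=> oZ; have [] := oZ setT openT; rewrite setCT.
have [aTX a0X] := aT _ oX; have [aTY a0Y] := aT _ oY.
have aW k : analytic (W k) /\ analytic (~` W k).
  rewrite /W; case: (unpickle k) => [[i j]|]; last first.
    rewrite setC0 (_ : set0 = rectangle set0 set0); last by apply/seteqP; split=> // z [].
    rewrite (_ : setT = rectangle setT setT); last by apply/seteqP; split.
    by split; apply: analytic_rectangle.
  have [aU aU'] := oX _ (Ub.1 i); have [aV aV'] := oY _ (Vb.1 j).
  split; first exact: analytic_rectangle.
  rewrite (_ : ~` _ = rectangle (~` U i) setT `|` rectangle setT (~` V j)).
    by apply: analyticU; apply: analytic_rectangle.
  apply/seteqP; split=> -[u v]; rewrite /rectangle /=; last by case=> -[? ?] [].
  by move=> n; case: (pselect (U i u)) => Ui; [right|left]; split=> // Vj; apply: n.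
move=> O oO.
have OE : O = \bigcup_n (if pselect (W n `<=` O) then W n else set0).
  rewrite {1}(base_open Wb oO); apply/seteqP; split=> z [k /= h Wz]; exists k => //.
    by case: pselect.
  by move: Wz; case: pselect.
  by move: Wz; case: pselect.
have a0 : analytic (@set0 (X * Y)) /\ analytic (@setT (X * Y)).
  by have [] := aW (pickle (0%N, 0%N)) => _ _; split;
   [rewrite (_ : set0 = rectangle set0 set0); last by apply/seteqP; split=> // z []
   |rewrite (_ : setT = rectangle setT setT); last by apply/seteqP; split];
   apply: analytic_rectangle.
split.
  rewrite OE; apply: analytic_bigcup => n; case: pselect => ?; [exact: (aW n).1|exact: a0.1].
rewrite OE setC_bigcup; apply: analytic_bigcap => // n.
case: pselect => ?; [exact: (aW n).2|rewrite setC0; exact: a0.2].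
Qed.

Local Close Scope ring_scope.

Local Open Scope ring_scope.

Section PolishSuslin.
Variables (R : realType) (X : ptopologicalType) (d : X -> X -> R).
Hypothesis dd : complete_dist d.
Variable q : nat -> X.
Hypothesis qdense : forall x (e : R), 0 < e -> exists n, d (q n) x < e.

Lemma inv_small (e : R) : 0 < e -> exists m : nat, m.+1%:R^-1 < e :> R.
Proof.
move=> e0; have [N _ /(_ N (leqnn N)) /= h] := near_infty_natSinv_lt (PosNum e0).
by exists N.
Qed.

Lemma inv_gt0 (m : nat) : 0 < m.+1%:R^-1 :> R. Proof. by rewrite invr_gt0. Qed.

Lemma inv_le (m n : nat) : (m <= n)%N -> n.+1%:R^-1 <= m.+1%:R^-1 :> R.
Proof. by move=> mn; rewrite lef_pV2 ?posrE // ler_nat. Qed.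

Lemma cvg_dist (u : nat -> X) x : u @ \oo --> x -> forall e : R, 0 < e ->
  exists N : nat, forall n, (N <= n)%N -> d x (u n) < e.
Proof.
move=> ux e e0; have /ux[N _ h] : nbhs x [set y | d x y < e] by apply/(dist_nbhs dd); exists e.
by exists N => n Nn; apply: (h n).
Qed.

(** The [j]-th letter names a closed ball of radius [1 / j.+1] centred at a point of the dense
    sequence. Points chosen along a branch form a Cauchy sequence, whose limit stays in all these
    balls and in [C]. *)
Lemma analytic_closed (C : set X) : closed C -> analytic C.
Proof.
move=> cC.
exists (fun s => [set x | C x /\ forall j, (j < size s)%N -> d (q (nth 0%N s j)) x <= j.+1%:R^-1]).
split.
- by apply/seteqP; split=> x /= => [[]|Cx].
- move=> s i x [Cx h]; split=> // j js; have := h j; rewrite size_rcons ltnS ltnW //.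
  by rewrite nth_rcons js; apply.
- move=> s x [Cx h]; have [i di] := qdense x (inv_gt0 (size s)).
  exists i; split=> // j; rewrite size_rcons ltnS nth_rcons.
  by case: ltngtP => // [js|->] _; [apply: h|apply: ltW].
- move=> a /choice[x hx].
  have close m n j : (j < m)%N -> (j < n)%N -> d (x m) (x n) <= j.+1%:R^-1 + j.+1%:R^-1.
    move=> jm jn; apply: le_trans (dist_tri dd _ (q (a j)) _) _.
    have := (hx m).2 j; have := (hx n).2 j; rewrite !size_mkseq !nth_mkseq // => h1 h2.
    by rewrite lerD // ?(distC dd (x m)); [apply: h2|apply: h1].
  have [e e0|y xy] := dist_complete dd (u := x).
    have e2 : 0 < e / 2 by rewrite divr_gt0.
    have [j je] := inv_small e2; exists j.+1 => m n jm jn.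
    by apply: le_lt_trans (close m n j jm jn) _; rewrite (splitr e) ltrD.
  have Cy : C y.
    apply: contrapT => nC; have : nbhs y (~` C).
      by apply: open_nbhs_nbhs; split=> //; apply: closed_openC.
    by move=> /xy[N _ /(_ N (leqnn N))]; apply; have [] := hx N.
  have dy j : d (q (a j)) y <= j.+1%:R^-1.
    apply/ler_addgt0Pr => e e0; have [N hN] := cvg_dist xy e0.
    apply: le_trans (dist_tri dd _ (x (maxn N j.+1)) _) _.
    rewrite lerD //.
      have := (hx (maxn N j.+1)).2 j; rewrite size_mkseq nth_mkseq ?leq_maxr //.
      by apply.
    by rewrite (distC dd); apply/ltW/hN/leq_maxl.
  exists y; split=> // O oO Oy.
  have /(dist_nbhs dd)[e e0 eO] : nbhs y O by apply: open_nbhs_nbhs.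
  have e2 : 0 < e / 2 by rewrite divr_gt0.
  have [j je] := inv_small e2; exists j.+1 => z [Cz hz]; apply: eO => /=.
  apply: le_lt_trans (dist_tri dd _ (q (a j)) _) _; rewrite (splitr e).
  have := hz j; rewrite size_mkseq nth_mkseq // => /(_ (ltnSn _)) hzj.
  by apply: ltrD; apply: le_lt_trans je => //; rewrite (distC dd).
Qed.

Lemma closed_ball_dist x (e : R) : closed [set y | d x y <= e].
Proof.
rewrite -[X in closed X]setCK; apply: open_closedC.
rewrite openE => y /= /negP; rewrite -ltNge => ey; apply/(dist_nbhs dd).
exists (d x y - e); first by rewrite subr_gt0.
move=> z /= yz; apply/negP; rewrite -ltNge.
have := dist_tri dd x z y; rewrite (distC dd z y) => h.
by rewrite -(ltrD2r (d y z)); apply: lt_le_trans h; rewrite -ltrBrDl.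
Qed.

Lemma suslin_polish : suslin X.
Proof.
have Ub := rational_ball_base dd qdense.
split; first exact: polish_hausdorff dd.
  by exists (rational_ball d q).
move=> O oO; split; last by apply: analytic_closed; apply: open_closedC.
pose K k := if unpickle k is Some (n, m) then
  (if pselect ([set y | d (q n) y <= m.+1%:R^-1] `<=` O)
   then [set y | d (q n) y <= m.+1%:R^-1] else set0) else set0.
rewrite (_ : O = \bigcup_k K k).
  apply: analytic_bigcup => k; apply: analytic_closed; rewrite /K.
  case: (unpickle k) => [[n m]|]; last exact: closed0.
  by case: pselect => ?; [apply: closed_ball_dist|apply: closed0].
apply/seteqP; split=> [x Ox|x [k _]]; last first.
  by rewrite /K; case: (unpickle k) => [[n m]|//]; case: pselect => // h /h.
have /(dist_nbhs dd)[e e0 eO] : nbhs x O by apply: open_nbhs_nbhs.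
have e2 : 0 < e / 2 by rewrite divr_gt0.
have [m me] := inv_small e2; have [n nx] := qdense x (inv_gt0 m).
exists (pickle (n, m)) => //; rewrite /K pickleK; case: pselect => [?|]; first exact: ltW.
case=> y /= ny; apply: eO; apply: le_lt_trans (dist_tri dd _ (q n) _) _.
rewrite (splitr e) ltrD //; last exact: le_lt_trans me.
by rewrite (distC dd); apply: lt_trans me.
Qed.

Lemma borel_fun_pair (f g : X -> X) : borel_fun f -> borel_fun g ->
  borel_fun (fun x => (f x, g x)).
Proof.
move=> bf bg; have Ub := rational_ball_base dd qdense.
set U := rational_ball d q in Ub.
apply: borel_fun_open => O oO.
apply: (@borel_eqP _ (fun x => exists k l, (rectangle (U k) (U l) `<=` O) /\
   (U k (f x) /\ U l (g x)))).
  move=> x; split=> [[k [l [sub [h1 h2]]]]|Ox]; first exact: (sub (f x, g x)).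
  have [A [B [oA oB Af Bg sub]]] := prod_open_rect oO Ox.
  have [k Uk UA] := Ub.2 _ _ (open_nbhs_nbhs (conj oA Af)).
  have [l Ul UB] := Ub.2 _ _ (open_nbhs_nbhs (conj oB Bg)).
  exists k, l; split=> // -[u v] [/= /UA ? /UB ?]; exact: sub.
apply: borel_ex_nat => k; apply: borel_ex_nat => l.
apply: borel_and; first exact: borel_cst.
apply: borel_and; [apply: bf|apply: bg]; apply: borel_open; exact: Ub.1.
Qed.

(* A uniformly separated partial function extends to a Borel function: the
   sets [S i m] locate the value within [1/m] of the dense point [q i]. *)
Lemma borel_selector (E : X -> X -> Prop) (S : nat -> nat -> set X) :
  borel [set p : X * X | E p.1 p.2] -> (forall i m, borel (S i m)) ->
  exists f : X -> X, [/\ borel_fun f, forall x, f x = x \/ E x (f x) &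
    forall x y, E x y -> (forall i m, S i m x <-> d (q i) y < m.+1%:R^-1) -> f x = y].
Proof.
move=> bE bS.
pose idx m x i := S i m x /\ forall j, (j < i)%N -> ~ S j m x.
have idx_uniq m x i j : idx m x i -> idx m x j -> i = j.
  by move=> [Si mi] [Sj mj]; case: (ltngtP i j) => // [/mj|/mi].
pose lim x z := forall m, exists i, idx m x i /\ d (q i) z <= m.+1%:R^-1.
have lim_uniq x z z' : lim x z -> lim x z' -> z = z'.
  move=> lz lz'; apply/(dist0 dd)/eqP; rewrite eq_le (dist_ge0 dd) andbT.
  apply/ler_addgt0Pr => e e0; rewrite add0r; have e2 : 0 < e / 2 by rewrite divr_gt0.
  have [m me] := inv_small e2; have [i [ii di]] := lz m; have [j [ij dj]] := lz' m.
  rewrite -(idx_uniq _ _ _ _ ii ij) in dj.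
  apply: le_trans (dist_tri dd _ (q i) _) _; rewrite (splitr e) (distC dd z).
  by apply: ltW; apply: ltrD; apply: le_lt_trans me.
have bidx m i : borel [set x | idx m x i].
  apply: borel_and; first exact: bS.
  by apply: borel_all => j; apply: borel_imp; [apply: borel_cst|apply: borel_not; apply: bS].
(* By completeness a limit exists exactly when the located balls have pairwise compatible centres, a
   condition on countably many indices. *)
have blim : borel [set x | exists z, lim x z].
  apply: (@borel_eqP _ (fun x => (forall m, exists i, idx m x i) /\
     forall m n i j, idx m x i -> idx n x j -> d (q i) (q j) <= m.+1%:R^-1 + n.+1%:R^-1)).
    move=> x; split=> [[h1 h2]|[z lz]]; last first.
      split=> [m|m n i j im jn]; first by have [i []] := lz m; exists i.
      have [i' [im' di]] := lz m; have [j' [jn' dj]] := lz n.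
      rewrite (idx_uniq _ _ _ _ im im') (idx_uniq _ _ _ _ jn jn').
      by apply: le_trans (dist_tri dd _ z _) _; rewrite lerD // (distC dd).
    have [s hs] := choice h1.
    have [e e0|z xz] := dist_complete dd (u := q \o s).
      have e2 : 0 < e / 2 by rewrite divr_gt0.
      have [j je] := inv_small e2; exists j => m n jm jn /=.
      apply: le_lt_trans (h2 _ _ _ _ (hs m) (hs n)) _; rewrite (splitr e).
      by apply: ltrD; apply: le_lt_trans je; apply: inv_le.
    exists z => m; exists (s m); split=> //.
    apply/ler_addgt0Pr => e e0; have e2 : 0 < e / 2 by rewrite divr_gt0.
    have [N hN] := cvg_dist xz e2; have [j je] := inv_small e2.
    apply: le_trans (dist_tri dd _ (q (s (maxn N j))) _) _.
    have h3 : d (q (s (maxn N j))) z <= e / 2.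
      by rewrite (distC dd); apply: ltW; apply: hN; apply: leq_maxl.
    apply: le_trans (lerD (h2 _ _ _ _ (hs m) (hs _)) h3) _.
    rewrite -addrA lerD2l [leRHS](splitr e) lerD2r; apply: le_trans (ltW je).
    by apply: inv_le; apply: leq_maxr.
  apply: borel_and; first by apply: borel_all => m; apply: borel_ex_nat => i; apply: bidx.
  do 4 (apply: borel_all => ?); apply: borel_imp; first exact: bidx.
  by apply: borel_imp; [exact: bidx|exact: borel_cst].
pose g x := if pselect (exists z, lim x z) is left e then projT1 (cid e) else x.
have glim x z : lim x z -> g x = z.
  move=> lz; rewrite /g; case: pselect => [e|]; last by case; exists z.
  by case: cid => z' lz' /=; apply: lim_uniq lz' lz.
have gout x : ~ (exists z, lim x z) -> g x = x by rewrite /g; case: pselect.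
have bg : borel_fun g.
  apply: borel_fun_open => O oO.
  apply: (@borel_eqP _ (fun x => ((exists z, lim x z) /\ exists m i, idx m x i /\
      [set y | d (q i) y <= m.+1%:R^-1] `<=` O) \/ (~ (exists z, lim x z) /\ O x))).
    move=> x /=; case: (pselect (exists z, lim x z)) => [[z lz]|nl]; last first.
      by rewrite gout //; split=> [[[]|[]]//|]; right.
    rewrite (glim _ _ lz); split=> [[[_ [m [i [im sub]]]]|[[]]]|Oz]; last 2 first.
    - by exists z.
    - left; split; first by exists z.
      have /(dist_nbhs dd)[e e0 eO] : nbhs z O by apply: open_nbhs_nbhs.
      have e2 : 0 < e / 2 by rewrite divr_gt0.
      have [m me] := inv_small e2; have [i [im di]] := lz m; exists m, i; split=> // y /= yi.
      apply: eO => /=; apply: le_lt_trans (dist_tri dd _ (q i) _) _; rewrite (splitr e).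
      by apply: ltrD; apply: le_lt_trans me => //; rewrite (distC dd).
    - by apply: sub; have [i' [im' di]] := lz m; rewrite /= (idx_uniq _ _ _ _ im im').
  apply: borel_or; apply: borel_and => //.
  - apply: borel_ex_nat => m; apply: borel_ex_nat => i.
    by apply: borel_and; [apply: bidx|apply: borel_cst].
  - exact: borel_not.
  - exact: borel_open.
pose f x := if pselect (E x (g x)) then g x else x.
have bid : borel_fun (@id X) by [].
have bEg : borel [set x | E x (g x)] by exact: (borel_fun_pair bid bg bE).
exists f; split.
- move=> B bB.
  apply: (@borel_eqP _ (fun x => (E x (g x) /\ B (g x)) \/ (~ E x (g x) /\ B x))).
    move=> x; rewrite /f /=; case: pselect => h; split=> [[[]|[]]//|Bx]; [by left|by right].
  by apply: borel_or; apply: borel_and => //; [exact: bg|exact: borel_not].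
- by move=> x; rewrite /f; case: pselect => h; [right|left].
- move=> x y Exy hS; have ly : lim x y.
    move=> m; have [i0 qi0] := qdense y (inv_gt0 m).
    have [|i [Si mi]] := @least_ex (fun i => S i m x) i0; first exact/hS.
    by exists i; split=> //; apply/ltW/hS.
  by rewrite /f (glim _ _ ly); case: pselect.
Qed.

(** The set [Amb k] of the pairs whose second coordinate is not isolated in its section by [U k] is
    analytic, and finiteness of sections makes the intersection of these sets empty. Novikov's
    theorem encloses them in Borel sets [B k] with empty intersection; the differences [E \ B k] are
    Borel, cover [E] and are graphs of partial functions. *)
Theorem lusin_novikov (E : X -> X -> Prop) :
  borel [set p : X * X | E p.1 p.2] -> (forall x, finite_set [set y | E x y]) ->
  exists nb : nat -> X -> X, [/\ forall i, borel_fun (nb i),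
    forall x y, E x y -> exists i, nb i x = y &
    forall i x, nb i x = x \/ E x (nb i x)].
Proof.
move=> bE finE; have Ub := rational_ball_base dd qdense.
set U := rational_ball d q in Ub.
have Usep : separating U := base_separating Ub (polish_hausdorff dd).
have sX := suslin_polish; have sX2 := suslin_prod sX sX; have sX3 := suslin_prod sX2 sX.
have b1 : borel_fun (fst : X * X -> X).
  by apply: borel_fun_open => B oB; apply: borel_open; apply: open_comp oB => x _; apply: cvg_fst.
have b2 : borel_fun (snd : X * X -> X).
  by apply: borel_fun_open => B oB; apply: borel_open; apply: open_comp oB => x _; apply: cvg_snd.
have b31 : borel_fun (fst : (X * X) * X -> X * X).
  by apply: borel_fun_open => B oB; apply: borel_open; apply: open_comp oB => x _; apply: cvg_fst.
have b32 : borel_fun (snd : (X * X) * X -> X).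
  by apply: borel_fun_open => B oB; apply: borel_open; apply: open_comp oB => x _; apply: cvg_snd.
have b313 : borel_fun (fun p : (X * X) * X => (p.1.1, p.2)).
  apply: borel_fun_open => B oB; apply: borel_open; rewrite openE => -[[x y] z] Bp.
  have [A [C [oA oC Ax Cz sub]]] := prod_open_rect oB Bp.
  exists (rectangle A setT, C) => /=; last by move=> [[u v] w] [[/= Au _] Cw]; exact: sub.
  split; last exact: open_nbhs_nbhs.
  by apply: open_nbhs_nbhs; split=> //; apply: open_rectangle => //; exact: openT.
pose Amb k : set (X * X) := [set p | E p.1 p.2 /\
   (~ U k p.2 \/ exists z, U k z /\ (z <> p.2 /\ E p.1 z))].
have aAmb k : analytic (Amb k).
  have -> : Amb k = [set p | E p.1 p.2 /\ ~ U k p.2] `|`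
     [set p | exists z, [set s : (X * X) * X | E s.1.1 s.1.2 /\ (U k s.2 /\
        (s.2 <> s.1.2 /\ E s.1.1 s.2))] (p, z)].
    apply/seteqP; split=> -[x y] /=.
      by move=> [Exy [nU|[z [Uz [zy Exz]]]]]; [left|right; exists z].
    move=> [[Exy nU]|[z [Exy [Uz [zy Exz]]]]]; split=> //; first by left.
    by right; exists z.
  apply: analyticU.
    apply: borel_analytic => //; apply: borel_and => //; apply: borel_not.
    by apply: b2; exact: Usep.1.
  apply: analytic_fst; apply: borel_analytic => //.
  apply: borel_and; first exact: (b31 _ bE).
  apply: borel_and; first by apply: b32; exact: Usep.1.
  apply: borel_and; last exact: (b313 _ bE).
  apply: borel_not; apply: (borel_eq_fun Usep) => //; exact: borel_fun_comp b31 b2.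
have [|B [hB B0]] := novikov (suslin_t2 sX2) aAmb.
  apply/seteqP; split=> // -[x y] h.
  have [Exy _] := h 0%N I.
  have [k Uy iso] := base_isolate Ub y Usep (finE x).
  have [_ [//|[z [Uz [zy Exz]]]]] := h k I.
  by case: zy; apply: iso.
pose W k : set (X * X) := [set p | E p.1 p.2 /\ ~ B k p].
have bW k : borel (W k).
  by apply: borel_and => //; apply: borel_not; have [] := hB k.
have Wfun k x y y' : W k (x, y) -> W k (x, y') -> y = y'.
  move=> [Exy nB] [Exy' nB']; apply: contrapT => yy'.
  have : ~ Amb k (x, y) by move=> h; apply: nB; apply: (hB k).2.
  have : ~ Amb k (x, y') by move=> h; apply: nB'; apply: (hB k).2.
  move=> h1 h2; apply: h2; split=> //; right; exists y'; split=> /=.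
    by apply: contrapT => nU; apply: h1; split=> //; left.
  by split=> // e; apply: yy'; rewrite e.
pose ball i m := [set y | d (q i) y < m.+1%:R^-1].
have bball i m : borel (ball i m) by apply: borel_open; apply: open_ball_dist.
(* The partial function [W k] has its value in a given ball on one analytic set, and outside the
   ball on another one, disjoint from it. Novikov's theorem, the family being padded with [setT],
   yields a Borel set between the first and the complement of the second. *)
have /choice[S hS] (kim : nat * (nat * nat)) : exists S : set X, borel S /\
    (forall x y, W kim.1 (x, y) -> (S x <-> ball kim.2.1 kim.2.2 y)).
  case: kim => k [i m] /=.
  pose P0 := [set x | exists y, [set p | W k p /\ ball i m p.2] (x, y)].
  pose P1 := [set x | exists y, [set p | W k p /\ ~ ball i m p.2] (x, y)].
  have a0 : analytic P0.
    apply: analytic_fst; apply: borel_analytic => //.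
    exact: (@borel_and _ (W k) (fun p => ball i m p.2) (bW k) (b2 _ (bball i m))).
  have a1 : analytic P1.
    apply: analytic_fst; apply: borel_analytic => //.
    exact: (@borel_and _ (W k) (fun p => ~ ball i m p.2) (bW k)
      (borel_not (b2 _ (bball i m)))).
  have aT : analytic (@setT X) by have [] := suslin_open sX openT.
  have [||C [hC C0]] := @novikov X (suslin_t2 sX)
      (fun n => if n is 0%N then P0 else if n is 1%N then P1 else setT).
  - by move=> [|[|n]].
  - apply/seteqP; split=> // x h; have [y [Wy by_]] := h 0%N I.
    have [y' [Wy' nb']] := h 1%N I; apply: nb'.
    by rewrite /= (Wfun _ _ _ _ Wy' Wy).
  exists (C 0%N); split; first exact: (hC 0%N).1.
  move=> x y Wxy; split=> [C0x|byk]; last by apply: (hC 0%N).2; exists y.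
  apply: contrapT => nb; suff : (\bigcap_n C n) x by rewrite C0.
  move=> [|[|n]] _ //; first by apply: (hC 1%N).2; exists y.
  by apply: (hC n.+2).2.
have /choice[nb hnb] k := borel_selector (S := fun i m => S (k, (i, m))) bE
  (fun i m => (hS (k, (i, m))).1).
exists nb; split=> [i|x y Exy|i x]; [by have [] := hnb i| |by have [] := hnb i].
have [k nB] : exists k, ~ B k (x, y).
  apply: contrapT => nex; suff : (\bigcap_n B n) (x, y) by rewrite B0.
  by move=> k _; apply: contrapT => nB; apply: nex; exists k.
exists k; have [_ _ h] := hnb k; apply: h => // i m.
by apply: (hS (k, (i, m))).2.
Qed.

End PolishSuslin.

Local Close Scope ring_scope.

(** * Baire category *)

Section Category.
Variables (R : realType) (X : ptopologicalType) (d : X -> X -> R).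
Hypothesis dd : complete_dist d.
Variable q : nat -> X.
Hypothesis qdense : forall x (e : R), (0 < e)%R -> exists n, (d (q n) x < e)%R.
Local Open Scope ring_scope.

Lemma meagre_sub (A B : set X) : A `<=` B -> meagre B -> meagre A.
Proof. by move=> AB [F nF BF]; exists F => // x /AB /BF. Qed.

Lemma meagre_nd (A : set X) : nowhere_dense A -> meagre A.
Proof. by move=> nA; exists (fun=> A) => // x Ax; exists 0%N. Qed.

Lemma meagre0 : meagre (@set0 X).
Proof. by apply: meagre_nd; rewrite /nowhere_dense closure0 interior0. Qed.

Lemma meagre_bigcup (A : nat -> set X) : (forall n, meagre (A n)) -> meagre (\bigcup_n A n).
Proof.
move=> mA.
have /choice[F hF] n : exists F : nat -> set X, (forall i, nowhere_dense (F i)) /\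
    A n `<=` \bigcup_i F i by have [F ? ?] := mA n; exists F.
pose H k := if unpickle k is Some (i, j) then F i j else set0.
exists H => [k|x [n _ /(hF n).2[i _ Fx]]].
  rewrite /H; case: (unpickle k) => [[i j]|]; first exact: (hF i).1.
  by rewrite /nowhere_dense closure0 interior0.
by exists (pickle (n, i)) => //; rewrite /H pickleK.
Qed.

Lemma meagreU (A B : set X) : meagre A -> meagre B -> meagre (A `|` B).
Proof.
move=> mA mB; apply: (@meagre_sub _ (\bigcup_n (if n is 0%N then A else B))).
  by move=> x [Ax|Bx]; [exists 0%N|exists 1%N].
by apply: meagre_bigcup => -[|n].
Qed.

Lemma baire_open (O : set X) : open O -> O !=set0 -> ~ meagre O.
Proof.
move=> oO [x0 Ox0] [F nF OF].
have step (n : nat) (xe : X * R) : exists ye : X * R, 0 < xe.2 ->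
    [/\ 0 < ye.2, ye.2 <= n.+1%:R^-1, [set z | d ye.1 z <= ye.2] `<=` [set z | d xe.1 z < xe.2] &
      [set z | d ye.1 z <= ye.2] `&` F n = set0].
  case: xe => x e /=; case: (pselect (0 < e)) => e0; last by exists (x, e).
  have [y [xy nFy]] : exists y, d x y < e /\ ~ closure (F n) y.
    apply: contrapT => nex; have : (closure (F n))° x.
      apply/(dist_nbhs dd); exists e => // y xy.
      by apply: contrapT => nFy; apply: nex; exists y.
    by rewrite (nF n).
  have : nbhs y ([set z | d x z < e] `&` ~` closure (F n)).
    apply: open_nbhs_nbhs; split=> //; apply: openI; first exact: open_ball_dist.
    by apply: closed_openC; apply: closed_closure.
  move=> /(dist_nbhs dd)[r r0 rsub].
  exists (y, Num.min (r / 2) n.+1%:R^-1) => _ /=.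
  have m0 : 0 < Num.min (r / 2) n.+1%:R^-1 by rewrite lt_min divr_gt0 //= inv_gt0.
  have mr z : d y z <= Num.min (r / 2) n.+1%:R^-1 -> d y z < r.
    rewrite le_min => /andP[h _]; apply: le_lt_trans h _.
    by rewrite ltr_pdivrMr // ltr_pMr // ltr1n.
  split=> //.
  - by rewrite ge_min lexx orbT.
  - by move=> z /mr /rsub[].
  - apply/seteqP; split=> // z [/mr /rsub[_ nFz] Fz]; exact/nFz/subset_closure.
have /choice[f hf] : forall nxe : nat * (X * R), exists ye : X * R, 0 < nxe.2.2 ->
    [/\ 0 < ye.2, ye.2 <= nxe.1.+1%:R^-1,
      [set z | d ye.1 z <= ye.2] `<=` [set z | d nxe.2.1 z < nxe.2.2] &
      [set z | d ye.1 z <= ye.2] `&` F nxe.1 = set0] by move=> [n xe]; exact: step.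
have /(dist_nbhs dd)[e e0 eO] : nbhs x0 O by apply: open_nbhs_nbhs.
pose fix s n : X * R := if n is n'.+1 then f (n', s n') else (x0, e).
have s0 n : 0 < (s n).2 by elim: n => //= n IH; have [] := hf (n, s n) IH.
have sS n := hf (n, s n) (s0 n).
have smono m n z : (m <= n)%N -> d (s n).1 z <= (s n).2 -> d (s m).1 z <= (s m).2.
  move=> /subnK <-; elim: (n - m)%N z => // k IH z; rewrite addSn => h; apply: IH.
  by apply: ltW; have [_ _ sub _] := sS (k + m)%N; apply: sub.
have sself n : d (s n).1 (s n).1 <= (s n).2 by rewrite distxx // ltW.
have [r r0|y sy] := dist_complete dd (u := fun n => (s n).1).
  have r2 : 0 < r / 2 by rewrite divr_gt0.
  have [j jr] := inv_small r2; exists j.+1 => m n jm jn.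
  have [_ sj _ _] := sS j.
  apply: le_lt_trans (dist_tri dd _ (s j.+1).1 _) _; rewrite (splitr r).
  rewrite (distC dd _ (s j.+1).1); apply: ltrD.
    by apply: le_lt_trans jr; apply: le_trans (smono _ _ _ jm (sself m)) sj.
  by apply: le_lt_trans jr; apply: le_trans (smono _ _ _ jn (sself n)) sj.
have ysn n : d (s n).1 y <= (s n).2.
  apply/ler_addgt0Pr => r r0; have [N hN] := cvg_dist dd sy r0.
  apply: le_trans (dist_tri dd _ (s (maxn N n)).1 _) _; rewrite lerD //.
    by apply: smono (sself _); apply: leq_maxr.
  by rewrite (distC dd); apply/ltW/hN/leq_maxl.
have Oy : O y by apply: eO; have [_ _ sub _] := sS 0%N; exact: (sub y (ysn 1%N)).
have [n _ Fy] := OF y Oy; have [_ _ _ dis] := sS n.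
by have : set0 y by rewrite -dis; split=> //; exact: (ysn n.+1).
Qed.

Definition baire_property (A : set X) := exists2 O : set X, open O &
  meagre (A `\` O) /\ meagre (O `\` A).

Lemma borel_baire (A : set X) : borel A -> baire_property A.
Proof.
move=> bA; suff h : <<s @open X >> `<=` baire_property by apply: h.
have m0 := meagre0.
apply: smallest_sub => [|O oO]; last by exists O; rewrite ?setDv.
split.
- by exists set0; [exact: open0|rewrite setDv].
- move=> B [W oW [h1 h2]]; rewrite setTD; exists (~` closure W).
    by apply: closed_openC; apply: closed_closure.
  split; last first.
    apply: meagre_sub h1 => x [nO nB]; split; first exact: contrapT.
    by move=> Ox; apply: nO; apply: subset_closure.
  apply: (@meagre_sub _ ((closure W `\` W) `|` (W `\` B))).
    move=> x [nB /contrapT cO]; case: (pselect (W x)) => Ox; first by right.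
    by left.
  apply: meagreU => //; apply: meagre_nd.
  rewrite /nowhere_dense; apply/seteqP; split=> // x.
  have cl : closed (closure W `\` W).
    by apply: closedI; [exact: closed_closure|exact: open_closedC].
  rewrite -((closure_id _).1 cl) => nx.
  have [y [Oy [_ nOy]]] : W `&` (closure W `\` W) !=set0.
    by have [cOx _] := nbhs_singleton nx; exact: cOx.
  by [].
- move=> B hB.
  have /choice[V hV] n : exists V : set X, open V /\ meagre (B n `\` V) /\ meagre (V `\` B n).
    by have [V ? ?] := hB n; exists V.
  exists (\bigcup_n V n); first by apply: bigcup_open => n _; apply: (hV n).1.
  split.
    apply: (@meagre_sub _ (\bigcup_n (B n `\` V n))).
      by move=> x [[n _ Bx] nV]; exists n => //; split=> // Vx; apply: nV; exists n.
    by apply: meagre_bigcup => n; apply: (hV n).2.1.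
  apply: (@meagre_sub _ (\bigcup_n (V n `\` B n))).
    by move=> x [[n _ Vx] nB]; exists n => //; split=> // Bx; apply: nB; exists n.
  by apply: meagre_bigcup => n; apply: (hV n).2.2.
Qed.

(** Some [O] intersected with [A i] is not meagre, by Baire's theorem; the open set that
    approximates [A i] then meets [O]. *)
Lemma cover_locally_comeagre (O : set X) (A : nat -> set X) : open O -> O !=set0 ->
  (forall i, borel (A i)) -> (forall x, exists i, A i x) ->
  exists i (V : set X), [/\ open V, V !=set0, V `<=` O & meagre (V `\` A i)].
Proof.
move=> oO neO bA cA; apply: contrapT => nex; apply: (baire_open oO neO).
apply: (@meagre_sub _ (\bigcup_i (O `&` A i))).
  by move=> x Ox; have [i Ax] := cA x; exists i.
apply: meagre_bigcup => i; have [W oW [h1 h2]] := borel_baire (bA i).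
case: (pselect (O `&` W !=set0)) => [neV|nV].
  case: nex; exists i, (O `&` W); split=> //; first exact: openI.
  by apply: (meagre_sub _ h2) => x [[_ ?] ?].
apply: meagre_sub h1 => x [Ox Ax]; split=> // Wx; apply: nV; by exists x.
Qed.

(* Kuratowski-Ulam in disguise: the [n]-th choice covers a comeagre part of a nonempty
   open subset of the [n]-th basic open set. *)
Lemma generic_branch (S : Type) (s0 : S) (next : S -> nat -> S) (cov : S -> nat -> set X) :
  (forall s i, borel (cov s i)) -> (forall s x, exists i, cov s i x) ->
  exists (a : nat -> nat) (s : nat -> S), [/\ s 0%N = s0,
    forall n, s n.+1 = next (s n) (a n) &
    comeagre [set x | forall m, exists2 n, (m <= n)%N & cov (s n) (a n) x]].
Proof.
move=> bcov ccov; have Ub := rational_ball_base dd qdense.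
set U := rational_ball d q in Ub.
(* The second component of the coded pair is ignored, so that every basic open set is treated at
   infinitely many times. *)
pose idx n := if @unpickle (nat * nat)%type n is Some (k, _) then k else 0%N.
have /choice[f hf] (nt : nat * S) : exists i, U (idx nt.1) !=set0 ->
    exists V : set X, [/\ open V, V !=set0, V `<=` U (idx nt.1) & meagre (V `\` cov nt.2 i)].
  case: nt => n t /=; case: (pselect (U (idx n) !=set0)) => ne; last by exists 0%N.
  have [i [V hV]] := cover_locally_comeagre (Ub.1 (idx n)) ne (bcov t) (ccov t).
  by exists i => _; exists V.
pose fix s n : S := if n is n'.+1 then next (s n') (f (n', s n')) else s0.
exists (fun n => f (n, s n)), s; split=> //.
have /choice[V hV] n : exists V : set X, U (idx n) !=set0 ->
    [/\ open V, V !=set0, V `<=` U (idx n) & meagre (V `\` cov (s n) (f (n, s n)))].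
  case: (pselect (U (idx n) !=set0)) => ne; last by exists set0.
  by have [V] := hf (n, s n) ne; exists V.
apply: (@meagre_sub _ (\bigcup_m [set x | forall n, (m <= n)%N -> ~ cov (s n) (f (n, s n)) x])).
  move=> x /existsNP[m nm]; exists m => // n mn cx; apply: nm; by exists n.
apply: meagre_bigcup => m.
pose good n := (m <= n)%N /\ U (idx n) !=set0.
pose D := \bigcup_(n in good) V n.
apply: (@meagre_sub _ (~` D `|` \bigcup_n [set x | good n /\ (V n `\` cov (s n) (f (n, s n))) x])).
  move=> x hx; case: (pselect (D x)) => [[n gn Vx]|]; [right|by left].
  by exists n => //; split=> //; split=> //; apply: hx; case: gn.
apply: meagreU.
  apply: meagre_nd; rewrite /nowhere_dense -(closure_id _).1; last first.
    by apply: open_closedC; apply: bigcup_open => n [_ ne]; have [] := hV n ne.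
  apply/seteqP; split=> // x nx.
  have [k Ux Usub] := Ub.2 _ _ nx.
  have [n' [mn' idn']] : exists n', (m <= n')%N /\ idx n' = k.
    have inj : injective (fun j : nat => @pickle (nat * nat)%type (k, j)).
      by move=> i j h; have [] := pcan_inj (@pickleK (nat * nat)%type) h.
    apply: contrapT => nex.
    have sm (j : nat) : (@pickle (nat * nat)%type (k, j) < m)%N.
      rewrite ltnNge; apply/negP => mj; apply: nex; exists (@pickle (nat * nat)%type (k, j)); split=> //.
      by rewrite /idx pickleK.
    have : (size [seq @pickle (nat * nat)%type (k, j) | j <- iota 0 m.+1] <= size (iota 0 m))%N.
      apply: uniq_leq_size; first by rewrite map_inj_uniq ?iota_uniq.
      by move=> z /mapP[j _ ->]; rewrite mem_iota leq0n add0n; apply: sm.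
    by rewrite size_map !size_iota ltnn.
  have ne : U (idx n') !=set0 by rewrite idn'; exists x.
  have [_ [y Vy] VU _] := hV n' ne.
  have := Usub y; rewrite -idn' => /(_ (VU _ Vy)); apply.
  by exists n'.
apply: meagre_bigcup => n; case: (pselect (good n)) => [[_ ne]|ngn].
  have [_ _ _ mV] := hV n ne; by apply: (meagre_sub _ mV) => x [].
by apply: (@meagre_sub _ set0); [move=> x []|exact: meagre0].
Qed.

End Category.

(** * Shapes of pieces and the layers they define *)

Section Templates.
Variables (X : topologicalType) (adj : X -> X -> Prop) (U : nat -> set X)
  (nb : nat -> X -> X).
Hypothesis en : enumerated adj U nb.
Hypothesis Ubase : countable_base U.

Local Notation conn := (conn adj).
Local Notation nearby := (nearby adj).
Local Notation walk := (walk nb).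
Local Notation piece := (piece nb).
Implicit Types (p r : seq (seq nat)).

Definition piece_radius p := \max_(v <- p) size v.

Lemma piece_nearby p y z : piece p y z -> nearby (piece_radius p) y z.
Proof.
move=> [v vp ->]; apply: nearby_leq (nearby_walk (en_or en) v y).
exact: leq_bigmax_seq.
Qed.

Lemma finite_piece (A : set X) y : finite_set A -> A `<=` [set z | conn setT y z] ->
  exists p, piece p y = A.
Proof.
move=> /finite_seqP[s ->]; elim: s => [_|a s IH sub].
  by exists [::]; apply/seteqP; split=> z // [].
have [|p hp] := IH; first by move=> z zs; apply: sub; rewrite /= inE zs orbT.
have [|v av] := walk_conn (en_ex en) (x := y) (y := a); first by apply: sub; rewrite /= mem_head.
exists (v :: p); apply/seteqP; split=> z /=.
  move=> [w]; rewrite !inE => /orP[/eqP -> ->|wp ->]; first by rewrite av eqxx.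
  suff : piece p y (walk w y) by rewrite hp /= => ->; rewrite orbT.
  by exists w.
rewrite inE => /orP[/eqP ->|]; first by exists v => //; rewrite mem_head.
move=> zs; have [w wp ->] : piece p y z by rewrite hp.
by exists w => //; rewrite inE wp orbT.
Qed.

Definition template p r y := [/\ piece r y `<=` piece p y,
  forall u v, piece r y u -> piece r y v -> conn (piece r y) u v &
  forall z w, piece p y z -> ~ piece r y z -> adj z w -> piece p y w].

(** Walks of length [n] in a ring whose vertices are named by words of [r]. This turns connectedness
    of a ring into a countable combination of Borel conditions. *)
Fixpoint linked r n u v x : Prop :=
  if n is n'.+1 then exists w, w \in r /\ adj (walk u x) (walk w x) /\ linked r n' w v x
  else walk u x = walk v x.

Lemma linkedP r u v x : u \in r -> v \in r ->
  (exists n, linked r n u v x) <-> conn (piece r x) (walk u x) (walk v x).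
Proof.
move=> ur vr; split=> [[n]|].
  elim: n u ur => [u ur|n IH u ur] /=; first by move=> ->; apply: conn_refl; exists v.
  move=> [w [wr [uw /(IH _ wr)]]]; apply: conn_step uw; by exists u.
move eqa : (walk u x) => a; move eqb : (walk v x) => b ab.
elim: ab u ur eqa eqb => [c _ u _ eu ev|c e f _ ce ef IH u ur eu ev].
  by exists 0; rewrite /= eu ev.
have [w wr ew] := conn_l ef.
have [n hn] := IH w wr (esym ew) ev.
by exists n.+1, w; rewrite eu -ew.
Qed.

Lemma borel_linked r n u v : borel [set x | linked r n u v x].
Proof.
elim: n u => [|n IH] u /=.
  exact: (walk_borel_eq (en_sep en) (en_borel en)).
apply: borel_ex => w; apply: borel_and; first exact: borel_cst.
apply: borel_and => //.
exact: (walk_borel_adj (en_sep en) (en_irr en) (en_borel en) (en_ex en) (en_or en)).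
Qed.

Lemma borel_template p r : borel [set y | template p r y].
Proof.
have bp q v : borel [set y | piece q y (walk v y)].
  exact: (walk_borel_piece (en_sep en) (en_borel en) q [::] v).
apply: (@borel_eqP _ (fun y => (forall v, v \in r -> piece p y (walk v y)) /\
  ((forall u v, u \in r -> v \in r -> exists n, linked r n u v y) /\
  forall u i, u \in p -> ~ piece r y (walk u y) -> piece p y (walk (i :: u) y)))).
  move=> y; split=> [[h1 [h2 h3]]|[h1 h2 h3]]; split.
  - by move=> z [v vr ->]; apply: h1.
  - by move=> _ _ [u ur ->] [v vr ->]; apply/linkedP => //; apply: h2.
  - by move=> _ w [u up ->] nr /(en_ex en)[i <-]; apply: (h3 u i).
  - by move=> v vr; apply: h1; exists v.
  - split=> [u v ur vr|u i up nr]; first by apply/linkedP => //; apply: h2; [exists u|exists v].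
    have pu : piece p y (walk u y) by exists u.
    by case: (en_or en i (walk u y)) => [/= ->//|h]; apply: h3 nr h.
apply: borel_and.
  by apply: borel_all => v; apply: borel_imp; [exact: borel_cst|exact: bp].
apply: borel_and; apply: borel_all => u; apply: borel_all => v.
  apply: borel_imp; first exact: borel_cst.
  apply: borel_imp; first exact: borel_cst.
  by apply: borel_ex => n; apply: borel_linked.
apply: borel_imp; first exact: borel_cst.
by apply: borel_imp; [apply: borel_not; exact: bp|exact: bp].
Qed.

Lemma template_layer p r (B : set X) : borel B -> discrete_set adj (2 * piece_radius p) B ->
  B `<=` template p r ->
  exists L : layer adj nb, [/\ layer_set L = B, layer_in L = p, layer_ring L = r &
    layer_diam L = 2 * piece_radius p].
Proof.
move=> bB dB BT.
have diam y z w : piece p y z -> piece p y w -> nearby (2 * piece_radius p) z w.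
  move=> /piece_nearby yz /piece_nearby yw; rewrite mul2n -addnn.
  exact: nearby_trans (nearby_sym (en_sym en) yz) yw.
have ok : layer_valid adj (2 * piece_radius p) B (piece p) (piece r).
  split=> [y /BT[]//|y u v /BT[_ h _]|y z w /BT[_ _ h]|y y' z By By' yz y'z|y z w _].
  - exact: h.
  - exact: h.
  - apply: dB => //; rewrite mul2n -addnn.
    apply: nearby_trans (piece_nearby yz) _.
    move: (piece_nearby y'z). refine (@nearby_sym _ _ (en_sym en) _ _ _).
  - exact: diam.
by exists (Layer bB ok).
Qed.

Lemma cleared_layer (L : layer adj nb) s x y : layer_set L y ->
  (forall z, nearby s x z -> piece (layer_in L) y z /\ ~ piece (layer_ring L) y z) ->
  cleared s [:: L] x.
Proof.
move=> Ly h z /h[pz nrz] /= [[_ nex]|[y' [Ly' rz' _]]].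
  by apply: nex; exists y.
have [RP _ _ dis _] := layer_ok L.
by apply: nrz; rewrite (dis y y' z) //; apply: RP.
Qed.

(** A layer is determined by a shape [p], [r] and a colour of the discrete cover, so one countable
    list serves all radii: at [x], take a shape that clears the ball around [x] and a colour of
    [x]. *)
Lemma template_family : (forall s y, exists p r, template p r y /\
    forall z, nearby s y z -> piece p y z /\ ~ piece r y z) ->
  exists L : nat -> layer adj nb, forall s x, exists i, cleared s [:: L i] x.
Proof.
move=> hT.
have /choice[F hF] (kpr : nat * seq (seq nat) * seq (seq nat)) :
    exists L : layer adj nb, [/\ layer_set L = discrete_cover adj U (2 * piece_radius kpr.1.2)
      kpr.1.1 `&` template kpr.1.2 kpr.2, layer_in L = kpr.1.2 & layer_ring L = kpr.2].
  case: kpr => [[k p] r] /=.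
  have [||y []//|L [? ? ? _]] := @template_layer p r (discrete_cover adj U (2 * piece_radius p)
      k `&` template p r).
  - by apply: borel_and; [exact: (borel_discrete_cover en)|exact: borel_template].
  - by move=> x y [cx _] [cy _]; apply: (discrete_cover_discrete cx cy).
  by exists L.
exists (fun i => F (odflt (0, [::], [::]) (unpickle i))) => s x.
have [p [r [tx hx]]] := hT s x.
have [k kx] := discrete_cover_ex en Ubase (2 * piece_radius p) x.
exists (pickle (k, p, r)); rewrite pickleK /=.
have [eB eP eR] := hF (k, p, r); apply: (@cleared_layer _ _ _ x); first by rewrite eB.
by rewrite eP eR.
Qed.

End Templates.

Section TreeOnInvariant.
Variables (X : ptopologicalType) (G : sgraph X) (U : nat -> set X) (nb : nat -> X -> X).
Hypothesis GT : vset G = setT.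
Hypothesis en : enumerated (fun x y => adj G x y) U nb.

Lemma conn_invariant_graph Z : conn_invariant (fun x y => adj G x y) Z -> graph_invariant G Z.
Proof.
move=> iZ; exists [set C | graph_component G C /\ C `<=` Z]; first by move=> C [].
apply/seteqP; split=> [x Zx|x [C [_ CZ] /CZ]//].
exists [set y | reachable G x y]; last by exists [::].
split; first by exists x; rewrite ?GT.
by move=> y /reachable_conn xy; apply: iZ xy Zx.
Qed.

Lemma one_ended_map_tree Z f : borel Z -> conn_invariant (fun x y => adj G x y) Z ->
  one_ended_map (fun x y => adj G x y) Z f ->
  admits_borel_one_ended_spanning_tree (induced_sgraph G Z).
Proof.
move=> bZ iZ [bf fadj fback fmerge].
have Zadj x y : Z x -> adj G x y -> Z y.
  by move=> Zx xy; apply: iZ Zx; apply: conn_edge.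
have conn_ind x y : Z x -> conn (fun x y => adj G x y) setT x y ->
    conn (fun x y => adj (induced_sgraph G Z) x y) setT x y.
  move=> + xy; elim: xy => [u _ _|u v w _ uv _ IH Zx]; first exact: conn_refl.
  have Zv := Zadj _ _ Zx uv; apply: conn_step (IH Zv) => //.
  by apply/and3P; split=> //; apply/mem_set.
have ind_conn x y : conn (fun x y => adj (induced_sgraph G Z) x y) setT x y ->
    conn (fun x y => adj G x y) setT x y.
  by elim=> [u _|u v w _ /and3P[uv _ _] _ IH]; [exact: conn_refl|exact: conn_step IH].
apply: (@map_tree_spanning _ U _ f); rewrite /= ?GT ?setTI //.
- exact: en_sep en.
- move=> x [_ Zx]; apply/and3P; split; [exact: fadj|exact/mem_set|apply/mem_set].
  exact: Zadj (fadj x Zx).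
- move=> x [_ Zx]; apply: sub_finite_set (fback x Zx) => y [[_ Zy] hy]; by split.
- by move=> x y [_ Zx] /ind_conn; apply: fmerge.
- move=> x [_ Zx]; have := @en_inf _ _ _ _ en x; apply: sub_infinite_set => y; exact: conn_ind.
Qed.

Lemma one_ended_map_treeT f : one_ended_map (fun x y => adj G x y) setT f ->
  admits_borel_one_ended_spanning_tree G.
Proof.
move=> [bf fadj fback fmerge].
apply: (@map_tree_spanning _ U _ f); rewrite ?GT //.
- exact: en_sep en.
- by apply: borel_cst.
- by move=> x _; apply: (en_inf en).
Qed.

End TreeOnInvariant.

(** * The generic case *)

Section Category.
Variables (R : realType) (X : ptopologicalType) (d : X -> X -> R) (q : nat -> X).
Hypothesis dd : complete_dist d.
Hypothesis qdense : forall x (e : R), (0 < e)%R -> exists n, (d (q n) x < e)%R.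
Variable G : sgraph X.
Hypothesis GT : vset G = setT.
Hypothesis locfin : locally_finite_graph G.
Hypothesis oneend : one_ended_graph G.

Local Notation U := (rational_ball d q).
Local Notation E := (fun x y => adj G x y).

Lemma rational_ball_separating : separating U.
Proof. exact: base_separating (rational_ball_base dd qdense) (polish_hausdorff dd). Qed.

Lemma graph_fin x : finite_set [set y | adj G x y].
Proof. by apply: locfin; rewrite GT. Qed.

Lemma graph_enumerated (nb : nat -> X -> X) : (forall i, borel_fun (nb i)) ->
  (forall x y, adj G x y -> exists i, nb i x = y) ->
  (forall i x, nb i x = x \/ adj G x (nb i x)) -> enumerated E U nb.
Proof.
move=> bnb nb_ex nb_or; split=> //.
- exact: rational_ball_separating.
- by move=> x y; rewrite adj_sym.
- by move=> x; rewrite adj_irr.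
- exact: graph_fin.
- exact: infinite_class GT locfin oneend.
Qed.

(** Let [V] be the infinite part left by the ball, and [W] the finite rest of the component. The
    ring is a finite connected subset of [V] containing all neighbours of [W] in [V]; the piece is
    [W] together with the ring. *)
Lemma graph_template (nb : nat -> X -> X) : enumerated E U nb -> forall s y,
  exists p r, template E nb p r y /\
    forall z, nearby E s y z -> piece nb p y z /\ ~ piece nb r y z.
Proof.
move=> en s y; set F := [set z | nearby E s y z].
have finF : finite_set F by exact: nearby_finite graph_fin s y.
have [V [Vsub Vconn _ _ finW]] := infinite_part GT locfin oneend y finF.
set W := (X in finite_set X) in finW.
pose N := V `&` \bigcup_(u in W) [set v | adj G u v].
have finN : finite_set N.
  by apply: finite_setIr; apply: bigcup_finite => // u _; exact: graph_fin.
have adjC : forall x y, E x y -> E y x by move=> a b; rewrite adj_sym.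
have [Rg [finR NR RV Rconn]] := finite_connected_hull adjC Vconn (@subIsetl _ _ _) finN.
have [|r hr] := finite_piece en (y := y) finR; first by move=> z /RV /Vsub[].
have [||p hp] := finite_piece en (y := y) (A := W `|` Rg).
- by rewrite finite_setU.
- by move=> z [[]//|/RV /Vsub[]].
exists p, r; rewrite /template hr hp; split; last first.
  move=> z sz; split; last by move=> /RV /Vsub[_]; apply.
  left; split; first exact: nearby_conn sz.
  by move=> /Vsub[_]; apply.
split; [by move=> z Rz; right|exact: Rconn|].
move=> z w [Wz _|Rz /(_ Rz)//] zw; case: (pselect (V w)) => Vw.
  by right; apply: NR; split=> //; exists z.
left; split=> //; apply: conn_trans (conn_edge _ _ zw) => //.
by case: Wz.
Qed.

Lemma generic_tree : borel_edges G -> exists X' : set X,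
  [/\ graph_invariant G X', comeagre X', borel X' &
      admits_borel_one_ended_spanning_tree (induced_sgraph G X')].
Proof.
move=> bE.
have [nb [bnb nb_ex nb_or]] := lusin_novikov dd qdense bE graph_fin.
have en := graph_enumerated bnb nb_ex nb_or.
have [L hL] := template_family en (rational_ball_base dd qdense) (graph_template en).
(* The state of the branch is the list of the layers chosen so far: its length and total diameter
   fix the radius to be cleared by the next one. *)
pose cov (h : seq (layer E nb)) i := cleared (clear_radius (size h) (stage_diam h)) [:: L i].
pose next h i := h ++ [:: L i].
have bcov h i : borel (cov h i) by exact: (borel_cleared en).
have ccov h x : exists i, cov h i x by exact: hL.
have [a [h [h0 hS com]]] := generic_branch dd qdense [::] next bcov ccov.
pose st n := [:: L (a n)].
have cumE n : cumul st n = h n by elim: n => [//|n IH]; rewrite hS /next -IH.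
have szh n : size (h n) = n by elim: n => [|n IH]; rewrite ?h0 // hS size_cat IH addn1.
pose D n := stage_diam (h n).
have Dge n : stage_diam (cumul st n) <= D n by rewrite cumE.
pose Z := stage_domain st D.
have bZ : borel Z by exact: (borel_stage_domain en).
have iZ : conn_invariant E Z by exact: (stage_domain_inv en).
have [f hf] := stage_map en Dge.
exists Z; split=> //.
- by apply: (conn_invariant_graph GT).
- apply: meagre_sub com => x /= nZ inf; apply: nZ; apply: (stage_domain_ex Dge) => m.
  by have [n mn hn] := inf m; exists n => //; move: hn; rewrite /cov szh.
- exact: (one_ended_map_tree GT en bZ iZ hf).
Qed.

End Category.

Lemma conn_map (X Y : Type) (adj : X -> X -> Prop) (adj' : Y -> Y -> Prop) (f : X -> Y)
    (A : set X) (B : set Y) : (forall u v, adj u v -> f u = f v \/ adj' (f u) (f v)) ->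
  (forall u, A u -> B (f u)) -> forall x y, conn adj A x y -> conn adj' B (f x) (f y).
Proof.
move=> fadj AB x y; elim=> [u /AB|u v w Au uv vw IH]; first exact: conn_refl.
by case: (fadj u v uv) => [->//|h]; apply: conn_step h IH; apply: AB.
Qed.

(** * Cayley graphs *)

Section Cayley.
Variables (Gam : groupType) (S : seq Gam).
Hypothesis genS : generates S.
Implicit Types (g h : Gam) (w v : seq nat) (P R : seq Gam).
Local Open Scope group_scope.

Definition letters : seq Gam := S ++ [seq x^-1 | x <- S].
(** The default value [1] makes indices out of range act trivially, which is the padding permitted
    by [enumerated]. *)
Definition letter i := nth 1 letters i.
(** Generators multiply on the left, as in the Schreier graph. Right translations are automorphisms,
    and the distance from [g] to [h] is the length of [h * g^-1]. *)
Definition cay g h := g <> h /\ h * g^-1 \in letters.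

Lemma lettersV g : g \in letters -> g^-1 \in letters.
Proof.
rewrite !mem_cat => /orP[gS|/mapP[s sS ->]]; first by rewrite map_f ?orbT.
by rewrite invgK sS.
Qed.

Lemma letter_or i : letter i \in letters \/ letter i = 1.
Proof. by case: (ltnP i (size letters)) => h; [left; apply: mem_nth|right; apply: nth_default]. Qed.

Fixpoint ev w : Gam := if w is i :: w' then letter i * ev w' else 1.

Lemma ev_cat v w : ev (v ++ w) = ev v * ev w.
Proof. by elim: v => [|i v IH] /=; rewrite ?mul1g // IH mulgA. Qed.

Lemma cay_sym g h : cay g h -> cay h g.
Proof.
move=> [ne hg]; split; first by move=> e; apply: ne.
by have := lettersV hg; rewrite invgM invgK.
Qed.

Lemma cay_right (x g h : Gam) : cay g h -> cay (g * x) (h * x).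
Proof.
move=> [ne hg]; split; first by move=> /mulIg.
by rewrite invgM mulgA mulgK.
Qed.

Lemma cay_letter l g : l \in letters -> g = l * g \/ cay g (l * g).
Proof.
move=> ll; case: (eqVneq g (l * g)) => [|/eqP ne]; first by left.
by right; split=> //; rewrite mulgK.
Qed.

Fixpoint wball n : seq Gam :=
  if n is n'.+1 then undup (wball n' ++ [seq l * g | l <- letters, g <- wball n']) else [:: 1].

Lemma uniq_wball n : uniq (wball n).
Proof. by case: n => //= n; apply: undup_uniq. Qed.

Lemma wballS n : {subset wball n <= wball n.+1}.
Proof. by move=> g gn; rewrite /= mem_undup mem_cat gn. Qed.

Lemma wball_leq m n : m <= n -> {subset wball m <= wball n}.
Proof.
move=> /subnK <-; elim: (n - m) => [|k IH] g gm; first by [].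
by apply: wballS; apply: IH.
Qed.

Lemma wballP n g : reflect (exists2 w, size w <= n & ev w = g) (g \in wball n).
Proof.
apply: (iffP idP).
  elim: n g => [|n IH] g; first by rewrite inE => /eqP ->; exists [::].
  rewrite /= mem_undup mem_cat => /orP[/IH[w wn <-]|/allpairsP[[l h] /= [ll /IH[w wn <-] ->]]].
    by exists w => //; apply: leqW.
  by exists (index l letters :: w) => //=; rewrite /letter nth_index.
move=> [w + <-]; elim: w n => [|i w IH] n; first by move=> _; apply: (wball_leq (leq0n n)); rewrite inE.
case: n => // n; rewrite ltnS /= => /IH wn; rewrite mem_undup mem_cat.
case: (letter_or i) => [il|->]; last by rewrite mul1g wn.
by apply/orP; right; apply/allpairsP; exists (letter i, ev w).
Qed.

Lemma wball1 n : 1 \in wball n.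
Proof. by apply/wballP; exists [::]. Qed.

Lemma wballM m n g h : g \in wball m -> h \in wball n -> g * h \in wball (m + n).
Proof.
move=> /wballP[v vm <-] /wballP[w wn <-]; apply/wballP; exists (v ++ w); last exact: ev_cat.
by rewrite size_cat leq_add.
Qed.

Lemma wballV n g : g \in wball n -> g^-1 \in wball n.
Proof.
move=> /wballP[w wn <-]; elim: w n wn => [|i w IH] n /=; first by rewrite invg1 wball1.
case: n => // n; rewrite ltnS => /IH h; rewrite invgM -addn1; apply: wballM => //.
apply/wballP; case: (letter_or i) => [/lettersV il|->]; last by exists [::] => //; rewrite invg1.
by exists [:: index (letter i)^-1 letters] => //=; rewrite /letter nth_index ?mulg1.
Qed.

Lemma wball_ex g : exists n, g \in wball n.
Proof.
have [n [s [_ sS ->]]] := genS g; exists (size s); elim: s sS => [|l s IH] sS.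
  by rewrite big_nil wball1.
rewrite big_cons /= mem_undup mem_cat; apply/orP; right; apply/allpairsP.
exists (l, \prod_(b <- s) b); split=> //=; last by apply: IH => b bs; apply: sS; rewrite inE bs orbT.
have /orP[lS|lS] := sS l (mem_head _ _); rewrite mem_cat ?lS //.
by rewrite -[l]invgK map_f ?orbT.
Qed.

Definition len g := ex_minn (wball_ex g).

Lemma len_leq g n : (len g <= n) = (g \in wball n).
Proof.
rewrite /len; case: ex_minnP => m gm hm; apply/idP/idP; last exact: hm.
by move=> /wball_leq; apply.
Qed.

Lemma len_ball g : g \in wball (len g). Proof. by rewrite -len_leq. Qed.

Lemma len1 : len 1 = 0.
Proof. by apply/eqP; rewrite -leqn0 len_leq wball1. Qed.

Lemma lenM g h : len (g * h) <= len g + len h.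
Proof. by rewrite len_leq wballM ?len_ball. Qed.

Lemma lenV g : len g^-1 = len g.
Proof.
have h x : len x^-1 <= len x by rewrite len_leq wballV ?len_ball.
by apply/eqP; rewrite eqn_leq h; have := h g^-1; rewrite invgK.
Qed.

Lemma len_ev w : len (ev w) <= size w.
Proof. by rewrite len_leq; apply/wballP; exists w. Qed.

Lemma geodesic_ex g : exists2 w, size w = len g & ev w = g.
Proof.
have /wballP[w wn ew] := len_ball g; exists w => //.
by apply/eqP; rewrite eqn_leq wn -{1}ew len_ev.
Qed.

Lemma geodesic_cat v w : len (ev (v ++ w)) = size (v ++ w) ->
  len (ev v) = size v /\ len (ev w) = size w.
Proof.
rewrite ev_cat size_cat => h; have := lenM (ev v) (ev w).
by have := len_ev v; have := len_ev w; split; lia.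
Qed.

Lemma len_split g k : k <= len g -> exists u h, [/\ g = u * h, len h = k & len u = len g - k].
Proof.
move=> kg; have [w sw ew] := geodesic_ex g.
set m := len g - k; exists (ev (take m w)), (ev (drop m w)).
have [|h1 h2] := @geodesic_cat (take m w) (drop m w); first by rewrite cat_take_drop ew.
rewrite h1 h2 -ev_cat cat_take_drop ew size_drop size_takel sw ?leq_subr //.
by split=> //; rewrite subKn.
Qed.

Definition track w (x : Gam) : set Gam := [set z | exists2 k, k <= size w & z = ev (drop k w) * x].

Lemma conn_track w (x : Gam) : conn cay (track w x) (ev w * x) x.
Proof.
elim: w => [|i w IH] /=.
  by rewrite mul1g; apply: conn_refl; exists 0; rewrite ?mul1g.
have tw : track w x `<=` track (i :: w) x by move=> z [k kw ->]; exists k.+1.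
have top : track (i :: w) x (letter i * ev w * x) by exists 0.
have := conn_sub tw IH; rewrite -mulgA => h.
case: (letter_or i) => [il|->]; last by rewrite mul1g.
case: (@cay_letter (letter i) (ev w * x) il) => [<- //|/cay_sym e].
by apply: conn_step e h; rewrite mulgA.
Qed.

Section Action.
Variables (X : topologicalType) (a : Gam -> X -> X).
Implicit Types (x y z : X).
Hypothesis act : free_borel_action a.
Variable adj : X -> X -> Prop.
Hypothesis sch : forall x y, adj x y <-> x <> y /\ exists2 s, s \in S & y = a s x \/ x = a s y.

Lemma act1 x : a 1 x = x. Proof. by have [h _ _ _] := act; exact: h. Qed.
Lemma actM g h x : a (g * h) x = a g (a h x). Proof. by have [_ k _ _] := act; exact: k. Qed.
Lemma borel_act g : borel_fun (a g). Proof. by have [_ _ h _] := act => B; exact: h. Qed.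
Lemma act_inj x g h : a g x = a h x -> g = h.
Proof.
have [_ _ _ free] := act; move=> e; apply/eqP; rewrite eq_sym -divg_eq1; apply/eqP.
by apply: (free _ (a g x)); rewrite -actM mulgVK e.
Qed.
Lemma actK g x : a g^-1 (a g x) = x. Proof. by rewrite -actM mulVg act1. Qed.
Lemma actVK g x : a g (a g^-1 x) = x. Proof. by rewrite -actM mulgV act1. Qed.

Definition act_nb i x := a (letter i) x.

Lemma adj_letter x y : adj x y <-> x <> y /\ exists2 l, l \in letters & y = a l x.
Proof.
rewrite sch; split=> -[ne [s sS e]]; split=> //.
  case: e => [->|->]; first by exists s => //; rewrite mem_cat sS.
  by exists s^-1; rewrite ?actK // mem_cat map_f ?orbT.
move: sS; rewrite mem_cat => /orP[sS|/mapP[t tS et]]; first by exists s => //; left.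
by exists t => //; right; rewrite e et actVK.
Qed.

Lemma walk_act w x : walk act_nb w x = a (ev w) x.
Proof. by elim: w => [|i w IH] /=; rewrite ?act1 // IH actM. Qed.

Lemma act_nb_ex x y : adj x y -> exists i, act_nb i x = y.
Proof.
by move=> /adj_letter[_ [l ll ->]]; exists (index l letters); rewrite /act_nb /letter nth_index.
Qed.

Lemma act_nb_or i x : act_nb i x = x \/ adj x (act_nb i x).
Proof.
rewrite /act_nb; case: (letter_or i) => [il|->]; last by left; exact: act1.
case: (pselect (a (letter i) x = x)) => e; first by left.
by right; apply/adj_letter; split; [move=> h; apply: e|exists (letter i)].
Qed.

Lemma adj_cay x g h : adj (a g x) (a h x) <-> cay g h.
Proof.
split=> [/adj_letter[ne [l ll e]]|[ne hg]].
  split; first by move=> gh; apply: ne; rewrite gh.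
  have -> : h = l * g by apply: (act_inj (x := x)); rewrite e actM.
  by rewrite mulgK.
apply/adj_letter; split; first by move=> /act_inj.
by exists (h * g^-1) => //; rewrite -actM mulgVK.
Qed.

Lemma adj_orbit x g z : adj (a g x) z -> exists2 h, cay g h & z = a h x.
Proof.
move=> gz; have /adj_letter[_ [l _ ez]] := gz.
by exists (l * g); rewrite ?actM //; apply/(adj_cay x); rewrite actM -ez.
Qed.

Lemma conn_orbit x z : conn adj setT x z -> exists g, z = a g x.
Proof.
by move=> /(walk_conn act_nb_ex)[w ->]; exists (ev w); rewrite walk_act.
Qed.

Lemma nearby_ball n x z : nearby adj n x z <-> exists2 g, g \in wball n & z = a g x.
Proof.
split.
  elim: n x => [|n IH] x; first by move=> /= <-; exists 1; rewrite ?inE ?act1.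
  move=> [/IH[g gn ->]|[y /act_nb_ex[i <-] /IH[g gn ->]]]; first by exists g => //; apply: wballS.
  exists (g * letter i); last by rewrite actM.
  rewrite -addn1; apply: wballM => //; apply/wballP; exists [:: i] => //=; exact: mulg1.
move=> [_ /wballP[w wn <-] ->]; rewrite -walk_act.
by apply: nearby_leq wn (nearby_walk act_nb_or w x).
Qed.

Lemma words_of n P : {subset P <= wball n} ->
  exists2 p, map ev p = P & piece_radius p <= n.
Proof.
elim: P => [|g P IH] sub; first by exists [::] => //; rewrite /piece_radius big_nil.
have [|p eP pn] := IH; first by move=> h hP; apply: sub; rewrite inE hP orbT.
have /wballP[w wn ew] := sub g (mem_head _ _).
exists (w :: p); rewrite /= ?ew ?eP //.
by rewrite /piece_radius big_cons geq_max wn.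
Qed.

Lemma piece_act p y z : piece act_nb p y z <-> exists2 g, g \in map ev p & z = a g y.
Proof.
split=> [[v vp ->]|[_ /mapP[v vp ->] ->]]; last by exists v; rewrite ?walk_act.
by exists (ev v); rewrite ?map_f ?walk_act.
Qed.

Definition group_template P R := [/\ {subset R <= P},
  {in R &, forall g h, conn cay [set` R] g h} &
  forall g h, g \in P -> g \notin R -> cay g h -> h \in P].

Lemma group_templateP p r y : group_template (map ev p) (map ev r) ->
  template adj act_nb p r y.
Proof.
move=> [RP Rconn Pcl]; split.
- by move=> z /piece_act[g gR ->]; apply/piece_act; exists g => //; apply: RP.
- move=> _ _ /piece_act[g gR ->] /piece_act[h hR ->].
  apply: (@conn_map _ _ cay adj (a^~ y) [set` map ev r]).
  - by move=> u v uv; right; apply/adj_cay.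
  - by move=> u uR; apply/piece_act; exists u.
  - exact: Rconn.
- move=> z w /piece_act[g gP ->] nR /adj_orbit[h gh ->]; apply/piece_act; exists h => //.
  by apply: Pcl gP _ gh; apply/negP => gR; apply: nR; apply/piece_act; exists g.
Qed.

Variable U : nat -> set X.
Hypothesis en : enumerated adj U act_nb.

Lemma group_layer P R n (B : set X) : group_template P R -> {subset P <= wball n} -> borel B ->
  discrete_set adj (2 * n) B -> exists L : layer adj act_nb,
    [/\ layer_set L = B, layer_diam L <= 2 * n,
        forall y z, piece act_nb (layer_in L) y z <-> exists2 g, g \in P & z = a g y &
        forall y z, piece act_nb (layer_ring L) y z <-> exists2 g, g \in R & z = a g y].
Proof.
move=> tPR Pn bB dB.
have [RP _ _] := tPR.
have [p eP pn] := words_of Pn; have [|r eR _] := @words_of n R; first by move=> g /RP /Pn.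
have dB' : discrete_set adj (2 * piece_radius p) B.
  by move=> x y Bx By xy; apply: dB => //; apply: nearby_leq xy; rewrite leq_mul2l.
have [|L [hB hp hr hd]] := template_layer en (p := p) (r := r) bB dB'.
  by move=> y _; apply: group_templateP; rewrite eP eR.
exists L; rewrite hB hp hr hd -eP -eR leq_mul2l pn orbT.
by split=> // y z; apply: piece_act.
Qed.

End Action.
End Cayley.

Lemma uniq_map_injP (T1 T2 : eqType) (f : T1 -> T2) s x y : uniq (map f s) ->
  x \in s -> y \in s -> f x = f y -> x = y.
Proof.
elim: s => //= a s IH /andP[as_ us]; rewrite !inE => /orP[/eqP ->|xs] /orP[/eqP ->|ys] e //.
- by move: as_; rewrite e map_f.
- by move: as_; rewrite -e map_f.
- exact: IH.
Qed.

Lemma infinite_uniq (T : choiceType) (A : set T) n : infinite_set A ->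
  exists s : seq T, [/\ uniq s, size s = n & forall z, z \in s -> A z].
Proof.
move=> inf; elim: n => [|n [s [us sn sA]]]; first by exists [::].
have [z [Az zs]] : exists z, A z /\ z \notin s.
  apply: contrapT => nex; apply: inf; apply: sub_finite_set (finite_seq s) => z Az /=.
  by apply: contrapT => /negP zs; apply: nex; exists z.
exists (z :: s); rewrite /= zs us sn; split=> // t; rewrite inE => /orP[/eqP ->//|]; exact: sA.
Qed.

(** * Growth of one-ended groups *)

Section Ultrafilter.
Variables (T : Type) (F : set_system T).
Hypothesis uF : UltraFilter F.

Lemma ultra_bigU (I : eqType) (s : seq I) (A : I -> set T) (B : set T) : F B ->
  (forall t, B t -> exists2 i, i \in s & A i t) -> exists2 i, i \in s & F (A i).
Proof.
elim: s B => [|i s IH] B FB BA.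
  have [t /BA[i]] := filter_ex FB; by rewrite in_nil.
have [FA|FA] := in_ultra_setVsetC (A i) uF; first by exists i => //; apply: mem_head.
have [t [Bt nA]|j js FAj] := IH (B `&` ~` A i) (filterI FB FA).
  have [j] := BA t Bt; rewrite inE => /orP[/eqP ->//|js Aj]; by exists j.
by exists j => //; rewrite inE js orbT.
Qed.

Lemma ultra_all (I : eqType) (s : seq I) (A : I -> set T) :
  (forall i, i \in s -> F (A i)) -> F [set t | forall i, i \in s -> A i t].
Proof.
elim: s => [|i s IH] FA; first by apply: (filterS _ filterT).
have h : F (A i `&` [set t | forall i, i \in s -> A i t]).
  apply: filterI; first by apply: FA; apply: mem_head.
  by apply: IH => j js; apply: FA; rewrite inE js orbT.
by apply: filterS h => t [Ai h] j; rewrite inE => /orP[/eqP ->//|]; apply: h.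
Qed.

End Ultrafilter.

Section Growth.
Variables (Gam : groupType) (S : seq Gam).
Hypothesis genS : generates S.
Implicit Types (g h z : Gam) (w v u x : seq nat).
Hypothesis len_ex : forall n, exists g : Gam, len genS g = n.
Hypothesis cut : forall F A B : set Gam, finite_set F -> (forall g, F g \/ A g \/ B g) ->
  A `&` B = set0 -> (forall g h, A g -> cay S g h -> ~ F h -> A h) ->
  (forall g h, B g -> cay S g h -> ~ F h -> B h) -> finite_set A \/ finite_set B.
Local Open Scope group_scope.

Local Notation len := (len genS).
Local Notation ev := (ev S).
Local Notation wball := (wball S).
Local Notation cay := (cay S).

Definition sphere n := [seq g <- wball n | len g == n].

Lemma mem_sphere n g : (g \in sphere n) = (len g == n).
Proof.
by rewrite mem_filter andbC; case: eqP => [<-|]; rewrite ?andbF // len_ball.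
Qed.

Lemma uniq_sphere n : uniq (sphere n).
Proof. exact: filter_uniq (uniq_wball S n). Qed.

Lemma len_cay g h : cay g h -> len h <= (len g).+1.
Proof.
move=> [_ hg]; rewrite -[h](mulgVK g); apply: leq_trans (lenM _ _ _) _.
rewrite -add1n leq_add2r len_leq; apply/wballP; exists [:: index (h * g^-1) (letters S)] => //=.
by rewrite /letter nth_index // mulg1.
Qed.

(* If infinitely many spheres had at most [C] elements, a Busemann function,
   that is a limit of the distances to points going to infinity along a
   bi-infinite geodesic, would have a finite level set separating two
   infinite sides. *)
Lemma sphere_unbounded C : exists m, forall n, m <= n -> C < size (sphere n).
Proof.
apply: contrapT => nex.
have /choice[T hT] m : exists n, m <= n /\ size (sphere n) <= C.
  apply: contrapT => nm; apply: nex; exists m => n mn.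
  by rewrite ltnNge; apply/negP => h; apply: nm; exists n.
(* The points [(h n)^-1], [1] and [u] lie in this order on a geodesic of length [2 * T n] with [1]
   in the middle. The function [b] below is the limit of the distances to [(h n)^-1], normalised to
   vanish at [1]. *)
have /choice[h hh] n : exists h, exists2 u, len h = T n & len u = T n /\ len (u * h) = T n + T n.
  have [g gT] := len_ex (T n + T n); have [|u [h [gE hT' uT]]] := @len_split _ _ genS g (T n).
    by rewrite gT leq_addr.
  by exists h, u => //; rewrite uT -gE gT addnK.
have [F [uF subF]] := ultraFilterLemma (eventually_filter : ProperFilter \oo).
pose Bus z (k : int) := [set n | (len (z * h n))%:Z - (T n)%:Z = k]%R.
have busle n z : (`|(len (z * h n))%:Z - (T n)%:Z| <= (len z)%:Z)%R.
  have [u hn _] := hh n.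
  have h1 := lenM genS z (h n); have := lenM genS z^-1 (z * h n).
  by rewrite mulKg lenV; move: h1; rewrite hn; lia.
have /choice[b hb] z : exists k, F (Bus z k).
  pose ks := [seq (i%:Z - (len z)%:Z)%R | i <- iota 0 (len z + len z).+1].
  have [|k _ Fk] := @ultra_bigU _ _ uF _ ks (Bus z) setT filterT; last by exists k.
  move=> n _; exists ((len (z * h n))%:Z - (T n)%:Z)%R => //.
  apply/mapP; exists `|((len (z * h n))%:Z - (T n)%:Z + (len z)%:Z)%R|%N; last first.
    by have := busle n z; lia.
  by rewrite mem_iota; have := busle n z; lia.
(* On these geodesics, the points at distance [k] from [1] towards [u] and towards [(h n)^-1] have
   the values [k] and [- k]. They range over a finite ball, so the ultrafilter selects one of each
   kind. *)
have lev (k : nat) : (exists z, b z = Posz k) /\ exists z, b z = (- Posz k)%R.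
  have Fk : F [set n | (k <= n)%N] by apply: subF; exists k.
  have bE z c : F (Bus z c) -> b z = c.
    move=> Fc; have [n [e1 e2]] := filter_ex (filterI (hb z) Fc).
    by rewrite -e1 -e2.
  split.
    have [|z _ /bE e] := @ultra_bigU _ _ uF _ (wball k) (fun z => Bus z (Posz k)) _ Fk; last by exists z.
    move=> n /= kn; have [u hn [un uh]] := hh n; have [Tn _] := hT n.
    have [|u1 [u2 [uE u2k u1k]]] := @len_split _ _ genS u k; first by lia.
    exists u2; first by rewrite -len_leq u2k.
    have := lenM genS u1 (u2 * h n); rewrite mulgA -uE uh u1k un.
    by have := lenM genS u2 (h n); rewrite u2k hn /Bus /=; lia.
  have [|z _ /bE e] := @ultra_bigU _ _ uF _ (wball k) (fun z => Bus z (- Posz k)%R) _ Fk; last by exists z.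
  move=> n /= kn; have [u hn _] := hh n; have [Tn _] := hT n.
  have [|h1 [h2 [hE h2k h1k]]] := @len_split _ _ genS (h n) (T n - k); first by lia.
  exists h1^-1; first by rewrite -len_leq lenV h1k hn; lia.
  by rewrite /Bus /= hE mulKg h2k; lia.
have badj g g' : cay g g' -> (b g - 1 <= b g' <= b g + 1)%R.
  move=> gg'; have [n [e1 e2]] := filter_ex (filterI (hb g) (hb g')).
  have := len_cay (cay_right (h n) gg'); have := len_cay (cay_right (h n) (cay_sym gg')).
  by move: e1 e2; rewrite /Bus /=; lia.
(* For a suitable [n], right translation by [h n] injects finitely many points of this level set
   into the sphere of radius [T n], which has at most [C] elements. *)
have fin0 : finite_set [set z | b z = 0%R].
  apply: contrapT => inf; have [s [us sC sB]] := infinite_uniq C.+1 inf.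
  have [n hn] : exists n, forall z, z \in s -> Bus z 0%R n.
    apply: (@filter_ex _ F); apply: ultra_all => z /sB bz.
    by rewrite -bz.
  have [_ TC] := hT n.
  have : size (map (fun z => z * h n) s) <= size (sphere (T n)).
    apply: uniq_leq_size; first by rewrite map_inj_uniq; [|exact: mulIg].
    by move=> _ /mapP[z /hn zn ->]; rewrite mem_sphere; move: zn; rewrite /Bus /=; lia.
  by rewrite size_map => /leq_trans/(_ TC); rewrite sC ltnn.
have inf_side (A : set Gam) (f : int -> int) : (forall k : nat, exists2 z, A z & f (b z) = Posz k.+1) ->
    infinite_set A.
  move=> Ak /(finite_image (fun z => `|f (b z)|.-1)) fin.
  apply: infinite_nat; apply: sub_finite_set fin => k _.
  by have [z Az e] := Ak k; exists z => //; rewrite e.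
have [|||||] := @cut [set z | b z = 0%R] [set z | 0 < b z]%R [set z | b z < 0]%R fin0.
- by move=> g /=; have := ltgtP (b g) 0%R; lia.
- by apply/seteqP; split=> // z /= []; lia.
- by move=> g g' /= bg /badj; lia.
- by move=> g g' /= bg /badj; lia.
- apply: (@inf_side _ id) => k; have [[z bz] _] := lev k.+1; exists z => //=; lia.
- apply: (@inf_side _ (fun k => - k)%R) => k; have [_ [z bz]] := lev k.+1; exists z => /=; lia.
Qed.

End Growth.

(** * ShortLex words and quadratic growth *)

Section ShortLex.
Variables (Gam : groupType) (S : seq Gam).
Hypothesis genS : generates S.
Implicit Types (g h : Gam) (w v u x : seq nat).
Local Open Scope group_scope.

Local Notation len := (len genS).
Local Notation ev := (ev S).
Local Notation sphere := (sphere genS).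
Let base := (size (letters S)).+1.

(** The value of a word in base [base]: for words of equal length with letters below [base],
    comparing codes is comparing lexicographically. *)
Fixpoint code w : nat := if w is i :: w' then (i * base ^ size w' + code w')%N else 0.

Lemma code_cat v w : code (v ++ w) = (code v * base ^ size w + code w)%N.
Proof. by elim: v => //= i v ->; rewrite size_cat expnD; lia. Qed.

Lemma code_lt w : all (fun i => i < base) w -> code w < base ^ size w.
Proof.
elim: w => //= i w IH /andP[ib /IH wb]; rewrite expnS.
by have : i.+1 * base ^ size w <= base * base ^ size w; [rewrite leq_mul2r ib orbT|lia].
Qed.

Lemma code_inj v w : all (fun i => i < base) v -> all (fun i => i < base) w ->
  size v = size w -> code v = code w -> v = w.
Proof.
elim: v w => [|i v IH] [|j w] //= /andP[ib vb] /andP[jb wb] [vw].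
rewrite vw => e; have hv := code_lt vb; have hw := code_lt wb; rewrite vw in hv.
have ij : i = j.
  have := congr1 (fun n => n %/ base ^ size w) e.
  by rewrite !divnMDl ?expn_gt0 // !divn_small ?addn0.
by rewrite ij in e *; congr (_ :: _); apply: IH => //; lia.
Qed.

Definition shortlex w := len (ev w) = size w /\
  forall w', size w' = size w -> ev w' = ev w -> code w <= code w'.

Lemma shortlex_cat v w : shortlex (v ++ w) -> shortlex v /\ shortlex w.
Proof.
move=> [/geodesic_cat[lv lw] least]; split; split=> // w' sw ew.
  have := least (w' ++ w); rewrite !size_cat sw !ev_cat ew !code_cat => /(_ erefl erefl).
  by rewrite leq_add2r leq_mul2r expn_eq0.
have := least (v ++ w'); rewrite !size_cat sw !ev_cat ew !code_cat sw => /(_ erefl erefl).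
by rewrite leq_add2l.
Qed.

Lemma shortlex_range w : shortlex w -> all (fun i => i < base) w.
Proof.
elim: w => //= i w IH /(@shortlex_cat [:: i])[[li _] /IH ->]; rewrite andbT.
rewrite ltnS ltnW // ltnNge; apply/negP => h.
by move: li; rewrite /= /letter nth_default // mulg1 len1.
Qed.

Lemma shortlex_inj v w : shortlex v -> shortlex w -> ev v = ev w -> v = w.
Proof.
move=> sv sw e; apply: code_inj (shortlex_range sv) (shortlex_range sw) _ _.
  by rewrite -sv.1 -sw.1 e.
have sz : size v = size w by rewrite -sv.1 -sw.1 e.
by apply/eqP; rewrite eqn_leq sv.2 ?sw.2.
Qed.

Lemma shortlex_ex g : exists w, shortlex w /\ ev w = g.
Proof.
pose Q n := exists w, [/\ size w = len g, ev w = g & code w = n].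
have [w0 s0 e0] := geodesic_ex genS g.
have [n [[w [sw ew cw]] least]] := @least_ex Q (code w0) (ex_intro _ w0 (And3 s0 e0 erefl)).
exists w; split=> //; split; first by rewrite ew.
move=> w' sw' ew'; rewrite cw leqNgt; apply/negP => h; apply: (least _ h).
by exists w'; rewrite sw' ew'.
Qed.

Definition slex g := projT1 (cid (shortlex_ex g)).

Lemma slexP g : shortlex (slex g) /\ ev (slex g) = g.
Proof. exact: projT2 (cid (shortlex_ex g)). Qed.

Definition slwords n := map slex (sphere n).

Lemma mem_slwords n w : w \in slwords n <-> shortlex w /\ size w = n.
Proof.
split=> [/mapP[g]|[sw wn]].
  by rewrite mem_sphere => /eqP gn ->; have [[h1 h2] h3] := slexP g; rewrite -h1 h3.
apply/mapP; exists (ev w); first by rewrite mem_sphere sw.1 wn.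
by have [h1 h2] := slexP (ev w); apply: shortlex_inj.
Qed.

Lemma uniq_slwords n : uniq (slwords n).
Proof.
rewrite map_inj_in_uniq ?uniq_sphere // => g h _ _ e.
by rewrite -(slexP g).2 -(slexP h).2 e.
Qed.

Lemma size_slwords n : size (slwords n) = size (sphere n).
Proof. exact: size_map. Qed.

Hypothesis len_ex : forall n, exists g : Gam, len g = n.

Definition lext M w := exists2 u, size u = M & shortlex (u ++ w).
(** Words that are suffixes of arbitrarily long ShortLex words. They play the role of the factors of
    an infinite word in the Morse-Hedlund theorem. *)
Definition persistent m := [seq w <- slwords m | `[< forall M, lext M w >]].

Lemma lext_leq M N w : M <= N -> lext N w -> lext M w.
Proof.
move=> MN [u uN]; rewrite -{1}(cat_take_drop (N - M) u) -catA => /shortlex_cat[_ h].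
by exists (drop (N - M) u) => //; rewrite size_drop uN subKn.
Qed.

Lemma mem_persistent m w : w \in persistent m <-> size w = m /\ forall M, lext M w.
Proof.
rewrite mem_filter; split=> [/andP[/asboolP h /mem_slwords[_ ->]]|[wm h]]; first by [].
apply/andP; split; first exact/asboolP.
by apply/mem_slwords; split=> //; have [u _ /shortlex_cat[]] := h 0.
Qed.

Lemma persistent_stage m : exists M, forall w, size w = m -> lext M w -> w \in persistent m.
Proof.
have [|M N w MN h1 h2|w|M hM] := @finite_bound _ [set` slwords m]
    (fun M w => lext M w -> forall N, lext N w).
- exact: finite_seq.
- by apply: h1; apply: lext_leq h2.
- move=> wm; case: (pselect (forall N, lext N w)) => [h|/existsNP[N hN]]; first by exists 0.
  by exists N.
exists M => w wm ew; apply/mem_persistent; split=> //; apply: (hM w) => //=.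
by apply/mem_slwords; split=> //; have [u _ /shortlex_cat[]] := ew.
Qed.

Lemma persistent_surj m w : w \in persistent m -> exists i, i :: w \in persistent m.+1.
Proof.
move=> /mem_persistent[wm h]; have [M hM] := persistent_stage m.+1.
have [u] := h M.+1; case/lastP: u => // u i; rewrite size_rcons => -[uM] hs.
exists i; apply: hM; first by rewrite /= wm.
by exists u => //; rewrite -cat_rcons.
Qed.

Lemma persistent0 : 0 < size (persistent 0).
Proof.
suff : [::] \in persistent 0 by case: (persistent 0).
apply/mem_persistent; split=> // M; have [g gM] := len_ex M.
have [h1 h2] := slexP g; exists (slex g); last by rewrite cats0.
by rewrite -h1.1 h2.
Qed.

Lemma size_persistent m : size (persistent m) <= size (sphere m).
Proof. by rewrite -size_slwords size_filter count_size. Qed.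

(* Morse-Hedlund: when the number of persistent words stops growing, a persistent
   word determines the letter preceding it. *)
Lemma sphere_bounded n : 0 < n -> size (sphere n) <= n ->
  exists C, forall m, exists2 N, m <= N & size (sphere N) <= C.
Proof.
move=> n0 pn.
have [m mn mP] : exists2 m, m < n & size (persistent m.+1) <= size (persistent m).
  apply: contrapT => nex.
  have grow k : k <= n -> k < size (persistent k).
    elim: k => [_|k IH kn]; first exact: persistent0.
    apply: leq_ltn_trans (IH (ltnW kn)) _.
    by rewrite ltnNge; apply/negP => h; apply: nex; exists k.
  by have := grow n (leqnn n); have := size_persistent n; lia.
have inj v w : v \in persistent m.+1 -> w \in persistent m.+1 -> behead v = behead w -> v = w.
  apply: uniq_map_injP; apply: (@leq_size_uniq _ (persistent m)).
  - by apply: filter_uniq; apply: uniq_slwords.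
  - move=> u /persistent_surj[i iu]; apply/mapP; by exists (i :: u).
  - by rewrite size_map.
have [M hM] := persistent_stage m.+1.
(* A long ShortLex word is determined by its first [M] and its last [m] letters: the letters in
   between are recovered from right to left. *)
exists (size (allpairs (fun v w => (v, w)) (slwords M) (slwords m))) => k.
set N := k + (M + m); exists N; first by rewrite /N; lia.
rewrite -size_slwords -(size_map (fun w => (take M w, drop (N - m) w))).
apply: uniq_leq_size; last first.
  move=> _ /mapP[w /mem_slwords[sw wN] ->]; apply/allpairsP.
  exists (take M w, drop (N - m) w); split=> //=; apply/mem_slwords.
    split; last by rewrite size_takel // wN /N; lia.
    by move: sw; rewrite -{1}(cat_take_drop M w) => /shortlex_cat[].
  split; last by rewrite size_drop wN /N; lia.
  by move: sw; rewrite -{1}(cat_take_drop (N - m) w) => /shortlex_cat[].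
rewrite map_inj_in_uniq ?uniq_slwords // => v w /mem_slwords[sv vN] /mem_slwords[sw wN] [et ed].
(* A window of length [m.+1] preceded by at least [M] letters is persistent, by the choice of
   [M]. *)
have fac x j : shortlex x -> size x = N -> M <= j -> j < N - m ->
    take m.+1 (drop j x) \in persistent m.+1.
  move=> sx xN Mj jN; apply: hM; first by rewrite size_takel // size_drop xN; lia.
  apply: (lext_leq Mj); exists (take j x); first by rewrite size_takel // xN; lia.
  move: sx; rewrite -{1}(cat_take_drop (j + m.+1) x) takeD => /shortlex_cat[].
  by [].
have dropE j : j <= N - m - M -> drop (N - m - j) v = drop (N - m - j) w.
  elim: j => [|j IH] jN; first by rewrite subn0.
  set i := N - m - j.+1; have iE : N - m - j = i.+1 by rewrite /i; lia.
  have := IH (ltnW jN); rewrite iE => e.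
  have dS x : size x = N -> drop i x = nth 0 x i :: drop i.+1 x.
    by move=> xN; apply: drop_nth; rewrite xN /i; lia.
  rewrite !dS // e; congr (_ :: _).
  have [Mi iN] : M <= i /\ i < N - m by rewrite /i; lia.
  have := inj _ _ (fac v i sv vN Mi iN) (fac w i sw wN Mi iN).
  by rewrite !dS //= e => /(_ erefl)[].
have := dropE (N - m - M) (leqnn _).
have -> : N - m - (N - m - M) = M by rewrite /N; lia.
by move=> e; rewrite -(cat_take_drop M v) -(cat_take_drop M w) et e.
Qed.

Hypothesis cut : forall F A B : set Gam, finite_set F -> (forall g, F g \/ A g \/ B g) ->
  A `&` B = set0 -> (forall g h, A g -> cay S g h -> ~ F h -> A h) ->
  (forall g h, B g -> cay S g h -> ~ F h -> B h) -> finite_set A \/ finite_set B.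

Lemma sphere_gt n : n < size (sphere n).
Proof.
case: n => [|n].
  have : 1%g \in sphere 0 by rewrite mem_sphere len1.
  by case: (sphere 0).
rewrite ltnNge; apply/negP => /(sphere_bounded (ltn0Sn n))[C hC].
have [m hm] := sphere_unbounded len_ex cut C; have [N /hm h] := hC m.
by rewrite leqNgt h.
Qed.

Lemma wball_quadratic n : n.+1 * n.+2 <= 2 * size (wball S n).
Proof.
elim: n => [|n IH]; first by [].
suff : size (wball S n) + size (sphere n.+1) <= size (wball S n.+1).
  by have := sphere_gt n.+1; lia.
rewrite -size_cat; apply: uniq_leq_size.
  rewrite cat_uniq uniq_wball uniq_sphere andbT /=; apply/hasPn => g.
  by rewrite mem_sphere -(len_leq genS) => /eqP ->; rewrite ltnn.
move=> g; rewrite mem_cat => /orP[/wballS//|]; by rewrite mem_filter => /andP[].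
Qed.

End ShortLex.

Section OneEndedGroup.
Variables (X : ptopologicalType) (G : sgraph X).
Hypothesis GT : vset G = setT.
Hypothesis locfin : locally_finite_graph G.
Hypothesis oneend : one_ended_graph G.
Variables (Gam : groupType) (S : seq Gam) (a : Gam -> X -> X).
Hypothesis genS : generates S.
Hypothesis act : free_borel_action a.
Hypothesis sch : schreier_graph_of a S G.

Lemma act_len_ex n : exists g : Gam, len genS g = n.
Proof.
apply: contrapT => nex; have [x0 _] : exists x0 : X, True by exists point.
apply: (infinite_class GT locfin oneend (x := x0)).
apply: (@sub_finite_set _ _ ((fun g => a g x0) @` [set` wball S n])); last first.
  by apply: finite_image; exact: finite_seq.
move=> y /(conn_orbit act sch)[g ->]; exists g => //=; rewrite -(len_leq genS) leqNgt.
apply/negP => /ltnW /(len_split (g := g))[u [h [_ hn _]]]; apply: nex; by exists h.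
Qed.

Lemma act_cut (F A B : set Gam) : finite_set F -> (forall g, F g \/ A g \/ B g) ->
  A `&` B = set0 -> (forall g h, A g -> cay S g h -> ~ F h -> A h) ->
  (forall g h, B g -> cay S g h -> ~ F h -> B h) -> finite_set A \/ finite_set B.
Proof.
move=> finF cov dis clA clB; have [x0 _] : exists x0 : X, True by exists point.
pose im (E : set Gam) := (fun g => a g x0) @` E.
have imE (E : set Gam) g : im E (a g x0) -> E g by move=> [h Eh /(act_inj act) <-].
have cl (E : set Gam) : (forall g h, E g -> cay S g h -> ~ F h -> E h) ->
    forall u w, im E u -> adj G u w -> ~ im F w -> im E w.
  move=> clE _ w [g Eg <-] /(adj_orbit act sch)[h gh ->] nF.
  by exists h => //; apply: clE Eg gh _ => Fh; apply: nF; exists h.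
have back (E : set Gam) : finite_set ([set y | conn (fun x y => adj G x y) setT x0 y] `&` im E) ->
    finite_set E.
  move=> /(@finite_preimage _ _ _ (fun g => a g x0)) fin.
  apply: sub_finite_set (fin _); last by move=> g h _ _ /(act_inj act).
  move=> g Eg; split; last by exists g.
  have [n gn] := wball_ex genS g; apply: (nearby_conn (d := n)).
  by apply/(nearby_ball act sch); exists g.
have [||||h|h] := one_ended_cut GT locfin oneend (x := x0) (finite_image _ finF : finite_set (im F))
    (A := im A) (B := im B).
- move=> y /(conn_orbit act sch)[g ->]; have [Fg|[Ag|Bg]] := cov g.
  + by left; exists g.
  + by right; left; exists g.
  + by right; right; exists g.
- apply/seteqP; split=> // _ [[g Ag <-] /imE Bg].
  by have : set0 g by rewrite -dis.
- exact: cl.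
- exact: cl.
- by left; apply: back.
- by right; apply: back.
Qed.

Lemma act_wball_quadratic n : n.+1 * n.+2 <= 2 * size (wball S n).
Proof. exact: (wball_quadratic (genS := genS) act_len_ex act_cut). Qed.

End OneEndedGroup.

(** * Folner sets *)

Section Hall.
Local Open Scope set_scope.
Variables (I T : finType) (t0 : T).
Local Open Scope nat_scope.
Implicit Types (N : I -> {set T}) (J A B : {set I}).

Let bigcup_setDr N A (B : {set T}) :
  \bigcup_(i in A) (N i :\: B) = (\bigcup_(i in A) N i) :\: B.
Proof.
apply/setP => t; rewrite inE; apply/bigcupP/andP => [[i iA]|[tB /bigcupP[i iA ti]]].
  by rewrite inE => /andP[tB ti]; split=> //; apply/bigcupP; exists i.
by exists i => //; rewrite inE tB.
Qed.

(** Induction on the size of [J]: a nonempty proper subset with as few neighbours as elements is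
    matched separately from the rest; when there is none, any index can be matched arbitrarily. *)
Lemma hall_marriage N J :
  (forall A, A \subset J -> #|A| <= #|\bigcup_(i in A) N i|) ->
  exists f : I -> T, {in J, forall i, f i \in N i} /\ {in J &, injective f}.
Proof.
have [k] := ubnP #|J|; elim: k => // k IH in J N *; rewrite ltnS => Jk hall.
have [->|[i0 i0J]] := set_0Vmem J.
  by exists (fun=> t0); split=> i; rewrite inE.
case: (pselect (exists A, [/\ A \proper J, A != finset.set0 & #|\bigcup_(i in A) N i| <= #|A|])).
  move=> [A [AJ A0 tight]]; set B := \bigcup_(i in A) N i in tight.
  have AsJ := proper_sub AJ.
  have [||f1 [f1N f1i]] := IH A N.
  - exact: leq_trans (proper_card AJ) Jk.
  - by move=> C CA; apply: hall; apply: fintype.subset_trans CA AsJ.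
  have [||f2 [f2N f2i]] := IH (J :\: A) (fun i => N i :\: B).
  - have := cardsID A J; rewrite (finset.setIidPr AsJ) => e.
    by have : 0 < #|A| by [rewrite card_gt0]; lia.
  - move=> C CJ; rewrite bigcup_setDr.
    have dis : A :&: C = finset.set0.
      apply/setP => i; rewrite !inE; apply/negP => /andP[iA /(fintype.subsetP CJ)].
      by rewrite inE iA.
    have := hall (A :|: C); rewrite finset.subUset AsJ (fintype.subset_trans CJ (finset.subsetDl _ _)) => /(_ isT).
    rewrite cardsU dis cards0 subn0 finset.bigcup_setU -/B => h.
    have := cardsID B (\bigcup_(i in C) N i).
    rewrite cardsU in h; have := subset_leq_card (finset.subsetIr B (\bigcup_(i in C) N i)).
    by rewrite [_ :&: B]finset.setIC; lia.
  exists (fun i => if i \in A then f1 i else f2 i); split=> [i iJ|i j iJ jJ].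
    case: ifP => [|iA]; first exact: f1N.
    by have := f2N i; rewrite !inE iA iJ => /(_ isT)/andP[].
  have inB l : l \in A -> f1 l \in B by move=> lA; apply/bigcupP; exists l => //; apply: f1N.
  have ninB l : l \in J -> l \in A = false -> f2 l \notin B.
    by move=> lJ lA; have := f2N l; rewrite !inE lA lJ => /(_ isT)/andP[].
  case: ifP => iA; case: ifP => jA e.
  - exact: f1i.
  - by have := ninB j jJ jA; rewrite -e inB.
  - by have := ninB i iJ iA; rewrite e inB.
  - by apply: f2i; rewrite ?inE ?iA ?jA.
move=> ntight.
have strict A : A \proper J -> A != finset.set0 -> #|A| < #|\bigcup_(i in A) N i|.
  by move=> AJ A0; rewrite ltnNge; apply/negP => h; apply: ntight; exists A.
have [t tN] : exists t, t \in N i0.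
  have := hall (finset.set1 i0); rewrite finset.sub1set i0J big_set1 cards1 => /(_ isT).
  by rewrite card_gt0 => /finset.set0Pn.
have [||f [fN fi]] := IH (J :\ i0) (fun i => N i :\: finset.set1 t).
- by apply: leq_trans Jk; rewrite [leqRHS](cardsD1 i0) i0J.
- move=> A AJ; rewrite bigcup_setDr; have [->|A0] := eqVneq A finset.set0; first by rewrite cards0.
  have := strict A; rewrite A0 (sub_proper_trans AJ) ?properD1 // => /(_ isT isT).
  by rewrite (cardsD1 t); case: (t \in _); lia.
exists (fun i => if i == i0 then t else f i); split=> [i iJ|i j iJ jJ].
  case: eqP => [->//|/eqP ne]; by have := fN i; rewrite !inE ne iJ => /(_ isT)/andP[].
have nt k' : k' \in J -> k' != i0 -> f k' != t.
  by move=> kJ ne; have := fN k'; rewrite !inE ne kJ => /(_ isT)/andP[].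
case: eqP => [->|/eqP ni]; case: eqP => [->//|/eqP nj] e.
- by have := nt j jJ nj; rewrite -e eqxx.
- by have := nt i iJ ni; rewrite e eqxx.
- by apply: fi; rewrite ?inE ?ni ?nj.
Qed.

End Hall.

Section Folner.
Variables (Gam : groupType) (S : seq Gam).
Hypothesis genS : generates S.
Variable R : realType.
Hypothesis am : amenable Gam R.
Implicit Types (g h : Gam) (F : seq Gam).
Local Open Scope group_scope.

Local Notation len := (len genS).
Local Notation wball := (wball S).
Local Notation cay := (cay S).

Definition thicken n F : seq Gam := undup [seq b * g | b <- wball n, g <- F].

Lemma mem_thicken n F h : h \in thicken n F <-> exists2 g, g \in F & h * g^-1 \in wball n.
Proof.
rewrite mem_undup; split=> [/allpairsP[[b g] /= [bn gF ->]]|[g gF hg]].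
  by exists g; rewrite ?mulgK.
by apply/allpairsP; exists (h * g^-1, g); rewrite /= mulgVK.
Qed.

Lemma thicken_sub n F : {subset F <= thicken n F}.
Proof. by move=> g gF; apply/mem_thicken; exists g; rewrite ?mulgV ?wball1. Qed.

Lemma thickenD m n F : {subset thicken m (thicken n F) <= thicken (m + n) F}.
Proof.
move=> h /mem_thicken[k /mem_thicken[g gF kg] hk]; apply/mem_thicken; exists g => //.
by have := wballM hk kg; rewrite mulgA mulgVK.
Qed.

Lemma size_thicken n F : size (thicken n F) <= size (wball n) * size F.
Proof. by apply: leq_trans (size_undup _) _; rewrite size_allpairs. Qed.

(** Hall's theorem gives an injection of two copies of each ball, with displacements in [wball n].
    As displacements range over a finite set, these injections converge along an ultrafilter. *)
Lemma hall_displacement n : (forall F, uniq F -> 2 * size F <= size (thicken n F)) ->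
  exists d : Gam * bool -> Gam, (forall p, d p \in wball n) /\
    injective (fun p => d p * p.1).
Proof.
move=> big.
have /choice[f hf] (k : nat) : exists f : Gam * bool -> Gam,
    (forall p, p.1 \in wball k -> f p \in wball n) /\
    forall p p', p.1 \in wball k -> p'.1 \in wball k -> f p * p.1 = f p' * p'.1 -> p = p'.
  pose I := (seq_sub (wball k) * bool)%type; pose T := seq_sub (wball (n + k)).
  pose N (i : I) : {set T} := [set t | val t * (val i.1)^-1 \in wball n]%SET.
  have t0 : T := SeqSub (wball1 S (n + k)).
  have [|f [fN fi]] := @hall_marriage I T t0 N [set: I]%SET.
    move=> A _; pose E := [set p.1 | p in A]%SET.
    have AE : #|A| <= #|E| * 2.
      rewrite -card_bool -cardX; apply: subset_leq_card; apply/fintype.subsetP => -[i b] iA.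
      by rewrite !inE /= ?andbT; apply/imsetP; exists (i, b).
    apply: leq_trans AE _; set F := [seq val i | i <- enum E].
    have sF : size F = #|E| by rewrite size_map -cardE.
    rewrite -sF mulnC; apply: leq_trans (big F _) _.
      by rewrite map_inj_uniq ?enum_uniq //; apply: val_inj.
    rewrite cardE -(size_map val); apply: uniq_leq_size; first exact: undup_uniq.
    move=> h /mem_thicken[_ /mapP[i + ->] hi]; rewrite mem_enum => /imsetP[p pA ip].
    have hT : h \in wball (n + k) by rewrite -[h](mulgVK (val i)); apply: wballM => //; exact: valP.
    apply/mapP; exists (SeqSub hT) => //; rewrite mem_enum; apply/finset.bigcupP.
    by exists p => //; rewrite inE /= -ip.
  exists (fun p => if insub p.1 is Some i then val (f (i, p.2)) * (val i)^-1 else 1).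
  split=> [[g b] /= gk|[g b] [g' b'] /= gk gk'].
    rewrite insubT /=; have := fN (SeqSub gk, b); rewrite !inE => /(_ isT) /=.
    by [].
  rewrite !insubT /= !mulgVK => /val_inj /fi; rewrite !inE => /(_ isT isT)[-> ->].
  by [].
have [F [uF subF]] := ultraFilterLemma (eventually_filter : ProperFilter \oo).
have big_k g : F [set k | g \in wball k].
  by apply: subF; exists (len g) => // k /= gk; rewrite -(len_leq genS).
have /choice[d hd] (p : Gam * bool) : exists d, d \in wball n /\ F [set k | f k p = d].
  have [|d dn Fd] := @ultra_bigU _ _ uF _ (wball n) (fun d => [set k | f k p = d]) _ (big_k p.1).
    by move=> k pk; exists (f k p) => //; apply: (hf k).1.
  by exists d.
exists d; split=> [p|p p' e]; first exact: (hd p).1.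
have [k [[e1 e2] [k1 k2]]] := filter_ex (filterI (filterI (hd p).2 (hd p').2)
  (filterI (big_k p.1) (big_k p'.1))).
by apply: (hf k).2 => //; rewrite e1 e2.
Qed.

Lemma mean_bigU (m : set Gam -> R) : (forall A B, A `&` B = set0 -> m (A `|` B) = (m A + m B)%R) ->
  forall (I : eqType) (s : seq I) (A : I -> set Gam), uniq s ->
  (forall i j g, A i g -> A j g -> i = j) ->
  m [set g | exists2 i, i \in s & A i g] = (\sum_(i <- s) m (A i))%R.
Proof.
move=> mU I s A us dis.
have m0 : m set0 = 0%R.
  by have := mU set0 set0; rewrite setI0 setU0 => /(_ erefl) h; apply: (addrI (m set0)); rewrite addr0.
elim: s us => [_|i s IH /= /andP[is_ us]].
  by rewrite big_nil -m0; congr m; apply/seteqP; split=> // g [].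
rewrite big_cons -IH // -mU; last first.
  by apply/seteqP; split=> // g [Ag [j js Aj]]; move: is_; rewrite (dis _ _ _ Ag Aj) js.
congr m; apply/seteqP; split=> g.
  by move=> [j]; rewrite inE => /orP[/eqP -> Ag|js Ag]; [left|right; exists j].
by move=> [Ag|[j js Ag]]; [exists i; rewrite ?mem_head|exists j; rewrite // inE js orbT].
Qed.

(** Sorting the two copies of the group by displacement gives a paradoxical decomposition: the
    translated parts are disjoint, yet their total mean is 2. *)
Lemma no_paradox n (d : Gam * bool -> Gam) : (forall p, d p \in wball n) ->
  injective (fun p => d p * p.1) -> False.
Proof.
move=> dn inj; have [m [m1 m_ge0 mU minv]] := am.
pose A b h : set Gam := [set g | d (g, b) = h].
have sumA b : (\sum_(h <- wball n) m (A b h) = 1)%R.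
  rewrite -(mean_bigU mU); [|exact: uniq_wball|by move=> i j g /= <- <-].
  rewrite -m1; congr m; apply/seteqP; split=> // g _; by exists (d (g, b)).
pose C (p : bool * Gam) : set Gam := [set p.2 * g | g in A p.1 p.2].
have sumC b : (\sum_(h <- wball n) m (C (b, h)) = 1)%R.
  by rewrite -(sumA b); apply: eq_bigr => h _; apply: minv.
pose s := [seq (b, h) | b <- [:: true; false], h <- wball n].
have us : uniq s.
  by apply: allpairs_uniq; [|exact: uniq_wball|move=> [? ?] [? ?] _ _ /= [-> ->]].
have dis p p' g : C p g -> C p' g -> p = p'.
  case: p p' => [b h'] [b' h''] [g1 /= Ag <-] [g2 /= Ag' e].
  have := inj (g1, b) (g2, b'); rewrite /= Ag Ag' e => /(_ erefl)[eg eb].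
  by rewrite -Ag -Ag' eg eb.
have h : (m [set g | exists2 i, i \in s & C i g] = 1 + 1)%R.
  by rewrite (mean_bigU mU us dis) big_allpairs_dep /= big_cons big_seq1 !sumC.
set E := (X in m X) in h.
have := mU E (~` E); rewrite setICr setUCr => /(_ erefl); rewrite m1 h => e.
have := m_ge0 (~` E); lra.
Qed.

Lemma amenable_thicken n : exists F, uniq F /\ size (thicken n F) < 2 * size F.
Proof.
apply: contrapT => nex; have [|d [dn inj]] := @hall_displacement n; last exact: no_paradox dn inj.
by move=> F uF; rewrite leqNgt; apply/negP => h; apply: nex; exists F.
Qed.

Definition bdry F := [seq g <- F | `[< exists2 h, cay g h & h \notin F >]].

Lemma cay_wball g h : cay g h -> h * g^-1 \in wball 1.
Proof.
move=> [_ hg]; apply/wballP; exists [:: index (h * g^-1) (letters S)] => //=.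
by rewrite /letter nth_index // mulg1.
Qed.

(** If each of the first [n] successive thickenings of [F] grew by a proportion more than [1 / n],
    the size would double. A thickening that grows less has its inner boundary among the points just
    added. *)
Lemma folner_exists n : exists F, [/\ uniq F, F != [::] & n * size (bdry F) <= size F].
Proof.
have [F [uF small]] := amenable_thicken n.
have F0 : F != [::] by apply/eqP => F0; move: small; rewrite F0 muln0.
have mono j : {subset thicken j F <= thicken j.+1 F}.
  move=> h /mem_thicken[g gF hg]; apply/mem_thicken; exists g => //.
  exact: wballS.
case: n => [|n] in small *; first by exists F; rewrite mul0n.
have [j jn hj] : exists2 j, j < n.+1 &
    n.+1 * (size (thicken j.+1 F) - size (thicken j F)) <= size (thicken j.+1 F).
  apply: contrapT => nex.
  have sF j : size F <= size (thicken j F) by apply: uniq_leq_size => //; apply: thicken_sub.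
  have grow k : k <= n.+1 -> n.+1 * size F + k * size F <= n.+1 * size (thicken k F).
    elim: k => [_|k IH kn]; first by rewrite addn0 leq_mul2l sF orbT.
    have h1 := IH (ltnW kn); have h2 : size (thicken k F) <= size (thicken k.+1 F).
      by apply: uniq_leq_size; [exact: undup_uniq|exact: mono].
    have h3 : size (thicken k.+1 F) < n.+1 * (size (thicken k.+1 F) - size (thicken k F)).
      by rewrite ltnNge; apply/negP => h; apply: nex; exists k.
    rewrite mulnBr in h3; have := sF k.+1; have : n.+1 * size (thicken k F) <= n.+1 * size (thicken k.+1 F).
      by rewrite leq_mul2l h2 orbT.
    by rewrite mulSn; lia.
  have := grow n.+1 (leqnn _); rewrite -mulnDr leq_mul2l /= addnn -mul2n leqNgt.
  by rewrite small.
exists (thicken j.+1 F); split; first exact: undup_uniq.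
  case: F F0 {uF small hj mono} => // g F _; have : g \in thicken j.+1 (g :: F).
    by apply: thicken_sub; apply: mem_head.
  by case: (thicken _ _).
apply: leq_trans hj; rewrite leq_mul2l; apply/orP; right.
rewrite -(leq_add2r (size (thicken j F))) subnK; last first.
  by apply: uniq_leq_size; [exact: undup_uniq|exact: mono].
rewrite -size_cat; apply: uniq_leq_size; last first.
  move=> g; rewrite mem_cat mem_filter => /orP[/andP[]//|]; exact: mono.
rewrite cat_uniq filter_uniq ?undup_uniq //= andbT; apply/hasPn => g gj.
rewrite mem_filter negb_and; apply/orP; left; apply/asboolP => -[h gh hn].
move/negP: hn; apply; rewrite -add1n; apply: thickenD; apply/mem_thicken; exists g => //.
exact: cay_wball.
Qed.

(** Take such a set of least size. Sizes and boundaries add up over a splitting without edges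
    across, so if the set were disconnected one of the two parts would do as well. *)
Lemma connected_folner n : exists F, [/\ uniq F, F != [::], n * size (bdry F) <= size F &
  {in F &, forall g h, conn cay [set` F] g h}].
Proof.
pose Q k := exists F, [/\ uniq F, F != [::], n * size (bdry F) <= size F & size F = k].
have [F0 [u0 ne0 b0]] := folner_exists n.
have [k [[F [uF neF bF Fk]] least]] := @least_ex Q (size F0) (ex_intro _ F0 (And4 u0 ne0 b0 erefl)).
exists F; split=> //.
have [x xF] : exists x, x \in F by case: F neF {uF bF Fk} => // x F _; exists x; apply: mem_head.
pose c : pred Gam := fun g => `[< conn cay [set` F] x g >].
have cadj g h : cay g h -> g \in F -> h \in F -> c g = c h.
  move=> gh gF hF; apply/asboolP/asboolP => xg.
    by apply: conn_trans xg (conn_edge _ _ gh).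
  by apply: conn_trans xg (conn_edge _ _ (cay_sym gh)).
have bdry_part (P : pred Gam) : (forall g h, cay g h -> g \in F -> h \in F -> P g = P h) ->
    bdry (seq.filter P F) = seq.filter P (bdry F).
  move=> Padj; rewrite /bdry -!filter_predI; apply: eq_in_filter => g gF /=.
  rewrite andbC; case Pg : (P g) => //=.
  apply/asboolP/asboolP => -[h gh hn]; exists h => //.
    by apply/negP => hF; move: hn; rewrite mem_filter hF -(Padj _ _ gh) // Pg.
  by rewrite mem_filter negb_and hn orbT.
have b1 := bdry_part c cadj; have b2 : bdry (seq.filter (predC c) F) = seq.filter (predC c) (bdry F).
  by apply: bdry_part => g h gh gF hF /=; rewrite (cadj g h).
have szF := count_predC c F; have szb := count_predC c (bdry F).
rewrite -!size_filter in szF szb; rewrite -b1 -b2 in szb.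
have c_x : c x by apply/asboolP; apply: conn_refl.
have [all_c|nc] := boolP (all c F).
  move=> g h /(allP all_c)/asboolP xg /(allP all_c)/asboolP xh.
  exact: conn_trans (conn_sym (@cay_sym _ _) xg) xh.
have f1 : 0 < size (seq.filter c F) by rewrite size_filter -has_count; apply/hasP; exists x.
have f2 : 0 < size (seq.filter (predC c) F) by rewrite size_filter -has_count has_predC.
have [h|h] := leqP (n * size (bdry (seq.filter c F))) (size (seq.filter c F)).
  have [] := least (size (seq.filter c F)); first by rewrite -Fk; lia.
  exists (seq.filter c F); split=> //; first exact: filter_uniq.
  by rewrite -size_eq0 -lt0n.
have [] := least (size (seq.filter (predC c) F)); first by rewrite -Fk; lia.
exists (seq.filter (predC c) F); split=> //; first exact: filter_uniq.
  by rewrite -size_eq0 -lt0n.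
by move: bF; rewrite -szF -szb mulnDr; lia.
Qed.

End Folner.

(** * Thin rings in Folner sets *)

Section ThinTemplate.
Variables (Gam : groupType) (S : seq Gam).
Hypothesis genS : generates S.
Implicit Types (g h x y : Gam) (F N R : seq Gam).
Local Open Scope group_scope.

Local Notation len := (len genS).
Local Notation wball := (wball S).
Local Notation cay := (cay S).
Local Notation thicken := (thicken S).
Local Notation bdry := (bdry S).
Local Notation ev := (ev S).

Lemma thicken_bdry n F : {subset thicken n F <= F ++ thicken n (bdry F)}.
Proof.
move=> h /mem_thicken[g gF /wballP[w wn ew]]; have -> : h = ev w * g by rewrite ew mulgVK.
rewrite mem_cat; case: (boolP (_ \in F)) => //= hF.
apply/mem_thicken; elim: w n wn hF {ew} => [|i w IH] n /=; first by rewrite mul1g gF.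
case: n => // n; rewrite ltnS -mulgA => wn hF.
case: (boolP (ev w * g \in F)) => [wF|/(IH n wn)[k kb wk]]; last first.
  exists k => //; rewrite -mulgA -add1n; apply: wballM => //.
  by apply/wballP; exists [:: i] => //=; rewrite mulg1.
exists (ev w * g); last first.
  rewrite mulgK -add1n; apply: (wball_leq (leq_addr n 1)).
  by apply/wballP; exists [:: i] => //=; rewrite mulg1.
rewrite mem_filter wF andbT; apply/asboolP; exists (letter S i * (ev w * g)) => //.
case: (letter_or S i) => [il|e]; last by move: hF; rewrite e mul1g wF.
by case: (cay_letter (ev w * g) il) => // e; move: hF; rewrite -e wF.
Qed.

Definition path_seq w x : seq Gam := [seq ev (drop k w) * x | k <- iota 0 (size w).+1].

Lemma mem_path_seq w x z : z \in path_seq w x <-> track S w x z.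
Proof.
split=> [/mapP[k + ->]|[k kw ->]]; first by rewrite mem_iota => /andP[_ kw]; exists k.
by apply/mapP; exists k => //; rewrite mem_iota.
Qed.

Lemma conn_path_seq w x z : z \in path_seq w x -> conn cay [set` path_seq w x] z x.
Proof.
move=> /mem_path_seq[k kw ->]; apply: conn_sub (conn_track S (drop k w) x) => y.
move=> [j + ->]; rewrite size_drop drop_drop => jk; apply/mem_path_seq; exists (j + k) => //.
by lia.
Qed.

Lemma path_seq_top w x : ev w * x \in path_seq w x.
Proof. by apply/mem_path_seq; exists 0; rewrite ?drop0. Qed.

Lemma size_path_seq w x : size (path_seq w x) = (size w).+1.
Proof. by rewrite size_map size_iota. Qed.

Definition conn_seq R := {in R &, forall g h, conn cay [set` R] g h}.

Lemma conn_seq_attach R (ps : seq (seq nat * Gam)) : conn_seq R ->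
  (forall p, p \in ps -> p.2 \in R \/ ev p.1 * p.2 \in R) ->
  conn_seq (R ++ flatten [seq path_seq p.1 p.2 | p <- ps]).
Proof.
move=> cR psR; set R' := R ++ _.
have RR' : {subset R <= R'} by move=> g gR; rewrite mem_cat gR.
have toR g : g \in R' -> exists2 h, h \in R & conn cay [set` R'] g h.
  rewrite mem_cat => /orP[gR|/flatten_mapP[p pps gp]].
    by exists g => //; apply: conn_refl; apply: RR'.
  have sub : [set` path_seq p.1 p.2] `<=` [set` R'].
    by move=> z zp; rewrite /= mem_cat; apply/orP; right; apply/flatten_mapP; exists p.
  case: (psR p pps) => pR; first by exists p.2 => //; exact: conn_sub sub (conn_path_seq gp).
  exists (ev p.1 * p.2) => //; apply: (conn_sub sub).
  apply: conn_trans (conn_path_seq gp) _; apply: (conn_sym (@cay_sym Gam S)).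
  exact: conn_path_seq (path_seq_top _ _).
move=> g h /toR[g' g'R gg'] /toR[h' h'R hh'].
apply: conn_trans gg' _; apply: conn_trans (conn_sym (@cay_sym _ _) hh').
by apply: conn_sub (cR _ _ g'R h'R) => z; apply: RR'.
Qed.

Definition spread r N := forall x y, x \in N -> y \in N -> y * x^-1 \in wball r -> x = y.

(** Packing: the balls of radius [r] around the points of [N] are disjoint. *)
Lemma spread_size r N F : uniq N -> {subset N <= F} -> spread (r + r) N ->
  size N * size (wball r) <= size (thicken r F).
Proof.
move=> uN NF sN; rewrite -(size_allpairs (fun x b => b * x)); apply: uniq_leq_size.
  apply: allpairs_uniq => //; first exact: uniq_wball.
  move=> [x b] [y c] /allpairsP[[x' b'] [/= xN bB [-> ->]]] /allpairsP[[y' c'] [/= yN cB [-> ->]]] /= e.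
  have xy : x' = y'.
    apply: sN => //; have -> : y' * x'^-1 = c'^-1 * b'.
      by apply: (mulgI c'); rewrite mulVKg mulgA -e mulgK.
    by apply: wballM => //; apply: wballV.
  by move: e; rewrite xy => /mulIg ->.
move=> _ /allpairsP[[x b] [/= /NF xF bB ->]]; apply/mem_thicken; exists x => //.
by rewrite mulgK.
Qed.

(** The net is grown along the connected set [F]: a vertex of [F] just outside the [r]-neighbourhood
    of [N] is at distance [r.+1] from [N], and the path attaching it has [r.+2] vertices. *)
Lemma connected_net r F x0 : x0 \in F -> conn_seq F -> exists N R,
  [/\ uniq N, {subset N <= F}, spread r N,
      forall f, f \in F -> exists2 x, x \in N & f * x^-1 \in wball r &
      [/\ {subset N <= R}, conn_seq R & size R <= r.+2 * size N]].
Proof.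
move=> x0F cF.
pose good N R := [/\ uniq N, {subset N <= F}, spread r N, x0 \in N &
      [/\ {subset N <= R}, conn_seq R & size R <= r.+2 * size N]].
pose dense N := forall f, f \in F -> exists2 x, x \in N & f * x^-1 \in wball r.
have step k : (exists N R, good N R /\ dense N) \/ exists N R, good N R /\ size N = k.+1.
  elim: k => [|k [IH|[N [R [[uN NF sN x0N [NR cR szR]] Nk]]]]]; [right| by left|].
    exists [:: x0], [:: x0]; split=> //; split=> //.
    - by move=> x; rewrite inE => /eqP ->.
    - by move=> x y; rewrite !inE => /eqP -> /eqP ->.
    - by rewrite mem_head.
    - split=> //.
      by move=> x y; rewrite !inE => /eqP -> /eqP ->; apply: conn_refl; rewrite /= mem_head.
  case: (pselect (dense N)) => [dN|/existsNP[f /not_implyP[fF nf]]].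
    by left; exists N, R; split=> //; split.
  right; pose D := [set g | g \in F /\ exists2 x, x \in N & g * x^-1 \in wball r].
  have [u [v [Du vF uv nv]]] : exists u v, [/\ D u, v \in F, cay u v & ~ D v].
    apply: contrapT => nex.
    apply: nf; suff [] : D f by [].
    apply: (@conn_closed _ cay [set` F] D x0 f) (cF _ _ x0F fF).
      move=> u v Du vF uv; apply: contrapT => nv; apply: nex; by exists u, v.
    by split=> //; exists x0; rewrite ?mulgV ?wball1.
  have [_ [y yN uy]] := Du.
  have vy : v * y^-1 \in wball r.+1.
    by have := wballM (cay_wball uv) uy; rewrite mulgA mulgVK add1n.
  have /wballP[w wr ew] := vy.
  have evw : ev w * y = v by rewrite ew mulgVK.
  have nvN x : x \in N -> v * x^-1 \notin wball r.
    by move=> xN; apply/negP => h; apply: nv; split=> //; exists x.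
  exists (v :: N), (R ++ flatten [seq path_seq p.1 p.2 | p <- [:: (w, y)]]).
  split; last by rewrite /= Nk.
  split.
  - rewrite /= uN andbT; apply/negP => vN; move: (nvN _ vN); by rewrite mulgV wball1.
  - by move=> x; rewrite inE => /orP[/eqP ->//|]; apply: NF.
  - move=> x z; rewrite !inE => /orP[/eqP ->|xN] /orP[/eqP ->|zN] //; last exact: sN.
      move=> /wballV; rewrite invgM invgK => h; by have := nvN _ zN; rewrite h.
    by move=> h; have := nvN _ xN; rewrite h.
  - by rewrite inE x0N orbT.
  - rewrite /= cats0; split.
    + move=> x; rewrite inE mem_cat => /orP[/eqP ->|/NR ->//].
      by rewrite -evw path_seq_top orbT.
    + have := @conn_seq_attach R [:: (w, y)] cR; rewrite /= cats0; apply => p.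
      by rewrite inE => /eqP -> /=; left; apply: NR.
    + by rewrite size_cat size_path_seq /= mulnS; lia.
have [[N [R [[? ? ? ? ?] ?]]]|[N [R [[uN NF _ _ _] Nk]]]] := step (size F); first by exists N, R.
by have := uniq_leq_size uN NF; rewrite Nk ltnn.
Qed.

Hypothesis quad : forall n, n.+1 * n.+2 <= 2 * size (wball n).
Variable K : realType.
Hypothesis am : amenable Gam K.

(** The ring is a connected set carrying a net of a Folner set [F], with paths from the net to every
    boundary vertex of [F]. The first part is small because the net has at most [2 * |F| / |B(r)|]
    points, the second because the boundary is small. *)
Lemma thin_template s : exists F P R, [/\ uniq F, F != [::], {subset F <= P},
  group_template S P R & 16 * size (thicken s R) <= size F].
Proof.
(* Since [|B(r)|] is at least [r.+1 * r.+2 / 2], the factor 256 gives [4 * k <= |B(r)|]; then the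
   net and the boundary of [F] both have at most [|F| / (2 * k)] points. The ring has at most
   [2 * r + 2] vertices for each of them, and [k] includes the factor [16 * gs] lost by
   thickening. *)
set gs := size (wball s); pose r := (256 * gs)%N.
pose k := (16 * gs * (2 * r + 2))%N.
have [F [uF neF bF cF]] := connected_folner genS am (size (wball r) + 2 * k).
have [x0 x0F] : exists x, x \in F.
  by case: F neF {uF bF cF} => // x F _; exists x; apply: mem_head.
have [N [R [uN NF sN dN [NR cR szR]]]] := @connected_net (r + r) F x0 x0F cF.
have szN : size N * size (wball r) <= 2 * size F.
  apply: leq_trans (spread_size uN NF sN) _.
  have : size (thicken r F) <= size (F ++ thicken r (bdry F)).
    by apply: uniq_leq_size; [exact: undup_uniq|exact: thicken_bdry].
  rewrite size_cat; have := size_thicken S r (bdry F).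
  by move: bF; rewrite mulnDl; lia.
have /choice[lk lkP] f : exists p : seq nat * Gam, f \in F ->
    [/\ p.2 \in N, size p.1 <= r + r & ev p.1 * p.2 = f].
  case: (boolP (f \in F)) => [/dN[x xN /wballP[w wr ew]]|_]; last by exists ([::], x0).
  by exists (w, x) => _; split=> //=; rewrite ew mulgVK.
have bF' : {subset bdry F <= F} by move=> f; rewrite mem_filter => /andP[].
set ps := [seq lk f | f <- bdry F].
pose R2 := R ++ flatten [seq path_seq p.1 p.2 | p <- ps].
have szR2 : size R2 <= (r + r).+2 * size N + (r + r).+1 * size (bdry F).
  rewrite size_cat leq_add // size_flatten sumnE !big_map.
  apply: leq_trans (_ : \sum_(f <- bdry F) (r + r).+1 <= _); last by rewrite big_const_seq count_predT iter_addn_0.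
  rewrite big_seq [leqRHS]big_seq; apply: leq_sum => f /bF' /lkP[_ sz _].
  by rewrite size_path_seq.
have bR2 : {subset bdry F <= R2}.
  move=> f fb; have [_ _ <-] := lkP f (bF' f fb).
  rewrite mem_cat; apply/orP; right; apply/flatten_mapP; exists (lk f); last exact: path_seq_top.
  exact: map_f.
exists F, (F ++ R2), R2; split=> //.
- by move=> g gF; rewrite mem_cat gF.
- split.
  + by move=> g gR; rewrite mem_cat gR orbT.
  + apply: conn_seq_attach cR _ => _ /mapP[f /bF' /lkP[h _ _] ->].
    by left; apply: NR.
  + move=> g h; rewrite mem_cat => /orP[gF|->//] ng gh; rewrite mem_cat.
    case: (boolP (h \in F)) => // hF; move/negP: ng; case; apply: bR2.
    by rewrite mem_filter gF andbT; apply/asboolP; exists h.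
- apply: leq_trans (_ : 16 * (gs * size R2) <= _); first by rewrite leq_mul2l size_thicken orbT.
  have big : 4 * k <= size (wball r).
    have := quad r; have : (r.+1) * (256 * gs) <= r.+1 * r.+2.
      by rewrite leq_mul2l /r; lia.
    by rewrite /k; nia.
  have h1 : 2 * (k * size N) <= size F.
    have : size N * (4 * k) <= size N * size (wball r) by rewrite leq_mul2l big orbT.
    by nia.
  have h2 : 2 * (k * size (bdry F)) <= size F.
    by apply: leq_trans bF; nia.
  have : 16 * (gs * size R2) <= 16 * (gs * ((r + r).+2 * size N + (r + r).+1 * size (bdry F))).
    by rewrite !leq_mul2l szR2 orbT.
  have : 16 * (gs * ((r + r).+2 * size N + (r + r).+1 * size (bdry F))) <=
      k * size N + k * size (bdry F).
    by rewrite /k; nia.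
  by lia.
Qed.

End ThinTemplate.

Lemma borel_ex_seq (X : topologicalType) (I : eqType) (s : seq I) (A : I -> X -> Prop) :
  (forall i, borel [set x | A i x]) -> borel [set x | exists2 i, i \in s & A i x].
Proof.
move=> bA; elim: s => [|i s IH].
  by apply: borel_eqP (@borel_cst X False) => x; split=> // -[].
apply: borel_eqP (borel_or (bA i) IH) => x; split=> [[Ax|[j js Ax]]|[j]].
- by exists i => //; apply: mem_head.
- by exists j => //; rewrite inE js orbT.
- by rewrite inE => /orP[/eqP -> Ax|js Ax]; [left|right; exists j].
Qed.

(** * Amenable groups *)

Section Content.
Variables (R : realType) (X : topologicalType).
Implicit Types (A B M : set X) (m : set X -> R).
Local Open Scope ring_scope.

(* [m] may take junk values outside the Borel sets. *)
Record borel_content m : Prop := Content {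
  content_ge0 : forall A, borel A -> 0 <= m A;
  contentU : forall A B, borel A -> borel B -> A `&` B = set0 -> m (A `|` B) = m A + m B;
  content_cont : forall A : nat -> set X, (forall n, borel (A n)) ->
    (forall n, A n `<=` A n.+1) -> (forall x, exists n, A n x) ->
    forall e, 0 < e -> exists n, m setT <= m (A n) + e }.

Variable m : set X -> R.
Hypothesis mc : borel_content m.

Let borel0 : borel (@set0 X). Proof. exact: borel_cst. Qed.
Let borelT : borel [set: X]. Proof. exact: borel_cst. Qed.

Lemma content0 : m set0 = 0.
Proof.
have := contentU mc borel0 borel0; rewrite setI0 setU0 => /(_ erefl) h.
by apply: (addrI (m set0)); rewrite addr0.
Qed.

Lemma content_split A B : borel A -> borel B -> m A = m (A `&` B) + m (A `\` B).
Proof.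
move=> bA bB; rewrite -(contentU mc).
- congr m; apply/seteqP; split=> [x Ax|x [[]|[]]//].
  by case: (pselect (B x)) => Bx; [left|right].
- exact: borel_and.
- by apply: borel_and => //; apply: borel_not.
- by apply/seteqP; split=> // x [[_ Bx] [_ nB]].
Qed.

Lemma content_mono A B : borel A -> borel B -> A `<=` B -> m A <= m B.
Proof.
move=> bA bB AB; rewrite (content_split bB bA) (setIidr AB) lerDl.
by apply: (content_ge0 mc) => //; apply: borel_and => //; apply: borel_not.
Qed.

Lemma content_setU_le A B : borel A -> borel B -> m (A `|` B) <= m A + m B.
Proof.
move=> bA bB; have bD : borel (B `\` A) by apply: borel_and => //; apply: borel_not.
have -> : A `|` B = A `|` (B `\` A).
  apply/seteqP; split=> x; case: (pselect (A x)) => nA; [by left| |by left|by case=> // -[]; right].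
  by case=> // Bx; right.
rewrite (contentU mc) //; last by apply/seteqP; split=> // x [? []].
by rewrite lerD2l content_mono // => x [].
Qed.

Lemma content_bigU (I : eqType) (s : seq I) (A : I -> set X) : uniq s ->
  (forall i, borel (A i)) -> (forall i j x, A i x -> A j x -> i = j) ->
  m [set x | exists2 i, i \in s & A i x] = \sum_(i <- s) m (A i).
Proof.
move=> us bA dis; elim: s us => [_|i s IH /= /andP[is_ us]].
  by rewrite big_nil -content0; congr m; apply/seteqP; split=> // x [].
have bU : borel [set x | exists2 j, j \in s & A j x] by exact: borel_ex_seq.
rewrite big_cons -IH // -(contentU mc) //; last first.
  by apply/seteqP; split=> // x [Ax [j js Aj]]; move: is_; rewrite (dis _ _ _ Ax Aj) js.
congr m; apply/seteqP; split=> x.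
  by move=> [j]; rewrite inE => /orP[/eqP -> Ax|js Ax]; [left|right; exists j].
by move=> [Ax|[j js Ax]]; [exists i; rewrite ?mem_head|exists j; rewrite // inE js orbT].
Qed.

Lemma content_bigU_le (I : eqType) (s : seq I) (A : I -> set X) : (forall i, borel (A i)) ->
  m [set x | exists2 i, i \in s & A i x] <= \sum_(i <- s) m (A i).
Proof.
move=> bA; elim: s => [|i s IH].
  by rewrite big_nil -content0 le_eqVlt; apply/orP; left; apply/eqP; congr m; apply/seteqP; split=> // x [].
have bU : borel [set x | exists2 j, j \in s & A j x] by exact: borel_ex_seq.
rewrite big_cons; apply: le_trans (_ : m (A i `|` [set x | exists2 j, j \in s & A j x]) <= _).
  apply: content_mono; [exact: borel_ex_seq|exact: borel_or (bA i) bU|].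
  by move=> x [j]; rewrite inE => /orP[/eqP -> Ax|js Ax]; [left|right; exists j].
by apply: le_trans (content_setU_le _ _) _ => //; rewrite lerD2l.
Qed.

(** Allows a clearing stage to be built with respect to the part not yet cleared. *)
Lemma content_restr M : borel M -> borel_content (fun A => m (A `&` M)).
Proof.
move=> bM; split=> [A bA|A B bA bB AB|A bA Amono cA e e0].
- by apply: (content_ge0 mc); apply: borel_and.
- rewrite setIUl (contentU mc) //; [exact: borel_and|exact: borel_and|].
  by rewrite setIACA AB set0I.
- case: (content_cont mc bA Amono cA e0) => n hn; exists n.
  have bn : borel (~` A n) by apply: borel_not; apply: bA.
  have hT := content_split borelT (bA n); rewrite setTI setTD in hT.
  have := content_split bM (bA n); rewrite (setIC M) => hM.
  have : m (M `\` A n) <= m (~` A n).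
    by apply: content_mono => //; apply: borel_and.
  by rewrite setTI; lra.
Qed.

End Content.

Lemma In_mem_map (I : eqType) (T : Type) (f : I -> T) (s : seq I) y :
  List.In y (map f s) <-> exists2 i, i \in s & y = f i.
Proof.
elim: s y => [y|i s IH y] /=; first by split=> // -[].
split=> [[<-|/IH[j js ->]]|[j]].
- by exists i => //; apply: mem_head.
- by exists j => //; rewrite inE js orbT.
- by rewrite inE => /orP[/eqP -> ->|js ->]; [left|right; apply/IH; exists j].
Qed.

Section ClearingStage.
Variables (R : realType) (X : ptopologicalType) (adj : X -> X -> Prop) (U : nat -> set X).
Variables (Gam : groupType) (S : seq Gam) (a : Gam -> X -> X).
Hypothesis genS : generates S.
Hypothesis act : free_borel_action a.
Hypothesis sch : forall x y, adj x y <-> x <> y /\ exists2 s, s \in S & y = a s x \/ x = a s y.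
Hypothesis en : enumerated adj U (act_nb S a).
Hypothesis Ubase : countable_base U.
Hypothesis quad : forall n, n.+1 * n.+2 <= 2 * size (wball S n).
Hypothesis am : amenable Gam R.
Local Notation layer := (layer adj (act_nb S a)).
Implicit Types (B V : set X) (L : layer).

Lemma nearby_inside (P Q : set X) s x z : (forall u w, P u -> ~ Q u -> adj u w -> P w) ->
  P x -> (forall y, nearby adj s x y -> ~ Q y) -> nearby adj s x z -> P z.
Proof.
move=> Pcl; elim: s x => [|s IH] x Px nQ /=; first by move=> <-.
have nQ' y : nearby adj s x y -> ~ Q y by move=> xy; apply: nQ; left.
move=> [|[y xy yz]]; first exact: IH.
apply: (IH y) => //; last by move=> t yt; apply: nQ; right; exists y.
apply: Pcl xy => //; apply: nQ; apply: nearby_leq (leq0n _) _; exact: nearby_refl.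
Qed.

Lemma stage_op_out (st : seq layer) z :
  (forall L y, List.In L st -> layer_set L y -> ~ piece (act_nb S a) (layer_ring L) y z) ->
  (exists L y, [/\ List.In L st, layer_set L y & piece (act_nb S a) (layer_in L) y z]) ->
  ~ stage_op st setT z.
Proof.
elim: st => [|L st IH] nR [L0 [y [inL Ly pz]]]; first by case: inL.
case=> [[Yz nz]|[y' [Ly' /(nR L y' (or_introl erefl) Ly')]]//].
case: inL => [?|inL].
  by subst L0; apply: nz; exists y; split=> //; apply: nR => //; left.
apply: (IH _ _ Yz); first by move=> L' y' hL'; apply: nR; right.
by exists L0, y.
Qed.

Lemma cleared_stage (st : seq layer) s x :
  (forall L y z, List.In L st -> layer_set L y -> nearby adj s x z ->
     ~ piece (act_nb S a) (layer_ring L) y z) ->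
  (exists L y, [/\ List.In L st, layer_set L y & piece (act_nb S a) (layer_in L) y x]) ->
  cleared s st x.
Proof.
move=> nR [L [y [inL Ly px]]] z xz; apply: stage_op_out.
  by move=> L' y' inL' Ly'; apply: nR xz.
exists L, y; split=> //; have [_ _ Pcl _ _] := layer_ok L.
apply: (nearby_inside (Q := piece (act_nb S a) (layer_ring L) y)) xz => //.
  by move=> u w Pu nRu; apply: Pcl Ly Pu nRu.
by move=> t xt; apply: nR inL Ly xt.
Qed.

Definition translate g B : set X := [set x | B (a g^-1%g x)].

Lemma borel_translate g B : borel B -> borel (translate g B).
Proof. by move=> bB; apply: (borel_act act). Qed.

Variable m : set X -> R.
Hypothesis mc : borel_content m.
Local Open Scope ring_scope.

(** The sets [A k] partition the space into discrete sets of centres, and they are examined in turn: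
    [k] is kept when enough of the mass of its pieces is new. The pieces kept cover a quarter of the
    mass and the [s]-neighbourhoods of their rings waste at most half of that, whence the constant
    8. As [m] need not be invariant, masses are summed over [g] in [P]: for each [g], the sets
    [translate g (A k)] form a partition of the space. *)
Lemma clearing_stage s : exists st : seq layer, m setT <= 8 * m (cleared s st).
Proof.
have [F [P' [Rg [uF neF FP' tP' thin]]]] := thin_template genS quad am s.
set T := thicken S s Rg in thin; pose P := undup P'.
have tP : group_template S P Rg.
  have [h1 h2 h3] := tP'; split=> //.
    by move=> g /h1; rewrite mem_undup.
  by move=> g h; rewrite !mem_undup; apply: h3.
have FP : (size F <= size P)%N by apply: uniq_leq_size => // g /FP'; rewrite mem_undup.
have uP : uniq P by exact: undup_uniq.
pose n := \max_(g <- P) len genS g.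
have Pn : {subset P <= wball S n} by move=> g gP; rewrite -(len_leq genS); apply: leq_bigmax_seq.
pose Dc := discrete_cover adj U (2 * n).
pose A k : set X := [set x | Dc k x /\ forall j, (j < k)%N -> ~ Dc j x].
have bDc k : borel (Dc k) by exact: (borel_discrete_cover en).
have bA k : borel (A k).
  apply: borel_and; first exact: bDc.
  apply: borel_all => j; apply: borel_imp; first exact: borel_cst.
  by apply: borel_not; exact: bDc.
have Adis k l x : A k x -> A l x -> k = l.
  by move=> [Dk nk] [Dl nl]; case: (ltngtP k l) => // [/nl|/nk].
have Acov x : exists k, A k x.
  have [k0 hk0] := discrete_cover_ex en Ubase (2 * n) x.
  by have [k [hk least]] := @least_ex (fun k => Dc k x) _ hk0; exists k; split.
have Adisc k : discrete_set adj (2 * n) (A k).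
  by move=> x y [Dx _] [Dy _]; apply: (discrete_cover_discrete Dx Dy).
have bt g k : borel (translate g (A k)) by apply: borel_translate.
have trdis k g h x : g \in P -> h \in P -> translate g (A k) x -> translate h (A k) x -> g = h.
  move=> gP hP Agx Ahx; apply: invg_inj; apply: (act_inj act (x := x)); apply: Adisc Agx Ahx _.
  apply/(nearby_ball act sch); exists (h^-1 * g)%g; last by rewrite -(actM act) -mulgA mulgV mulg1.
  by rewrite mul2n -addnn; apply: wballM; [apply: wballV|]; apply: Pn.
have bPA k : borel [set x | exists2 g, g \in P & translate g (A k) x].
  by apply: borel_ex_seq => g; apply: bt.
(* A nonnegative weight means that the new mass of the pieces is at least half their total mass,
   plus twice the mass of the [s]-neighbourhoods of their rings. *)
pose w k V : R := \sum_(g <- P) (m (translate g (A k) `\` V) - 1 / 2 * m (translate g (A k))) -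
  2 * \sum_(h <- T) m (translate h (A k)).
pose fix V k : set X := if k is k'.+1 then V k' `|` [set x | 0 <= w k' (V k') /\
  exists2 g, g \in P & translate g (A k') x] else set0.
have bV k : borel (V k).
  by elim: k => [|k IH]; [exact: borel_cst|apply: borel_or => //; apply: borel_and => //; exact: borel_cst].
have Vmono k l : (k <= l)%N -> V k `<=` V l.
  move=> /subnK <-; elim: (l - k)%N => // j IH x Vx; left; exact: IH.
pose chosen k := 0 <= w k (V k).
have VS k : chosen k -> V k.+1 = V k `|` [set x | exists2 g, g \in P & translate g (A k) x].
  by move=> ck; apply/seteqP; split=> x [Vx|]; [left|case; right|left|right].
have mPA k W : borel W -> m ([set x | exists2 g, g \in P & translate g (A k) x] `&` W) =
    \sum_(g <- P) m (translate g (A k) `&` W).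
  move=> bW; pose C g := [set x | g \in P /\ (translate g (A k) `&` W) x].
  have bC g : borel (C g) by apply: borel_and; [exact: borel_cst|exact: borel_and (bt g k) bW].
  have := content_bigU mc uP bC; rewrite big_seq => h.
  rewrite [RHS]big_seq; rewrite [RHS](eq_bigr (fun g => m (C g))); last first.
    by move=> g gP; congr m; apply/seteqP; split=> x; [split|case].
  rewrite -h; last by move=> g g' x [gP [Ax _]] [g'P [Ax' _]]; apply: trdis Ax Ax'.
  congr m; apply/seteqP; split=> x; first by move=> [[g gP Ax] Wx]; exists g.
  by move=> [g gP [_ [Ax Wx]]]; split=> //; exists g.
pose tau k : R := \sum_(h <- T) m (translate h (A k)).
have tau0 k : 0 <= tau k by apply: sumr_ge0 => h _; apply: (content_ge0 mc).
pose TB k := [set x | chosen k /\ exists2 h, h \in T & translate h (A k) x].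
have bTB k : borel (TB k).
  by apply: borel_and; [exact: borel_cst|apply: borel_ex_seq => h; apply: bt].
have mTB k : m (TB k) <= if chosen k then tau k else 0.
  case: ifP => ck; last first.
    rewrite (_ : TB k = set0) ?(content0 mc) //; apply/seteqP; split=> // x [ck' _].
    by move: ck; rewrite ck'.
  apply: le_trans (content_bigU_le mc T (bt^~ k)); apply: (content_mono mc) => //.
    by apply: borel_ex_seq => h; apply: bt.
  by move=> x [].
(* Every chosen [k] adds to [V] at least twice the mass lost around its rings. *)
have big1 K : 2 * \sum_(0 <= k < K) (if chosen k then tau k else 0) <= m (V K).
  elim: K => [|K IH]; first by rewrite big_geq // mulr0 (content_ge0 mc).
  rewrite big_nat_recr //= mulrDr; case: ifP => ck; last first.
    rewrite mulr0 addr0; apply: le_trans IH _; apply: (content_mono mc) (bV K) (bV K.+1) _.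
    by apply: Vmono.
  rewrite -/(V K.+1) (VS K ck) (content_split mc _ (bV K)); last exact: borel_or (bV K) (bPA K).
  have -> : (V K `|` [set x | exists2 g, g \in P & translate g (A K) x]) `&` V K = V K.
    by apply/seteqP; split=> [x []//|x Vx]; split=> //; left.
  apply: lerD => //; have bC : borel (~` V K) by exact: borel_not (bV K).
  rewrite (_ : _ `\` _ = [set x | exists2 g, g \in P & translate g (A K) x] `&` ~` V K); last first.
    by apply/seteqP; split=> x [h nV]; [case: h => // h; split|split=> //; right].
  rewrite mPA //; move: ck; rewrite /chosen /w big_split /= sumrN -/(tau K).
  have : 0 <= \sum_(g <- P) (1 / 2 * m (translate g (A K))).
    by apply: sumr_ge0 => g _; rewrite mulr_ge0 // (content_ge0 mc).
  have -> : \sum_(g <- P) m (translate g (A K) `&` ~` V K) =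
      \sum_(g <- P) m (translate g (A K) `\` V K) by apply: eq_bigr => g _; rewrite setDE.
  lra.
(* Chosen or not, [k] has nearly half of the mass of its pieces in [V K]: a chosen one has all of it
   there, and a rejected one had too little new mass. *)
have big2 K k : (k < K)%N -> \sum_(g <- P) (1 / 2 * m (translate g (A k))) - 2 * tau k <=
    \sum_(g <- P) m (translate g (A k) `&` V K).
  move=> kK; have sp g : m (translate g (A k)) =
      m (translate g (A k) `&` V k) + m (translate g (A k) `\` V k) by apply: (content_split mc).
  case: (boolP (0 <= w k (V k))) => ck.
    apply: le_trans (_ : \sum_(g <- P) (1 / 2 * m (translate g (A k))) <= _).
      by rewrite lerBlDr lerDl mulr_ge0.
    rewrite big_seq [leRHS]big_seq; apply: ler_sum => g gP.
    rewrite (setIidl (_ : _ `<=` V K)); last first.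
      by move=> x Ax; apply: (Vmono _ _ kK); rewrite VS //; right; exists g.
    by have := content_ge0 mc (bt g k); lra.
  apply: le_trans (_ : \sum_(g <- P) m (translate g (A k) `&` V k) <= _); last first.
    apply: ler_sum => g _; apply: (content_mono mc); [exact: borel_and (bt _ _) (bV k)|exact: borel_and (bt _ _) (bV K)|].
    by move=> x [Ax Vx]; split=> //; apply: (Vmono _ _ (ltnW kK)).
  move: ck; rewrite -ltNge /w big_split /= sumrN -/(tau k) => ck.
  have : \sum_(g <- P) (1 / 2 * m (translate g (A k))) +
      \sum_(g <- P) (1 / 2 * m (translate g (A k))) =
      \sum_(g <- P) m (translate g (A k) `&` V k) + \sum_(g <- P) m (translate g (A k) `\` V k).
    by rewrite -!big_split /=; apply: eq_bigr => g _; rewrite -sp; lra.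
  lra.
pose Y K g := [set x | exists2 k, k \in index_iota 0 K & translate g (A k) x].
have mY K g W : borel W -> m (Y K g `&` W) = \sum_(0 <= k < K) m (translate g (A k) `&` W).
  move=> bW; rewrite -(content_bigU mc).
  - by congr m; apply/seteqP; split=> x; [move=> [[k kK Ax] Wx]; exists k|move=> [k kK [Ax Wx]]; split=> //; exists k].
  - exact: iota_uniq.
  - by move=> k; apply: borel_and (bt g k) bW.
  - by move=> k l x [Ak _] [Al _]; apply: Adis Ak Al.
have bY K g : borel (Y K g) by apply: borel_ex_seq => k; apply: bt.
have mY1 K g : m (Y K g) = \sum_(0 <= k < K) m (translate g (A k)).
  rewrite -[Y K g]setIT mY; last exact: borel_cst.
  by apply: eq_bigr => k _; rewrite setIT.
have mT0 : 0 <= m setT by apply: (content_ge0 mc); exact: borel_cst.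
have [e0|epos] := leP (m setT) 0.
  exists [::]; apply: le_trans e0 _; rewrite mulr_ge0 // (content_ge0 mc) //.
  exact: (borel_cleared en).
(* Finitely many classes must carry three quarters of the mass, for all [g] in [P] at once. *)
have [K hK] : exists K, forall g, g \in P -> m setT <= m (Y K g) + m setT / 4.
  have Ymono g k l : (k <= l)%N -> Y k g `<=` Y l g.
    by move=> kl x [j]; rewrite mem_index_iota => /andP[_ jk] Ax; exists j; rewrite // mem_index_iota (leq_trans jk).
  have [|k l g kl h|g _|K hK] := @finite_bound _ [set` P] (fun K g => m setT <= m (Y K g) + m setT / 4).
  - exact: finite_seq.
  - by apply: le_trans h _; rewrite lerD2r; apply: (content_mono mc) => //; apply: Ymono.
  - apply: (content_cont mc) => [//|k|x|]; first exact: Ymono.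
      have [k Ak] := Acov (a g^-1%g x); exists k.+1, k => //; by rewrite mem_index_iota /=.
    by rewrite divr_gt0.
  by exists K.
have sumC (t : seq Gam) (c : R) : c *+ size t = \sum_(g <- t) c.
  by rewrite big_const_seq count_predT iter_addr_0.
(* Summing [big2] over [k] and dividing by [size P] leaves half of three quarters, minus twice the
   ratio of [size T] to [size P]; the factor 16 of the thin template makes this [3 / 8 - 1 / 8]. *)
have mVK : m setT <= 4 * m (V K).
  have h1 : \sum_(0 <= k < K) (\sum_(g <- P) (1 / 2 * m (translate g (A k))) - 2 * tau k) <=
      \sum_(0 <= k < K) \sum_(g <- P) m (translate g (A k) `&` V K).
    by rewrite big_nat [leRHS]big_nat; apply: ler_sum => k /andP[_ kK]; apply: big2.
  rewrite exchange_big /= in h1; rewrite big_split /= sumrN exchange_big /= in h1.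
  have h2 : \sum_(g <- P) \sum_(0 <= k < K) m (translate g (A k) `&` V K) <= (size P)%:R * m (V K).
    rewrite mulr_natl sumC; apply: ler_sum => g _; rewrite -mY //.
    by apply: (content_mono mc) => //; exact: borel_and (bY K g) (bV K).
  have h3 : (size P)%:R * (3 / 8 * m setT) <= \sum_(g <- P) \sum_(0 <= k < K) (1 / 2 * m (translate g (A k))).
    rewrite mulr_natl sumC big_seq [leRHS]big_seq; apply: ler_sum => g gP.
    by rewrite -mulr_sumr -mY1; have := hK g gP; lra.
  have h4 : \sum_(0 <= k < K) (2 * tau k) <= (size T)%:R * (2 * m setT).
    rewrite -mulr_sumr /tau exchange_big /= mulrCA ler_pM2l // mulr_natl sumC.
    apply: ler_sum => g _; rewrite -mY1.
    by apply: (content_mono mc) => //; exact: borel_cst.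
  have sz : (size T)%:R * 16 <= (size P)%:R :> R.
    by rewrite -natrM ler_nat mulnC (leq_trans thin).
  have P0 : 0 < (size P)%:R :> R.
    by rewrite ltr0n (leq_trans _ FP) // lt0n size_eq0.
  rewrite -(ler_pM2l P0); have : (size T)%:R * 16 * m setT <= (size P)%:R * m setT by rewrite ler_pM2r.
  by nra.
have mout : m (V K) <= 2 * m (V K `\` [set x | exists2 k, k \in index_iota 0 K & TB k x]).
  have bTK : borel [set x | exists2 k, k \in index_iota 0 K & TB k x] by apply: borel_ex_seq.
  have := content_split mc (bV K) bTK.
  have : m (V K `&` [set x | exists2 k, k \in index_iota 0 K & TB k x]) <=
      \sum_(0 <= k < K) (if chosen k then tau k else 0).
    apply: le_trans (_ : m [set x | exists2 k, k \in index_iota 0 K & TB k x] <= _).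
      by apply: (content_mono mc) => //; exact: borel_and (bV K) bTK.
    by apply: le_trans (content_bigU_le mc _ bTB) _; apply: ler_sum.
  by have := big1 K; lra.
have /choice[L hL] k : exists L : layer, [/\ layer_set L = [set x | A k x /\ chosen k],
    forall y z, piece (act_nb S a) (layer_in L) y z <-> exists2 g, g \in P & z = a g y &
    forall y z, piece (act_nb S a) (layer_ring L) y z <-> exists2 g, g \in Rg & z = a g y].
  have [||L [h1 _ h2 h3]] := group_layer act sch en (B := [set x | A k x /\ chosen k]) tP Pn.
  - by apply: borel_and; [exact: bA|exact: borel_cst].
  - by move=> x y [Ax _] [Ay _]; exact: (@Adisc k).
  by exists L.
exists [seq L k | k <- index_iota 0 K].
suff : m (V K `\` [set x | exists2 k, k \in index_iota 0 K & TB k x]) <=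
    m (cleared s [seq L k | k <- index_iota 0 K]) by lra.
apply: (content_mono mc); first by apply: borel_and (bV K) _; apply: borel_not; apply: borel_ex_seq.
  exact: (borel_cleared en).
move=> x [Vx nT]; apply: cleared_stage.
  move=> L' y z /In_mem_map[k kK ->]; have [-> _ hR] := hL k => -[Ay ck] xz /hR[g gR ez].
  apply: nT; exists k => //; split=> //.
  have /(nearby_ball act sch)[h hs ez'] := xz.
  exists (h^-1 * g)%g; last by rewrite /translate /= invgM invgK (actM act) -ez' ez (actK act).
  by apply/mem_thicken; exists g => //; rewrite mulgK; apply: wballV.
have [k [kK ck [g gP Ax]]] : exists k, [/\ (k < K)%N, chosen k & exists2 g, g \in P & translate g (A k) x].
  elim: (K) Vx => [//|k IH] [/IH[j [jk cj h]]|[ck h]]; last by exists k.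
  by exists j; split=> //; apply: leqW.
have [eL hP _] := hL k; exists (L k), (a g^-1%g x); split.
- by apply/In_mem_map; exists k => //; rewrite mem_index_iota.
- by rewrite eL.
- by apply/hP; exists g; rewrite ?(actVK act).
Qed.

End ClearingStage.

Section Measured.
Variables (R : realType) (X : ptopologicalType).
Variable mu : probability (g_sigma_algebraType (@open X)) R.
Local Open Scope ring_scope.

Lemma probability_content : borel_content (fun A : set X => fine (mu A)).
Proof.
have bT : borel [set: X] by exact: borel_cst.
have muf (A : set X) : borel A -> mu A \is a fin_num by move=> bA; apply: fin_num_measure.
split=> [A bA|A B bA bB AB|A bA Amono cA e e0].
- by apply: fine_ge0; apply: measure_ge0.
- by rewrite -fineD ?muf // measureU.
- have AT : \bigcup_n A n = setT by apply/seteqP; split=> // x _; have [n An] := cA x; exists n.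
  have : mu \o A @ \oo --> mu (\bigcup_n A n).
    apply: nondecreasing_cvg_mu; [exact: bA|by rewrite AT; apply: measurableT|].
    by apply/nondecreasing_seqP => n; apply/subsetPset; exact: Amono.
  rewrite AT -(fineK (muf setT bT)) => /fine_cvg /cvgrPdist_le /(_ e e0)[n _ hn].
  by exists n; have := hn n (leqnn n); rewrite /= ler_norml => /andP[_]; lra.
Qed.

Variables (G : sgraph X) (U : nat -> set X).
Hypothesis GT : vset G = setT.
Hypothesis Ubase : countable_base U.
Variables (Gam : groupType) (S : seq Gam) (a : Gam -> X -> X).
Hypothesis genS : generates S.
Hypothesis act : free_borel_action a.
Hypothesis sch : schreier_graph_of a S G.
Hypothesis en : enumerated (fun x y => adj G x y) U (act_nb S a).
Hypothesis quad : forall n, (n.+1 * n.+2 <= 2 * size (wball S n))%N.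
Hypothesis am : amenable Gam R.
Local Notation E := (fun x y => adj G x y).
Local Notation layer := (layer E (act_nb S a)).
Implicit Types st : seq layer.

Lemma cleared_catl s st st' : cleared s st `<=` cleared s (st ++ st').
Proof.
move=> x cx z xz; rewrite stage_op_cat => h; apply: (cx z xz).
by apply: stage_op_mono h.
Qed.

Lemma cleared_catr s st st' : cleared (s + stage_diam st) st' `<=` cleared s (st ++ st').
Proof.
move=> x cx z xz; rewrite stage_op_cat => /stage_op_nearby[w hw zw].
by apply: (cx w) hw; apply: nearby_trans xz zw.
Qed.

(** The new stage is built for the restriction of the measure to the uncleared part. Being appended,
    it acts first, so by monotonicity what was cleared remains so; it has to clear a radius enlarged
    by the diameter of the older stages. *)
Lemma clearing_iterate k s : exists st, fine (mu (~` cleared s st)) <= (7 / 8) ^+ k.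
Proof.
have mc := probability_content.
have bC t (u : seq layer) : borel (cleared t u) by exact: (borel_cleared en).
elim: k => [|k [st IH]].
  exists [::]; rewrite expr0 -[leRHS]/(fine 1%:E) -(@probability_setT _ _ _ mu).
  apply: (content_mono mc); [|exact: borel_cst|by []].
  exact: borel_not (bC _ _).
pose M := ~` cleared s st; have bM : borel M by exact: borel_not (bC _ _).
have [st' h] := clearing_stage genS act sch en Ubase quad am (content_restr mc bM) (s + stage_diam st).
exists (st ++ st'); set C' := cleared _ st' in h.
have bC' : borel C' by exact: bC.
rewrite setTI in h.
apply: le_trans (_ : fine (mu (M `\` C')) <= _).
  apply: (content_mono mc); [exact: borel_not (bC _ _)|exact: borel_and bM (borel_not bC')|].
  by move=> x nx; split=> cx; apply: nx; [exact: cleared_catl cx|exact: cleared_catr cx].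
have := content_split mc bM bC'; rewrite (setIC M) exprS => e.
by move: IH; rewrite -/M; lra.
Qed.

Lemma clearing_small n s : exists st, fine (mu (~` cleared s st)) <= n.+1%:R^-1.
Proof.
have [st h] := clearing_iterate (8 * n) s; exists st; apply: le_trans h _.
(* An elementary decay estimate; for [k = 8 * n] it gives exactly the bound [1 / n.+1]. *)
have pow k : (7 / 8 : R) ^+ k * (k%:R + 8) <= 8.
  elim: k => [|k IH]; first by rewrite mul1r add0r.
  have p0 : 0 <= (7 / 8 : R) ^+ k by apply: exprn_ge0; lra.
  have k0 : 0 <= k%:R :> R by apply: ler0n.
  rewrite exprS -[k.+1%:R]natr1; move: (_ ^+ k) (k%:R) p0 k0 IH => p q p0 q0 IH.
  by have := mulr_ge0 p0 q0; lra.
rewrite -[leRHS]mul1r ler_pdivlMr ?ltr0n //.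
by have := pow (8 * n)%N; rewrite natrM -[n.+1%:R]natr1; lra.
Qed.

Lemma amenable_tree : exists X' : set X,
  [/\ graph_invariant G X', borel X', mu (~` X') = 0%E &
      admits_borel_one_ended_spanning_tree (induced_sgraph G X')].
Proof.
have mc := probability_content.
have /choice[pick hpick] (h : seq (seq layer)) : exists st,
    fine (mu (~` cleared (clear_radius (size h) (stage_diam (flatten h))) st)) <= (size h).+1%:R^-1.
  exact: clearing_small.
pose st n := pick (hist pick n); pose D n := stage_diam (flatten (hist pick n)).
have Dge n : (stage_diam (cumul st n) <= D n)%N by rewrite /st cumul_hist.
pose c n := cleared (clear_radius n (D n)) (st n).
have bc n : borel (c n) by exact: (borel_cleared en).
have mcn n : fine (mu (~` c n)) <= n.+1%:R^-1.
  by have := hpick (hist pick n); rewrite size_hist.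
pose Z := stage_domain st D.
have bZ : borel Z by exact: (borel_stage_domain en).
have iZ : conn_invariant E Z by exact: (stage_domain_inv en).
have [f hf] := stage_map en Dge.
exists Z; split=> //; first by apply: (conn_invariant_graph GT).
  (* A point has to be cleared at infinitely many [n] only, so bounds that tend to 0 suffice and no
     summability is required. *)
  pose Em m : set X := [set x | forall n, (m <= n)%N -> ~ c n x].
  have bE m : borel (Em m).
    apply: borel_all => n; apply: borel_imp; first exact: borel_cst.
    exact: borel_not (bc n).
  have nE m : mu.-negligible (Em m).
    apply/negligibleP; first exact: bE.
    have muf : mu (Em m) \is a fin_num by apply: fin_num_measure; exact: bE.
    apply: etrans (esym (fineK muf)) _; congr EFin; apply/eqP; rewrite eq_le (content_ge0 mc) ?andbT //.
    apply/ler_addgt0Pr => e e0; rewrite add0r; have [j je] := inv_small e0.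
    apply: ltW; apply: le_lt_trans je; have le := inv_le R (leq_maxr m j).
    apply: le_trans le; apply: le_trans (mcn (maxn m j)).
    apply: (content_mono mc) => //; first exact: borel_not (bc _).
    by move=> x hx; apply: hx; apply: leq_maxl.
  apply/(negligibleP mu (borel_not bZ)).
  apply: negligibleS (negligible_bigcup nE) => x nZ.
  apply: contrapT => nEm; apply: nZ; apply: (stage_domain_ex Dge) => m.
  apply: contrapT => nex; apply: nEm; exists m => // n mn cn; apply: nex; by exists n.
exact: (one_ended_map_tree GT en bZ iZ hf).
Qed.

End Measured.

(** * Groups of polynomial growth *)

Lemma averaging (T : eqType) (Q : seq T) (v : T -> nat) B : Q != [::] ->
  \sum_(q <- Q) v q <= B -> exists2 q, q \in Q & v q * size Q <= B.
Proof.
move=> Q0 sB; apply: contrapT => nex.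
have : \sum_(q <- Q) B.+1 <= \sum_(q <- Q) v q * size Q.
  rewrite big_seq [leqRHS]big_seq; apply: leq_sum => q qQ.
  by rewrite ltnNge; apply/negP => h; apply: nex; exists q.
rewrite big_const_seq count_predT iter_addn_0 -big_distrl /= => h.
have : size Q * B.+1 <= B * size Q by rewrite mulnC (leq_trans h) // leq_mul2r sB orbT.
by rewrite mulnC mulSn -{2}[B * size Q]add0n leq_add2r leqn0 size_eq0 (negPf Q0).
Qed.

Lemma count_sum (T : Type) (P : pred T) (H : seq T) : count P H = \sum_(h <- H) P h.
Proof. by rewrite -sum1_count big_mkcond; apply: eq_bigr => h _; case: (P h). Qed.

Section AvoidingTemplates.
Variables (Gam : groupType) (S : seq Gam).
Hypothesis genS : generates S.
Hypothesis len_ex : forall n, exists g : Gam, len genS g = n.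
Implicit Types (g h p q t x y z : Gam) (H R Y : seq Gam).
Local Open Scope group_scope.

Local Notation len := (len genS).
Local Notation wball := (wball S).
Local Notation ev := (ev S).
Local Notation growth n := (size (wball n)).

Definition geod g : seq nat := s2val (cid2 (geodesic_ex genS g)).

Lemma size_geod g : size (geod g) = len g. Proof. exact: s2valP (cid2 (geodesic_ex genS g)). Qed.

Lemma ev_geod g : ev (geod g) = g. Proof. exact: s2valP' (cid2 (geodesic_ex genS g)). Qed.

Lemma len_sub g h : len g <= len (h * g^-1) + len h.
Proof.
by have := lenM genS (h * g^-1)^-1 h; rewrite lenV invgM invgK mulgVK.
Qed.

Lemma maximal_spread r (F : seq Gam) : exists Y, [/\ uniq Y, {subset Y <= F}, spread S r Y &
  forall f, f \in F -> exists2 x, x \in Y & f * x^-1 \in wball r].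
Proof.
elim: F => [|f F [Y [uY YF sY dY]]]; first by exists [::].
case: (pselect (exists2 x, x \in Y & f * x^-1 \in wball r)) => h.
  exists Y; split=> // [x /YF xF|g]; first by rewrite inE xF orbT.
  by rewrite inE => /orP[/eqP ->|/dY].
exists (f :: Y); split.
- by rewrite /= uY andbT; apply/negP => fY; apply: h; exists f; rewrite ?mulgV ?wball1.
- by move=> x; rewrite !inE => /orP[->//|/YF ->]; rewrite orbT.
- move=> x y; rewrite !inE => /orP[/eqP ->|xY] /orP[/eqP ->|yY] // xy.
  + by case: h; exists y => //; have := wballV xy; rewrite invgM invgK.
  + by case: h; exists x.
  + exact: sY.
- move=> g; rewrite inE => /orP[/eqP ->|/dY[x xY gx]].
    by exists f; rewrite ?mem_head // mulgV wball1.
  by exists x; rewrite // inE xY orbT.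
Qed.

Definition hit s R h := has (fun z => z * h^-1 \in wball s) R.

Definition link (e : Gam * Gam) : seq Gam := path_seq S (geod (e.2 * e.1^-1)) e.1.

(* A geodesic joining two points is determined by its type, by one of its
   points and by the position of this point: few of them pass near [h]. *)
Lemma count_links s m h (Q : seq (Gam * Gam)) : uniq Q ->
  (forall e, e \in Q -> e.2 * e.1^-1 \in wball m) ->
  count (fun e => hit s (link e) h) Q <= growth s * growth m * m.+1.
Proof.
move=> uQ Qm; rewrite -size_filter.
pose F (kt : Gam * Gam * nat) : Gam * Gam :=
  let p := (ev (drop kt.2 (geod kt.1.2)))^-1 * (kt.1.1 * h) in (p, kt.1.2 * p).
pose D := allpairs (fun kt j => (kt, j)) (allpairs pair (wball s) (wball m)) (iota 0 m.+1).
have -> : (growth s * growth m * m.+1)%N = size (map F D) by rewrite size_map !size_allpairs size_iota.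
apply: uniq_leq_size; first exact: filter_uniq.
move=> [p q]; rewrite mem_filter => /andP[/hasP[z /mem_path_seq[j jt ez] zh] eQ].
have tm := Qm _ eQ; rewrite /= in tm jt ez.
apply/mapP; exists (z * h^-1, q * p^-1, j).
  have jm : j \in iota 0 m.+1.
    by rewrite mem_iota add0n ltnS; apply: leq_trans jt _; rewrite size_geod len_leq.
  apply/allpairsP; exists ((z * h^-1, q * p^-1), j); split=> //.
  by apply/allpairsP; exists (z * h^-1, q * p^-1).
by rewrite /F /= mulgVK ez mulKg mulgVK.
Qed.

(** Averages the number of hits over the [growth r ^ 2] pairs of endpoints in the [r]-balls around
    [y0] and [y]. The displacement of such a pair has length at most [28 * r + r + r]. *)
Lemma avoiding_link r s H y0 y : len (y * y0^-1) <= 28 * r ->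
  exists e, [/\ e.1 * y0^-1 \in wball r, e.2 * y^-1 \in wball r &
    count (hit s (link e)) H * growth r ^ 2 <= size H * (growth s * growth (30 * r) * (30 * r).+1)].
Proof.
move=> yy0; pose Q := allpairs (fun b c => (b * y0, c * y)) (wball r) (wball r).
have uQ : uniq Q.
  apply: allpairs_uniq; [exact: uniq_wball|exact: uniq_wball|].
  by move=> [b c] [b' c'] _ _ /= [/mulIg -> /mulIg ->].
have sQ : size Q = (growth r ^ 2)%N by rewrite size_allpairs.
have Q0 : Q != [::].
  rewrite -size_eq0 sQ expn_eq0 negb_and -lt0n /=; apply/orP; left.
  by case: (wball r) (wball1 S r).
have [|e eQ le] := @averaging _ Q (fun e => count (hit s (link e)) H)
    (size H * (growth s * growth (30 * r) * (30 * r).+1)) Q0.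
  under eq_bigr do rewrite count_sum.
  rewrite exchange_big /= mulnC -iter_addn_0 -count_predT -big_const_seq; apply: leq_sum => h _.
  rewrite -count_sum; apply: count_links => // _ /allpairsP[[b c] /= [bW cW ->]] /=.
  have -> : c * y * (b * y0)^-1 = c * ((y * y0^-1) * b^-1) by rewrite invgM !mulgA.
  rewrite -(len_leq genS); have := lenM genS (y * y0^-1) b^-1.
  have := lenM genS c ((y * y0^-1) * b^-1); rewrite lenV.
  move: yy0 bW cW; rewrite -!(len_leq genS).
  move: (len b) (len c) (len (y / y0)) (len (y / y0 / b)) (len (c * (y / y0 / b))); lia.
exists e; rewrite -sQ; split=> //; have /allpairsP[[b c] /= [bW cW ->]] := eQ; by rewrite mulgK.
Qed.

Lemma path_seq_len w x z r : z \in path_seq S w x -> size w <= r -> len x <= len z + r /\ len z <= len x + r.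
Proof.
move=> /mem_path_seq[k _ ->] wr; have := len_ev genS (drop k w); rewrite size_drop => h1.
have := lenM genS (ev (drop k w)) x; have := lenM genS (ev (drop k w))^-1 (ev (drop k w) * x).
by rewrite mulKg lenV; lia.
Qed.

(* The ring consists of geodesic segments from the sphere of radius [60 r] down to
   the sphere of radius [14 r], and of paths connecting the latter through finitely
   many links; only the links may come near the ball of radius [2 r]. *)
Lemma avoiding_template r s M H : 0 < r -> s <= r -> {subset H <= wball (2 * r)} ->
  growth (121 * r) <= M * growth r ->
  exists R, group_template S (wball (60 * r)) R /\
    count (hit s R) H * growth r <= size H * (growth s * M ^ 2 * (30 * r).+1).
Proof.
move=> r0 sr HW dbl.
have gpos n : 0 < growth n by case: (wball n) (wball1 S n).
have [y0 y0len] := len_ex (14 * r)%N.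
pose Sph := sphere genS (14 * r)%N.
have [Y [uY YS sepY denseY]] := maximal_spread (r + r)%N Sph.
have thick m n F : {subset F <= wball n} -> size (thicken S m F) <= growth (m + n)%N.
  move=> Fn; apply: uniq_leq_size; first exact: undup_uniq.
  move=> h /mem_thicken[g /Fn gn hg]; rewrite -[h](mulgVK g); exact: wballM.
have szY : size Y * growth r <= M * growth r.
  apply: leq_trans (spread_size uY YS sepY) _; apply: leq_trans dbl.
  apply: leq_trans (thick r (14 * r)%N _ _) _.
    by move=> z; rewrite mem_sphere -(len_leq genS) => /eqP ->.
  by apply: uniq_leq_size; [exact: uniq_wball|apply: wball_leq; lia].
have /choice[e he] y : exists e : Gam * Gam, y \in Y -> [/\ e.1 * y0^-1 \in wball r, e.2 * y^-1 \in wball r &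
    count (hit s (link e)) H * growth r ^ 2 <= size H * (growth s * growth (30 * r) * (30 * r).+1)].
  case: (boolP (y \in Y)) => yY; last by exists (1, 1).
  have [|e he] := @avoiding_link r s H y0 y; last by exists e.
  have := lenM genS y y0^-1; rewrite lenV y0len; have := YS _ yY.
  by rewrite mem_sphere => /eqP ->; lia.
have /choice[n hn] z : exists y, z \in Sph -> y \in Y /\ z * y^-1 \in wball (r + r).
  case: (boolP (z \in Sph)) => [/denseY[y yY zy]|_]; last by exists 1.
  by exists y.
have /choice[d hd] z : exists d, z \in sphere genS (60 * r)%N ->
    len d = (14 * r)%N /\ len (z * d^-1) = (46 * r)%N.
  case: (boolP (z \in _)) => [|_]; last by exists 1.
  rewrite mem_sphere => /eqP zl; have [|u [d [zE dl ul]]] := @len_split _ _ genS z (14 * r)%N.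
    by rewrite zl; lia.
  by exists d => _; rewrite {1}zE mulgK ul zl; split=> //; lia.
pose seg (x z : Gam) : seq nat * Gam := (geod (z * x^-1), x).
have segE x z : ev (seg x z).1 * (seg x z).2 = z by rewrite /= ev_geod mulgVK.
pose paths (ps : seq (seq nat * Gam)) := flatten [seq path_seq S u.1 u.2 | u <- ps].
have in_paths x z ps y : seg x z \in ps -> y = z -> y \in paths ps.
  move=> ps_ ->; apply/flatten_mapP; exists (seg x z) => //; rewrite -{1}(segE x z).
  exact: path_seq_top.
(* The first three families join [y0] to each net point through a link, the fourth joins the net to
   the whole sphere of radius [14 * r], and the last descends to it from the sphere of radius
   [60 * r]. *)
pose ps1 := [seq seg y0 (e y).1 | y <- Y].
pose ps2 := [seq seg (e y).1 (e y).2 | y <- Y].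
pose ps3 := [seq seg (e y).2 y | y <- Y].
pose ps4 := [seq seg (n z) z | z <- Sph].
pose ps5 := [seq seg (d z) z | z <- sphere genS (60 * r)%N].
pose R1 := [:: y0] ++ paths ps1; pose R2 := R1 ++ paths ps2; pose R3 := R2 ++ paths ps3.
pose R4 := R3 ++ paths ps4; pose R5 := R4 ++ paths ps5.
have c0 : conn_seq S [:: y0].
  by move=> x y; rewrite !inE => /eqP -> /eqP ->; apply: conn_refl; rewrite /= mem_head.
have c1 : conn_seq S R1.
  by apply: conn_seq_attach c0 _ => _ /mapP[y yY ->]; left; rewrite mem_head.
have c2 : conn_seq S R2.
  apply: conn_seq_attach c1 _ => _ /mapP[y yY ->]; left; rewrite mem_cat; apply/orP; right.
  by apply: (in_paths y0 (e y).1) => //; apply: map_f.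
have c3 : conn_seq S R3.
  apply: conn_seq_attach c2 _ => _ /mapP[y yY ->]; left; rewrite mem_cat; apply/orP; right.
  by apply: (in_paths (e y).1 (e y).2) => //; apply: map_f.
have c4 : conn_seq S R4.
  apply: conn_seq_attach c3 _ => _ /mapP[z zS ->]; left; rewrite mem_cat; apply/orP; right.
  have [nY _] := hn z zS; apply: (in_paths (e (n z)).2 (n z)) => //.
  by apply/mapP; exists (n z).
have c5 : conn_seq S R5.
  apply: conn_seq_attach c4 _ => _ /mapP[z zS ->]; left; rewrite mem_cat; apply/orP; right.
  have [dl _] := hd z zS; apply: (in_paths (n (d z)) (d z)) => //.
  by apply/mapP; exists (d z) => //; rewrite mem_sphere dl.
have ylen y : y \in Y -> len y = (14 * r)%N by move=> /YS; rewrite mem_sphere => /eqP.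
have e1len y : y \in Y -> 13 * r <= len (e y).1 <= 15 * r.
  move=> yY; have [h _ _] := he y yY; move: h; rewrite -(len_leq genS) => h.
  have := len_sub y0 (e y).1; have := lenM genS ((e y).1 * y0^-1) y0; rewrite mulgVK y0len; lia.
have e2len y : y \in Y -> 13 * r <= len (e y).2 <= 15 * r.
  move=> yY; have [_ h _] := he y yY; move: h; rewrite -(len_leq genS) => h.
  have := len_sub y (e y).2; have := lenM genS ((e y).2 * y^-1) y; rewrite mulgVK (ylen y yY); lia.
have R5len z : z \in R5 -> (exists2 y, y \in Y & z \in link (e y)) \/ 12 * r <= len z <= 60 * r.
  have inP ps : z \in paths ps -> exists2 u, u \in ps & z \in path_seq S u.1 u.2.
    by move=> /flatten_mapP.
  rewrite !mem_cat => /orP[/orP[/orP[/orP[/orP[]|]|]|]|].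
  - by rewrite inE => /eqP ->; right; rewrite y0len; lia.
  - move=> /inP[_ /mapP[y yY ->] /=]; have [h _ _] := he y yY.
    move=> /path_seq_len/(_ (leqnn _)); rewrite size_geod y0len; move: h; rewrite -(len_leq genS); lia.
  - by move=> /inP[_ /mapP[y yY ->] /= zl]; left; exists y.
  - move=> /inP[_ /mapP[y yY ->] /=]; have [_ h _] := he y yY; have := e2len y yY.
    have le : len (y * (e y).2^-1) <= r by rewrite -lenV invgM invgK (len_leq genS).
    move=> e2 /path_seq_len h'; have := h' r; rewrite size_geod => /(_ le).
    by right; lia.
  - move=> /inP[_ /mapP[x xS ->] /=]; have [nY h] := hn x xS.
    move=> /path_seq_len/(_ (leqnn _)); rewrite size_geod (ylen _ nY).
    by move: h; rewrite -(len_leq genS); lia.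
  - move=> /inP[_ /mapP[x xS ->] /=]; have [dl xd] := hd x xS.
    move=> /mem_path_seq[k]; rewrite size_geod xd => kr ->; right.
    set w := geod _; have wl : size w = (46 * r)%N by rewrite size_geod.
    have A := lenM genS (ev (drop k w)) (d x).
    have B := lenM genS (ev (take k w)) (ev (drop k w) * d x).
    have := len_ev genS (take k w); have := len_ev genS (drop k w).
    move: B; rewrite mulgA -ev_cat cat_take_drop ev_geod mulgVK dl in A *.
    move: xS; rewrite mem_sphere => /eqP ->; rewrite size_drop size_takel wl //.
    move: (len _) (len _) (len _) A => a b c; lia.
have linklen y z : y \in Y -> z \in link (e y) -> len z <= 60 * r.
  move=> yY /path_seq_len/(_ (leqnn _)); rewrite size_geod => -[_].
  have := e1len y yY; have := e2len y yY; have := lenM genS (e y).2 (e y).1^-1; rewrite lenV; lia.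
exists R5; split.
  split.
  - move=> z /R5len[[y yY zl]|/andP[_ zl]]; rewrite -(len_leq genS) //; exact: linklen zl.
  - exact: c5.
  - move=> g h gP gR gh; rewrite -(len_leq genS); apply: leq_trans (len_cay genS gh) _.
    move: gP; rewrite -(len_leq genS) leq_eqVlt => /orP[/eqP gl|//]; case/negP: gR.
    rewrite mem_cat; apply/orP; right; apply: (in_paths (d g) g) => //.
    by apply: map_f; rewrite mem_sphere gl.
(* The vertices outside the links have length at least [12 * r], whereas a point within [s <= r] of
   the ball of radius [2 * r] has length at most [3 * r]. *)
have hitR h : h \in H -> hit s R5 h <= \sum_(y <- Y) hit s (link (e y)) h.
  move=> hH; case: (boolP (hit s R5 h)) => // /hasP[z zR zh].
  case: (R5len z zR) => [[y yY zl]|/andP[zl _]].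
    have hz : hit s (link (e y)) h by apply/hasP; exists z.
    by rewrite (big_rem y yY); apply: leq_trans (leq_addr _ _); rewrite hz.
  have := HW h hH; move: zh; rewrite -!(len_leq genS) => zh hl.
  have : len z <= s + 2 * r.
    by rewrite -[z](mulgVK h); apply: leq_trans (lenM _ _ _) _; apply: leq_add.
  by clear -zl r0 sr; lia.
have cnt : count (hit s R5) H <= \sum_(y <- Y) count (hit s (link (e y))) H.
  under eq_bigr do rewrite count_sum; rewrite exchange_big count_sum /=.
  by rewrite big_seq [leqRHS]big_seq; apply: leq_sum.
have cnt2 : count (hit s R5) H * growth r ^ 2 <=
    size Y * (size H * (growth s * growth (30 * r) * (30 * r).+1)).
  apply: leq_trans (_ : (\sum_(y <- Y) count (hit s (link (e y))) H) * growth r ^ 2 <= _).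
    by rewrite leq_mul2r cnt orbT.
  rewrite big_distrl /= -[size Y]count_predT mulnC -iter_addn_0 -big_const_seq.
  rewrite big_seq [leqRHS]big_seq; apply: leq_sum => y yY; by have [] := he y yY.
have g30 : growth (30 * r) <= M * growth r.
  apply: leq_trans dbl; apply: uniq_leq_size; first exact: uniq_wball.
  by apply: wball_leq; rewrite leq_mul2r orbT.
have YM : size Y <= M by rewrite -(leq_pmul2r (gpos r)).
rewrite -(leq_pmul2r (gpos r)) -mulnA mulnn; apply: leq_trans cnt2 _.
apply: leq_trans (_ : M * (size H * (growth s * (M * growth r) * (30 * r).+1)) <= _).
  by rewrite leq_mul // leq_mul2l leq_mul2r leq_mul2l g30 !orbT.
by rewrite -mulnn; apply/eq_leq; ring.
Qed.

End AvoidingTemplates.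

(** Otherwise [g] would be multiplied by more than [121 ^ d.+1] at each of the scales
    [121 ^ j * r0.+1], beyond degree [d]. The number 121 is [1 + 2 * 60]: the balls of radius [r]
    around points at distance at most [2 * (60 * r)] lie in the ball of radius [121 * r]. *)
Lemma doubling_scale (g : nat -> nat) (c d : nat) : (forall n, 0 < g n) ->
  (forall n, 0 < n -> g n <= c * n ^ d) ->
  forall r0, exists r, [/\ r0 <= r, 0 < r & g (121 * r) <= 121 ^ d.+1 * g r].
Proof.
move=> g0 gpol r0; apply: contrapT => nex; set K := 121 in nex.
have step r : r0 <= r -> 0 < r -> K ^ d.+1 * g r < g (K * r).
  by move=> rr r_0; rewrite ltnNge; apply/negP => h; apply: nex; exists r.
have grow j : (K ^ d.+1) ^ j <= g (K ^ j * r0.+1).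
  elim: j => [|j IH]; first by rewrite expn0.
  rewrite expnS (expnS K j) -(mulnA K); apply: leq_trans (ltnW (step _ _ _)).
  - by rewrite leq_mul2l IH orbT.
  - by apply: leq_trans (leq_pmull _ _); rewrite ?expn_gt0 // leqnSn.
  - by rewrite muln_gt0 expn_gt0.
set j := c * r0.+1 ^ d.
have h : (K ^ d.+1) ^ j <= c * (K ^ j * r0.+1) ^ d.
  by apply: leq_trans (grow j) (gpol _ _); rewrite muln_gt0 expn_gt0.
have e1 : (K ^ d.+1) ^ j = K ^ j * (K ^ j) ^ d by rewrite -!expnM -expnD mulSn (mulnC d).
have e2 : c * (K ^ j * r0.+1) ^ d = j * (K ^ j) ^ d by rewrite expnMn mulnCA mulnC.
by move: h; rewrite e1 e2 leq_pmul2r ?expn_gt0 // leqNgt ltn_expl.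
Qed.

Section PolynomialGrowth.
Variables (Gam : groupType) (S : seq Gam).
Hypothesis genS : generates S.
Local Open Scope group_scope.

Lemma word_ball_leq (T : seq Gam) m n : (m <= n)%N -> word_ball T m `<=` word_ball T n.
Proof. by move=> mn g [s [sm sT ->]]; exists s; split=> //; apply: leq_trans mn. Qed.

Lemma word_ballM (T : seq Gam) m n g h : word_ball T m g -> word_ball T n h ->
  word_ball T (m + n) (g * h).
Proof.
move=> [s [sm sT ->]] [t [tn tT ->]]; exists (s ++ t); split.
- by rewrite size_cat leq_add.
- by move=> x; rewrite mem_cat => /orP[/sT|/tT].
- by rewrite big_cat.
Qed.

Lemma wball_polynomial : polynomial_growth Gam ->
  exists c d, forall n, (0 < n)%N -> (size (wball S n) <= c * n ^ d)%N.
Proof.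
move=> [T [genT [c [d hcd]]]].
have [L hL] : exists L, forall l, l \in letters S -> word_ball T L l.
  have [|m n l mn|l _|L hL] := @finite_bound _ [set` letters S] (fun n l => word_ball T n l).
  - exact: finite_seq.
  - exact: word_ball_leq.
  - exact: genT.
  by exists L.
have sub n g : g \in wball S n -> word_ball T (L.+1 * n) g.
  elim: n g => [|n IH] g; first by rewrite inE => /eqP ->; exists [::]; rewrite big_nil.
  rewrite /= mem_undup mem_cat => /orP[/IH|/allpairsP[[l h] /= [ll /IH hn ->]]].
    by apply: word_ball_leq; rewrite leq_mul2l leqnSn orbT.
  rewrite mulnS; apply: word_ballM hn; apply: word_ball_leq (hL _ ll); exact: leqnSn.
(* With [L.+1] instead of [L] the radius is positive, as the growth bound requires. *)
exists (c * L.+1 ^ d)%N, d => n n0; rewrite -mulnA -expnMn -card_le_II.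
apply: card_le_trans (hcd (L.+1 * n)%N _); last by rewrite muln_gt0.
have inj : {in `I_(size (wball S n)) &, injective (nth 1 (wball S n))}.
  by move=> i j; rewrite !inE /= => ii jj /eqP; rewrite nth_uniq ?uniq_wball // => /eqP.
have := inj_card_eq inj; rewrite card_eq_le => /andP[_ h].
apply: card_le_trans h _; apply: subset_card_le => _ [i ii <-]; apply: sub.
exact: mem_nth.
Qed.

Hypothesis len_ex : forall n, exists g : Gam, len genS g = n.
Hypothesis quad : forall n, (n.+1 * n.+2 <= 2 * size (wball S n))%N.
Variables c d : nat.
Hypothesis pol : forall n, (0 < n)%N -> (size (wball S n) <= c * n ^ d)%N.
Local Notation growth n := (size (wball S n)).
Let M := (121 ^ d.+1)%N.

(** A further ring can be chosen to hit at most a proportion [k / r.+2] of the points hit by all the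
    previous ones. After [d.+1] rings fewer than one point of a ball of size at most
    [c * (2 * r) ^ d] is left, once [r] is large. *)
Lemma avoiding_family s : exists r Rs, [/\ (0 < r)%N, (s <= r)%N,
  (growth (121 * r) <= M * growth r)%N, size Rs = d.+1 &
  (forall R, R \in Rs -> group_template S (wball S (60 * r)) R) /\
  forall h, h \in wball S (2 * r) -> exists2 R, R \in Rs & ~~ hit S s R h].
Proof.
(* The factor 60 is 30 from the length of the links times 2 from the quadratic lower bound on
   growth. *)
pose k := (60 * growth s * M ^ 2)%N.
have gpos n : (0 < growth n)%N by case: (wball S n) (wball1 S n).
have [r [rr r0 dbl]] := doubling_scale gpos pol (s + k ^ d.+1 * c * 2 ^ d).
have sr : (s <= r)%N by apply: leq_trans rr; exact: leq_addr.
pose H Rs := [seq h <- wball S (2 * r) | all (fun R => hit S s R h) Rs].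
have [Rs [szR tR HR]] : exists Rs, [/\ size Rs = d.+1,
    forall R, R \in Rs -> group_template S (wball S (60 * r)) R &
    (size (H Rs) * r.+2 ^ d.+1 <= k ^ d.+1 * growth (2 * r))%N].
  elim: (d.+1) => [|e [Rs [szR tR HR]]].
    by exists [::]; split=> //; rewrite !expn0 muln1 mul1n size_filter count_size.
  have [|R [tmpl hc]] := @avoiding_template _ _ genS len_ex r s M (H Rs) r0 sr _ dbl.
    by move=> h; rewrite mem_filter => /andP[].
  exists (R :: Rs); split; first by rewrite /= szR.
    by move=> R'; rewrite inE => /orP[/eqP ->//|]; apply: tR.
  have -> : size (H (R :: Rs)) = count (hit S s R) (H Rs).
    by rewrite -size_filter /H -filter_predI; congr size; apply: eq_filter => h.
  have le1 : (count (hit S s R) (H Rs) * r.+2 <= k * size (H Rs))%N.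
    rewrite -(leq_pmul2l (ltn0Sn r)); have := quad r; move: hc.
    move: (count _ _) (size (H Rs)) => x y hc hq.
    have : (x * (r.+1 * r.+2) <= x * (2 * growth r))%N by rewrite leq_mul2l hq orbT.
    have : (y * (growth s * M ^ 2 * (30 * r).+1) <= y * (growth s * M ^ 2 * (30 * r.+1)))%N.
      by rewrite !leq_mul2l; apply/orP; right; apply/orP; right; lia.
    by move: hc; rewrite /k; move: (M ^ 2)%N (growth s) (growth r); clear; nia.
  rewrite !expnS mulnA; apply: leq_trans (_ : k * size (H Rs) * r.+2 ^ e <= _)%N.
    by rewrite leq_mul2r le1 orbT.
  by rewrite -(mulnA k (size _)) -(mulnA k (k ^ e)%N) leq_mul2l HR orbT.
exists r, Rs; split=> //; split=> // h hW.
have H0 : size (H Rs) = 0%N.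
  apply/eqP; rewrite -leqn0 leqNgt; apply/negP => Hpos.
  have g2 := pol (n := (2 * r)%N); rewrite muln_gt0 r0 expnMn in g2; have {}g2 := g2 isT.
  have : (r.+2 ^ d.+1 <= r * r ^ d)%N.
    apply: leq_trans (_ : size (H Rs) * r.+2 ^ d.+1 <= _)%N; first exact: leq_pmull.
    apply: leq_trans HR _; apply: leq_trans (_ : k ^ d.+1 * (c * (2 ^ d * r ^ d)) <= _)%N.
      by rewrite leq_mul2l g2 orbT.
    by rewrite !mulnA leq_mul2r; apply/orP; right; apply: leq_trans rr; exact: leq_addl.
  by rewrite -expnS leqNgt ltn_exp2r // ltnS leqnSn.
apply: contrapT => nex; have : h \in H Rs.
  rewrite mem_filter hW andbT; apply/allP => R RRs; apply: contrapT => /negP nh.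
  by apply: nex; exists R.
by rewrite (size0nil H0).
Qed.

End PolynomialGrowth.

(** * Covering by boundedly many layers *)

Section PolynomialTree.
Variables (X : ptopologicalType) (adj : X -> X -> Prop) (U : nat -> set X).
Variables (Gam : groupType) (S : seq Gam) (a : Gam -> X -> X).
Hypothesis genS : generates S.
Hypothesis act : free_borel_action a.
Hypothesis sch : forall x y, adj x y <-> x <> y /\ exists2 s, s \in S & y = a s x \/ x = a s y.
Hypothesis en : enumerated adj U (act_nb S a).
Hypothesis Ubase : countable_base U.
Local Notation layer := (layer adj (act_nb S a)).
Local Notation growth n := (size (wball S n)).

(** In each round, a maximal discrete set of centres is taken among the points far from all earlier
    centres. A point missed by [M.+1] rounds would see a centre of each of them within
    [2 * (60 * r)]; these are more than [2 * r] apart, against packing in the ball of radius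
    [121 * r]. *)
Lemma covering_centers r M : growth (121 * r) <= M * growth r ->
  exists C : nat -> set X, [/\ forall i, borel (C i),
    forall i, discrete_set adj (2 * (60 * r)) (C i) &
    forall x, exists i z, [/\ i < M.+1, C i z & nearby adj (2 * r) x z]].
Proof.
move=> dbl.
pose A (W : set X) : set X := [set x | forall z, nearby adj (2 * r) x z -> ~ W z].
have /choice[f hf] (W : set X) : exists C : set X, borel W -> [/\ borel C, C `<=` A W,
    discrete_set adj (2 * (60 * r)) C &
    forall x, A W x -> exists2 z, C z & nearby adj (2 * (60 * r)) x z].
  case: (pselect (borel W)) => bW; last by exists set0.
  have [|C [? ? ? ?]] := maximal_discrete en Ubase (A := A W) (2 * (60 * r)); last by exists C.
  apply: (borel_all_nearby en) => v; apply: borel_not.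
  exact: (borel_walk (en_borel en)).
pose fix W n : set X := if n is n'.+1 then W n' `|` f (W n') else set0.
have bW n : borel (W n).
  by elim: n => [|n IH]; [exact: borel_cst|have [bf _ _ _] := hf _ IH; apply: borel_or].
have Wmono i j : i < j -> f (W i) `<=` W j.
  move=> /subnK <-; elim: (j - i.+1) => [|k IH] x fx; first by right.
  by left; apply: IH.
exists (fun n => f (W n)); split=> [i|i|x].
- by have [] := hf _ (bW i).
- by have [] := hf _ (bW i).
apply: contrapT => nex.
have Ax i : i < M.+1 -> A (W i) x.
  move=> iM z xz Wz; have [j ji fz] : exists2 j, j < i & f (W j) z.
    elim: i {iM} Wz => [//|i IH] [/IH[j ji fz]|fz]; last by exists i.
    by exists j => //; apply: ltnW.
  by apply: nex; exists j, z; split=> //; apply: ltn_trans ji iM.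
have /choice[g hg] i : exists g : Gam, i < M.+1 -> f (W i) (a g x) /\ g \in wball S (2 * (60 * r)).
  case: (ltnP i M.+1) => iM; last by exists 1%g.
  have [_ _ _ mx] := hf _ (bW i); have [z fz /(nearby_ball act sch)[g gW ez]] := mx x (Ax i iM).
  by exists g => _; rewrite -ez.
have far i j : i < j -> j < M.+1 -> (g j * (g i)^-1)%g \notin wball S (2 * r).
  move=> ij jM; apply/negP => gij; have [_ sub _ _] := hf _ (bW j).
  have [fj _] := hg j jM; have [fi _] := hg i (ltn_trans ij jM).
  apply: (sub _ fj (a (g i) x)); last exact: Wmono ij _ fi.
  apply/(nearby_ball act sch); exists ((g j * (g i)^-1)^-1)%g; first exact: wballV.
  by rewrite -(actM act) invgM invgK mulgVK.
have inj i j : i < M.+1 -> j < M.+1 -> (g j * (g i)^-1)%g \in wball S (2 * r) -> i = j.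
  move=> iM jM gij; case: (ltngtP i j) => // ij; first by have := far _ _ ij jM; rewrite gij.
  by have := far _ _ ij iM; have := wballV gij; rewrite invgM invgK => ->.
pose N := [seq g i | i <- iota 0 M.+1].
have uN : uniq N.
  rewrite map_inj_in_uniq ?iota_uniq // => i j; rewrite !mem_iota => /andP[_ iM] /andP[_ jM] e.
  by apply: inj => //; rewrite e mulgV wball1.
have sN : spread S (r + r) N.
  move=> _ _ /mapP[i + ->] /mapP[j + ->]; rewrite !mem_iota => /andP[_ iM] /andP[_ jM].
  by rewrite addnn -mul2n => /(inj i j iM jM) ->.
have NF : {subset N <= wball S (2 * (60 * r))}.
  by move=> _ /mapP[i + ->]; rewrite mem_iota => /andP[_ /hg[]].
have := spread_size uN NF sN; rewrite size_map size_iota; apply/negP; rewrite -ltnNge.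
apply: leq_ltn_trans (_ : M * growth r < _); last first.
  by rewrite ltn_mul2r ltnSn andbT; case: (wball S r) (wball1 S r).
apply: leq_trans dbl; apply: uniq_leq_size; first exact: undup_uniq.
move=> h /mem_thicken[k kW hk]; rewrite -[h](mulgVK k); apply: (@wball_leq _ S (r + 2 * (60 * r))).
  by lia.
exact: wballM.
Qed.

Hypothesis len_ex : forall n, exists g : Gam, len genS g = n.
Hypothesis quad : forall n, n.+1 * n.+2 <= 2 * growth n.
Hypothesis poly : polynomial_growth Gam.

(* [N] is chosen before [s]: the layers clearing radius [s] are distributed among
   [N] sequences of stages fixed in advance. *)
Lemma covering_layers : exists N, forall s, exists L : nat -> layer,
  forall x, exists2 i, i < N & cleared s [:: L i] x.
Proof.
have [c [d pol]] := wball_polynomial S poly.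
set M := 121 ^ d.+1; exists (M.+1 * d.+1) => s.
have [r [Rs [r0 sr dbl szR [tR hR]]]] := avoiding_family len_ex quad pol s.
have [C [bC dC cC]] := covering_centers dbl.
(* The index [i] codes a set of centres and a ring, by quotient and remainder modulo [d.+1]. *)
have /choice[L hL] i : exists L : layer, [/\ layer_set L = C (i %/ d.+1),
    forall y z, piece (act_nb S a) (layer_in L) y z <->
      exists2 g, g \in wball S (60 * r) & z = a g y &
    forall y z, piece (act_nb S a) (layer_ring L) y z <->
      exists2 g, g \in nth [::] Rs (i %% d.+1) & z = a g y].
  have tmpl : group_template S (wball S (60 * r)) (nth [::] Rs (i %% d.+1)).
    by apply: tR; apply: mem_nth; rewrite szR ltn_pmod.
  have [|L [? _ ? ?]] := group_layer act sch en tmpl (fun g h => h) (bC (i %/ d.+1)) _; last by exists L.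
  exact: dC.
exists L => x; have [i [y [iM Cy /(nearby_ball act sch)[g gW ey]]]] := cC x.
have [R RRs nhit] := hR _ (wballV gW).
have jd : index R Rs < d.+1 by rewrite -szR index_mem.
have [eS eP eR] := hL (i * d.+1 + index R Rs).
rewrite divnMDl // modnMDl modn_small // divn_small // addn0 nth_index // in eS eP eR.
exists (i * d.+1 + index R Rs).
  apply: leq_trans (_ : i.+1 * d.+1 <= _); last by rewrite leq_mul2r iM orbT.
  by rewrite mulSn addnC ltn_add2r.
apply: (cleared_layer (y := y)); first by rewrite eS.
move=> z /(nearby_ball act sch)[k kW ez].
have ezy : z = a (k * g^-1)%g y by rewrite (actM act) ey (actK act).
split.
  apply/eP; exists (k * g^-1)%g => //; have := wballM kW (wballV gW); apply: wball_leq; lia.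
move=> /eR[g' g'R]; rewrite ezy => /(act_inj act) e; move/negP: nhit; apply.
by apply/hasP; exists g' => //; rewrite -e mulgK.
Qed.

(** All sequences share the bound [D n], the maximum of their diameters, so one covering serves them
    all at time [n]. Each point is cleared at every time in some sequence, hence infinitely often in
    one of them by the pigeonhole principle; the domains cover the space and the maps are glued. *)
Lemma polynomial_map : exists f, one_ended_map adj setT f.
Proof.
have [N /choice[L hL]] := covering_layers.
pose Dm (c : nat -> seq layer) := \max_(i < N) stage_diam (c i).
pose fix c n : nat -> seq layer := if n is n'.+1
  then fun i => c n' i ++ [:: L (clear_radius n' (Dm (c n'))) i] else fun=> [::].
pose D n := Dm (c n); pose st i n := [:: L (clear_radius n (D n)) i].
have cumE i n : cumul (st i) n = c n i by elim: n => //= n ->.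
have Dge i n : i < N -> stage_diam (cumul (st i) n) <= D n.
  by move=> iN; rewrite cumE; apply: (leq_bigmax (Ordinal iN)).
pose Z i := stage_domain (st i) D.
have [f hf] : exists f, one_ended_map adj [set x | exists2 i, i < N & Z i x] f.
  apply: (one_ended_map_glue en) => i iN.
  - exact: (borel_stage_domain en).
  - exact: (stage_domain_inv en).
  - exact: (stage_map en (fun n => Dge i n iN)).
exists f; rewrite (_ : setT = [set x | exists2 i, i < N & Z i x]) //.
apply/seteqP; split=> // x _; apply: contrapT => nZ.
have [|m n i mn h1 l nl|i iN|m hm] := @finite_bound _ [set` iota 0 N]
    (fun m i => forall n, m <= n -> ~ cleared (clear_radius n (D n)) (st i n) x).
- exact: finite_seq.
- by apply: h1; apply: leq_trans mn nl.
- apply: contrapT => nex; apply: nZ; exists i; first by move: iN; rewrite /= mem_iota.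
  apply: (stage_domain_ex (fun n => Dge i n _)); first by move: iN; rewrite /= mem_iota.
  move=> m; apply: contrapT => nm; apply: nex; exists m => n mn cn; apply: nm; by exists n.
have [i iN ci] := hL (clear_radius m (D m)) x.
by apply: (hm i _ m _ ci) => //=; rewrite mem_iota.
Qed.

End PolynomialTree.

Local Open Scope ring_scope.

Theorem theorem1p1 (R : realType) (X : ptopologicalType) (hX : polish R X)
    (mu : probability (g_sigma_algebraType (@open X)) R)
    (G : sgraph X) (hG : borel_graph G) (hlf : locally_finite_graph G)
    (hoe : one_ended_graph G) :
  [/\ exists X' : set X,
        [/\ graph_invariant G X', comeagre X', borel X' &
            admits_borel_one_ended_spanning_tree (induced_sgraph G X')],
      (forall Gam : groupType, amenable Gam R ->
         induced_by_free_borel_action Gam G ->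
         exists X' : set X,
           [/\ graph_invariant G X', borel X', mu (~` X') = 0%E &
               admits_borel_one_ended_spanning_tree (induced_sgraph G X')]) &
      (forall Gam : groupType, polynomial_growth Gam ->
         induced_by_free_borel_action Gam G ->
         admits_borel_one_ended_spanning_tree G)].
Proof.
have [d [q [dd qdense]]] := polish_data hX; have [GT bE] := hG.
have Ubase := rational_ball_base dd qdense.
have act_en (Gam : groupType) (S : seq Gam) (a : Gam -> X -> X) (act : free_borel_action a)
    (sch : schreier_graph_of a S G) :
    enumerated (fun x y => adj G x y) (rational_ball d q) (act_nb S a).
  apply: (graph_enumerated dd qdense GT hlf hoe).
  - by move=> i; exact: (borel_act act).
  - exact: (act_nb_ex act sch).
  - exact: (act_nb_or act sch).
split.
- exact: (generic_tree dd qdense GT hlf hoe bE).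
- move=> Gam am [S [a [genS act sch]]].
  have quad := act_wball_quadratic GT hlf hoe genS act sch.
  exact: (amenable_tree mu GT Ubase genS act sch (act_en _ _ _ act sch) quad am).
- move=> Gam poly [S [a [genS act sch]]]; have en := act_en _ _ _ act sch.
  have len_ex := act_len_ex GT hlf hoe genS act sch.
  have quad := act_wball_quadratic GT hlf hoe genS act sch.
  have [f hf] := polynomial_map act sch en Ubase len_ex quad poly.
  exact: (one_ended_map_treeT GT en hf).
Qed.
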